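(* Let $k$ be a field with $\operatorname{char}(k)\neq 2,3$, with algebraic closure $\bar k$, let $S\subset\mathbb{P}^3_k$ be a geometrically smooth quartic surface, and let $\ell$ be a line on $S$ (all lines are taken over $\bar k$). (a) The line $\ell$ intersects at most $20$ other lines on $S$. (b) If $\ell$ meets more than $18$ other lines on $S$, then, in suitable homogeneous coordinates $x_1,x_2,x_3,x_4$ over $\bar k$ in which $\ell=\{x_3=x_4=0\}$, the surface $S$ is given by a quartic polynomial of the form $$x_3x_1^3+x_4x_2^3+x_1x_2\,q(x_3,x_4)+x_3\,g(x_3,x_4),$$ where $q,g\in\bar k[x_3,x_4]$ are homogeneous of degree $2$ and $3$, respectively. (c) If $S$ is given by a polynomial of the form in (b) and $\ell=\{x_3=x_4=0\}$, then $\ell$ meets $20$ other lines on $S$ if and only if $x_4\mid g$.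
   Context: Geometrically smooth means that the base change of $S$ to $\bar k$ is smooth. A line on $S$ is a line in $\mathbb{P}^3$ contained in $S$. *)

(* Defs.v *)
From HB Require Import structures.
From mathcomp Require Import all_boot all_order all_algebra.
From mathcomp Require Import classical_sets functions cardinality.
From mathcomp Require Import mpoly.

Set Implicit Arguments.
Unset Strict Implicit.
Unset Printing Implicit Defensive.

Import GRing.Theory.
Local Open Scope ring_scope.

(* Points of P^3 over K are represented by nonzero vectors of 'rV[K]_4, and
   lines in P^3 by the 2-dimensional subspaces of 'rV[K]_4. The surface is given
   by its quartic form. *)

Definition form_at (K : fieldType) (F : {mpoly K[4]}) (v : 'rV[K]_4) : K :=
  F.@[fun i => v 0 i].

(* Only meant for an algebraically closed K, where the K-points suffice. *)
Definition smooth_surface (K : fieldType) (F : {mpoly K[4]}) : Prop :=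
  forall v : 'rV[K]_4, v != 0 -> form_at F v = 0 ->
    exists i : 'I_4, form_at F^`M(i) v != 0.

Definition geometrically_smooth (k K : fieldType) (iota : {rmorphism k -> K})
    (F : {mpoly k[4]}) : Prop :=
  smooth_surface (map_mpoly iota F).

Definition line_on (K : fieldType) (F : {mpoly K[4]})
    (L : {vspace 'rV[K]_4}) : Prop :=
  \dim L = 2 /\ (forall v : 'rV[K]_4, v \in L -> form_at F v = 0).

Definition lines_meet (K : fieldType) (L M : {vspace 'rV[K]_4}) : Prop :=
  exists v : 'rV[K]_4, [/\ v != 0, v \in L & v \in M].

Definition other_lines_meeting (K : fieldType) (F : {mpoly K[4]})
    (L : {vspace 'rV[K]_4}) : set {vspace 'rV[K]_4} :=
  fun M => [/\ line_on F M, M <> L & lines_meet L M].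

(* The indices 0, 1, 2, 3 stand for the coordinates x_1, x_2, x_3, x_4; the two
   variables of q and g are x_3 and x_4, in this order. *)
Definition normal_form (K : fieldType) (q g : {mpoly K[2]}) : {mpoly K[4]} :=
  let x1 := 'X_(0 : 'I_4) in let x2 := 'X_(1 : 'I_4) in
  let x3 := 'X_(2 : 'I_4) in let x4 := 'X_(3 : 'I_4) in
  x3 * x1 ^+ 3 + x4 * x2 ^+ 3 + x1 * x2 * (q \mPo [tuple x3; x4])
    + x3 * (g \mPo [tuple x3; x4]).

(* An invertible A gives the homogeneous coordinates v |-> v *m A, whose i-th
   component is the linear form below. *)
Definition coordinate_form (K : fieldType) (A : 'M[K]_4) (i : 'I_4) :
    {mpoly K[4]} :=
  \sum_(j < 4) A j i *: 'X_j.

(* The equation of a surface is determined up to a nonzero scalar c only. *)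
Definition has_normal_form (K : fieldType) (F : {mpoly K[4]})
    (L : {vspace 'rV[K]_4}) (q g : {mpoly K[2]}) : Prop :=
  exists (A : 'M[K]_4) (c : K),
    [/\ A \in unitmx, c != 0,
        F = c *: (normal_form q g \mPo [tuple coordinate_form A i | i < 4])
      & forall v : 'rV[K]_4,
          v \in L <-> (v *m A) 0 2 = 0 /\ (v *m A) 0 3 = 0].

(* Main.v *)
(* Choose coordinates with L = {x3 = x4 = 0}.  The tangent plane of the surface at a point
   P = (x : 1 : 0 : 0) of L cuts out L and a residual cubic through P.  A line of the surface
   through P is a line component of that cubic, so P is a flex of it; this is a polynomial
   condition R(x) = 0 of degree 18, and R vanishes at P to an order at least the number of
   lines through P.  Hence at most 18 lines meet L unless R = 0.

   If R = 0, the flex tangent at P moves rationally with P, and it lies on the surface at the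
   roots of a polynomial N.  The map from L to the pencil of planes through L has degree 3, and
   N has degree 12 + 3k, where k is the number of its total ramification points; N is nonzero
   because at a simple ramification point a line would force a double line in a plane section,
   which a smooth surface does not have.  For k <= 1 this leaves at most 18 lines.  For k = 2
   the two cubes can be taken as x1^3 and x2^3, and R = 0 lets one complete the cubes to
   x3 x1^3 + x4 x2^3 + x1 x2 q(x3, x4) + G(x3, x4).

   There the lines meeting L outside the two ramification points come from the zeros of
   q^3 + 27 x3 x4 G, with three lines over each zero; counting them together with the lines
   through the ramification points gives at most 18 + [x3 | G] + [x4 | G], with equality, by
   smoothness, when both divide G. *)

Require Import Defs.
From HB Require Import structures.
From mathcomp Require Import all_boot all_order all_algebra all_field.
From mathcomp Require Import ring zify.
From mathcomp Require boolp.
From mathcomp Require Import classical_sets functions cardinality.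
From mathcomp Require Import mpoly.

Set Implicit Arguments.
Unset Strict Implicit.
Unset Printing Implicit Defensive.

Import GRing.Theory.
Local Open Scope ring_scope.

(** * Quartic forms vanishing on x3 = x4 = 0 *)

(** Lines are counted in the affine coordinate x of the given line. The frame is first chosen so
    that (1 : 0 : 0 : 0) is unramified and lies on no counted line; nothing is then lost at
    infinity. Termwise estimates of degrees are too weak: they give 19 for R and 15 + 3k for N, and
    the bounds needed come from cancellations, of leading terms in R and along the flex tangent in
    N. A total ramification point is a double root of J, which has degree 4. With at most one such
    point a simple root therefore remains, and this is where N is shown to be nonzero. The total
    ramification point itself is kept apart from N and carries at most three lines, whence 12 + 3k +
    3k. The normal form needs a frame of another kind, with the two total ramification points at
    zero and infinity. The flex condition is carried there point by point, as contact of order four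
    is independent of coordinates, and lines through the point at infinity are counted after
    exchanging the coordinates. *)

(* The form [s a(x, y) + t b(x, y) + A(s, t) x^2 + B(s, t) x y + C(s, t) y^2
   + U(s, t) x + V(s, t) y + G(s, t)], where [a, b, U, V] are cubic, [A, B, C] quadratic and
   [G] is quartic.  Each sequence lists the coefficients of a binary form, by increasing powers
   of its second variable; the later entries are irrelevant. *)
Record quartic (R : Type) := Quartic {
  cfa : nat -> R; cfb : nat -> R;
  cfA : nat -> R; cfB : nat -> R; cfC : nat -> R;
  cfU : nat -> R; cfV : nat -> R; cfG : nat -> R }.

Definition map_quartic (R S : Type) (f : R -> S) (c : quartic R) : quartic S :=
  Quartic (f \o cfa c) (f \o cfb c) (f \o cfA c) (f \o cfB c) (f \o cfC c)
          (f \o cfU c) (f \o cfV c) (f \o cfG c).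

Section Forms.
Variable R : comNzRingType.
Implicit Types (a : nat -> R) (c : quartic R) (x y s t : R).

(** Stated over any commutative ring, because the same formulas are used at a point, with entries
    polynomial in the coordinate of the line, and with linear forms in four variables. *)
Definition quad a x y : R := a 0 * x ^+ 2 + a 1 * x * y + a 2 * y ^+ 2.
Definition cubic a x y : R :=
  a 0 * x ^+ 3 + a 1 * x ^+ 2 * y + a 2 * x * y ^+ 2 + a 3 * y ^+ 3.
Definition biquad a x y : R :=
  a 0 * x ^+ 4 + a 1 * x ^+ 3 * y + a 2 * x ^+ 2 * y ^+ 2 + a 3 * x * y ^+ 3
  + a 4 * y ^+ 4.

Definition quad_x a x y : R := 2 * a 0 * x + a 1 * y.
Definition quad_y a x y : R := a 1 * x + 2 * a 2 * y.
Definition cubic_x a x y : R := 3 * a 0 * x ^+ 2 + 2 * a 1 * x * y + a 2 * y ^+ 2.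
Definition cubic_y a x y : R := a 1 * x ^+ 2 + 2 * a 2 * x * y + 3 * a 3 * y ^+ 2.
Definition cubic_xx a x y : R := 6 * a 0 * x + 2 * a 1 * y.
Definition biquad_x a x y : R :=
  4 * a 0 * x ^+ 3 + 3 * a 1 * x ^+ 2 * y + 2 * a 2 * x * y ^+ 2 + a 3 * y ^+ 3.
Definition biquad_y a x y : R :=
  a 1 * x ^+ 3 + 2 * a 2 * x ^+ 2 * y + 3 * a 3 * x * y ^+ 2 + 4 * a 4 * y ^+ 3.

Definition quart c x y s t : R :=
  s * cubic (cfa c) x y + t * cubic (cfb c) x y
  + (quad (cfA c) s t * x ^+ 2 + quad (cfB c) s t * x * y + quad (cfC c) s t * y ^+ 2)
  + (cubic (cfU c) s t * x + cubic (cfV c) s t * y) + biquad (cfG c) s t.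

Definition quart_1 c x y s t : R :=
  s * cubic_x (cfa c) x y + t * cubic_x (cfb c) x y
  + (2 * quad (cfA c) s t * x + quad (cfB c) s t * y) + cubic (cfU c) s t.
Definition quart_2 c x y s t : R :=
  s * cubic_y (cfa c) x y + t * cubic_y (cfb c) x y
  + (quad (cfB c) s t * x + 2 * quad (cfC c) s t * y) + cubic (cfV c) s t.
Definition quart_3 c x y s t : R :=
  cubic (cfa c) x y
  + (quad_x (cfA c) s t * x ^+ 2 + quad_x (cfB c) s t * x * y + quad_x (cfC c) s t * y ^+ 2)
  + (cubic_x (cfU c) s t * x + cubic_x (cfV c) s t * y) + biquad_x (cfG c) s t.
Definition quart_4 c x y s t : R :=
  cubic (cfb c) x y
  + (quad_y (cfA c) s t * x ^+ 2 + quad_y (cfB c) s t * x * y + quad_y (cfC c) s t * y ^+ 2)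
  + (cubic_y (cfU c) s t * x + cubic_y (cfV c) s t * y) + biquad_y (cfG c) s t.

Definition gradient_zero c x y s t : Prop :=
  [/\ quart_1 c x y s t = 0, quart_2 c x y s t = 0,
      quart_3 c x y s t = 0 & quart_4 c x y s t = 0].

Lemma quart_euler c x y s t :
  x * quart_1 c x y s t + y * quart_2 c x y s t + s * quart_3 c x y s t
  + t * quart_4 c x y s t = 4 * quart c x y s t.
Proof.
rewrite /quart_1 /quart_2 /quart_3 /quart_4 /quart /quad_x /quad_y /cubic_x /cubic_y
  /biquad_x /biquad_y /quad /cubic /biquad; ring.
Qed.

(* Expansion of the form at [(u x + n : u : s : t)] by powers of [u]: up to factors 2, the
   coefficients are [cres], [cJ n + cQ], [cE n^2 + 2 cY n + 2 cL] and [top_cubic]. *)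
Definition cres c x s t : R := s * cubic (cfa c) x 1 + t * cubic (cfb c) x 1.
Definition cJ c x s t : R := s * cubic_x (cfa c) x 1 + t * cubic_x (cfb c) x 1.
Definition cE c x s t : R := s * cubic_xx (cfa c) x 1 + t * cubic_xx (cfb c) x 1.
Definition cK c s t : R := s * cfa c 0 + t * cfb c 0.
Definition cQ c x s t : R :=
  quad (cfA c) s t * x ^+ 2 + quad (cfB c) s t * x + quad (cfC c) s t.
Definition cY c x s t : R := 2 * quad (cfA c) s t * x + quad (cfB c) s t.
Definition cL c x s t : R := cubic (cfU c) s t * x + cubic (cfV c) s t.

(** The residual cubic of the plane through the line and (0 : 0 : s : t), with (x : y : z) standing
    for the point (x : y : z s : z t). *)
Definition plane_cubic c s t x y z : R :=
  s * cubic (cfa c) x y + t * cubic (cfb c) x y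
  + z * (quad (cfA c) s t * x ^+ 2 + quad (cfB c) s t * x * y + quad (cfC c) s t * y ^+ 2)
  + z ^+ 2 * (cubic (cfU c) s t * x + cubic (cfV c) s t * y) + z ^+ 3 * biquad (cfG c) s t.

Definition top_cubic c s t m p : R :=
  cK c s t * m ^+ 3 + quad (cfA c) s t * m ^+ 2 * p + cubic (cfU c) s t * m * p ^+ 2
  + biquad (cfG c) s t * p ^+ 3.

Lemma plane_cubic_pencil c s t x u m p :
  2 * plane_cubic c s t (u * x + m) u p =
  2 * u ^+ 3 * cres c x s t + 2 * u ^+ 2 * (cJ c x s t * m + cQ c x s t * p)
  + u * (cE c x s t * m ^+ 2 + 2 * cY c x s t * m * p + 2 * cL c x s t * p ^+ 2)
  + 2 * top_cubic c s t m p.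
Proof.
rewrite /plane_cubic /cres /cJ /cE /cK /cQ /cY /cL /top_cubic /cK.
move: (quad (cfA c) s t) (quad (cfB c) s t) (quad (cfC c) s t) => A B C.
move: (cubic (cfU c) s t) (cubic (cfV c) s t) (biquad (cfG c) s t) => U V G.
rewrite /cubic /cubic_x /cubic_xx; ring.
Qed.

Lemma quart_plane c s t x y z : quart c x y (z * s) (z * t) = z * plane_cubic c s t x y z.
Proof. rewrite /quart /plane_cubic /quad /cubic /biquad; ring. Qed.

End Forms.

(** * The flex condition along the line *)

Section DegreeBound.
Variable R : idomainType.
Implicit Types p q : {poly R}.

Definition deg_le (d : nat) p := (size p <= d.+1)%N.

Lemma deg_leW e d p : deg_le d p -> (d <= e)%N -> deg_le e p.
Proof. by rewrite /deg_le => h de; apply: leq_trans h _; rewrite ltnS. Qed.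
Lemma deg_leC a : deg_le 0 a%:P.
Proof. exact: size_polyC_leq1. Qed.
Lemma deg_le_nat n : deg_le 0 (n%:R : {poly R}).
Proof. by rewrite -polyC_natr; apply: deg_leC. Qed.
Lemma deg_le1 d : deg_le d (1 : {poly R}). Proof. by rewrite /deg_le size_poly1. Qed.
Lemma deg_leX : deg_le 1 ('X : {poly R}). Proof. by rewrite /deg_le size_polyX. Qed.
Lemma deg_leD d e p q : deg_le d p -> deg_le e q -> deg_le (maxn d e) (p + q).
Proof.
rewrite /deg_le => hp hq; apply: leq_trans (size_polyD _ _) _; lia.
Qed.
Lemma deg_leN d p : deg_le d p -> deg_le d (- p).
Proof. by rewrite /deg_le size_polyN. Qed.
Lemma deg_leM d e p q : deg_le d p -> deg_le e q -> deg_le (d + e) (p * q).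
Proof.
rewrite /deg_le => hp hq; apply: leq_trans (size_polyMleq _ _) _; lia.
Qed.
Lemma deg_leXn d n p : deg_le d p -> deg_le (n * d) (p ^+ n).
Proof.
move=> hp; elim: n => [|n ih]; first by rewrite expr0 mul0n; apply: deg_leC.
by rewrite exprS mulSn; apply: deg_leM.
Qed.
End DegreeBound.

(** Meant for a goal whose degree is still an existential variable, opened by [deg_leW]: a bound is
    synthesised from the shape of the polynomial. Proofs generalise subterms of known degree
    beforehand, so that the hypotheses on them apply. *)
Ltac deg_bound :=
  repeat (lazymatch goal with
  | h : is_true (deg_le _ ?p) |- is_true (deg_le _ ?p) => exact h
  | |- is_true (deg_le _ (_ + _)) => apply: deg_leD
  | |- is_true (deg_le _ (- _)) => apply: deg_leN
  | |- is_true (deg_le _ (_ * _)) => apply: deg_leM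
  | |- is_true (deg_le _ (_ ^+ _)) => apply: deg_leXn
  | |- is_true (deg_le _ (_%:P)) => apply: deg_leC
  | |- is_true (deg_le _ 'X) => apply: deg_leX
  | |- is_true (deg_le _ (_%:R)) => apply: deg_le_nat
  end).

(** Every repetition in [xs] is paid for by a multiplicity in [p]. The lemma is applied to the list
    of points where lines meet the given one, in which a point occurs once for each line through
    it. *)
Lemma size_roots_lt (K : closedFieldType) (p : {poly K}) (xs : seq K) :
  p != 0 -> (forall x, ('X - x%:P) ^+ count_mem x xs %| p) -> (size xs < size p)%N.
Proof.
move=> p0 dv; have [rs Dp] := closed_field_poly_normal p.
have lp : lead_coef p != 0 by rewrite lead_coef_eq0.
have /count_subseqP[s ss ps] : forall x, (count_mem x xs <= count_mem x rs)%N.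
  move=> x; rewrite -(mu_prod_XsubC x rs) mup_geq ?monic_neq0 ?monic_prod_XsubC//.
  by rewrite -(dvdpZr _ _ lp) -Dp.
rewrite (perm_size ps) {1}Dp size_scale// size_prod_XsubC ltnS.
exact: size_subseq.
Qed.

Section Poly.
Variable K : closedFieldType.
Implicit Types (a : nat -> K) (p q : {poly K}) (x : K).

Notation "a ^P" := (polyC \o a) (at level 2).

Lemma horner_natr n x : (n%:R : {poly K}).[x] = n%:R.
Proof. by rewrite hornerMn hornerC. Qed.
Let hornerR := (hornerD, hornerN, hornerM, hornerC, hornerX, @horner_exp K, horner_natr).
Lemma horner_quad a p q x : (quad a^P p q).[x] = quad a p.[x] q.[x].
Proof. by rewrite /quad /= !hornerR. Qed.
Lemma horner_cubic a p q x : (cubic a^P p q).[x] = cubic a p.[x] q.[x].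
Proof. by rewrite /cubic /= !hornerR. Qed.
Lemma horner_biquad a p q x : (biquad a^P p q).[x] = biquad a p.[x] q.[x].
Proof. by rewrite /biquad /= !hornerR. Qed.
Lemma horner_cubic_x a p q x : (cubic_x a^P p q).[x] = cubic_x a p.[x] q.[x].
Proof. by rewrite /cubic_x /= !hornerR. Qed.
Lemma horner_cubic_xx a p q x : (cubic_xx a^P p q).[x] = cubic_xx a p.[x] q.[x].
Proof. by rewrite /cubic_xx /= !hornerR. Qed.

Definition hornerF := (hornerR, horner_quad, horner_cubic, horner_biquad,
  horner_cubic_x, horner_cubic_xx).

Lemma deg_quad a d p q : deg_le d p -> deg_le d q -> deg_le (2 * d) (quad a^P p q).
Proof.
move=> hp hq; rewrite /quad /=; apply: deg_leW; first by deg_bound.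
lia.
Qed.
Lemma deg_cubic a d p q : deg_le d p -> deg_le d q -> deg_le (3 * d) (cubic a^P p q).
Proof.
move=> hp hq; rewrite /cubic /=; apply: deg_leW; first by deg_bound.
lia.
Qed.
Lemma deg_biquad a d p q : deg_le d p -> deg_le d q -> deg_le (4 * d) (biquad a^P p q).
Proof.
move=> hp hq; rewrite /biquad /=; apply: deg_leW; first by deg_bound.
lia.
Qed.

Lemma deriv_cubic a : (cubic a^P 'X 1)^`() = cubic_x a^P 'X 1.
Proof. rewrite /cubic /cubic_x /= !derivE; ring. Qed.
Lemma deriv_cubic_x a : (cubic_x a^P 'X 1)^`() = cubic_xx a^P 'X 1.
Proof. rewrite /cubic_x /cubic_xx -!polyC_natr /= !derivE; ring. Qed.
Lemma deriv_cubic_xx a : (cubic_xx a^P 'X 1)^`() = (6 * a 0)%:P.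
Proof. rewrite /cubic_xx  /= -!polyC_natr !derivE polyCM; ring. Qed.

Variable c : quartic K.
Hypothesis (unram : cfa c 0 * cfb c 1 - cfa c 1 * cfb c 0 != 0).

Let cP := map_quartic polyC c.
(* The tangent plane at [(x : 1 : 0 : 0)] is spanned by the line and [(0 : 0 : s : t)] with
   [s = b(x, 1)] and [t = - a(x, 1)].  The prefix [f] stands for evaluation at this plane and [p]
   for the same expression as a polynomial in [x]; [J] is the Wronskian of [a] and [b], and
   [E] its derivative. *)
Definition sF x := cubic (cfb c) x 1.
Definition tF x := - cubic (cfa c) x 1.
Let sP : {poly K} := cubic (cfb cP) 'X 1.
Let tP : {poly K} := - cubic (cfa cP) 'X 1.

Definition fJ x := cJ c x (sF x) (tF x).
Definition fE x := cE c x (sF x) (tF x).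
Definition fQ x := cQ c x (sF x) (tF x).
Definition fY x := cY c x (sF x) (tF x).
Definition fL x := cL c x (sF x) (tF x).
Definition pJ : {poly K} := cJ cP 'X sP tP.
Definition pE : {poly K} := cE cP 'X sP tP.
Definition pQ : {poly K} := cQ cP 'X sP tP.
Definition pY : {poly K} := cY cP 'X sP tP.
Definition pL : {poly K} := cL cP 'X sP tP.

Lemma horner_sP x : sP.[x] = sF x. Proof. by rewrite /sP !hornerF. Qed.
Lemma horner_tP x : tP.[x] = tF x. Proof. by rewrite /tP !hornerF. Qed.
Lemma horner_cJ p u v x : (cJ cP p u v).[x] = cJ c p.[x] u.[x] v.[x].
Proof. by rewrite /cJ !hornerF. Qed.
Lemma horner_cE p u v x : (cE cP p u v).[x] = cE c p.[x] u.[x] v.[x].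
Proof. by rewrite /cE !hornerF. Qed.
Lemma horner_cQ p u v x : (cQ cP p u v).[x] = cQ c p.[x] u.[x] v.[x].
Proof. by rewrite /cQ !hornerF. Qed.
Lemma horner_cY p u v x : (cY cP p u v).[x] = cY c p.[x] u.[x] v.[x].
Proof. by rewrite /cY !hornerF. Qed.
Lemma horner_cL p u v x : (cL cP p u v).[x] = cL c p.[x] u.[x] v.[x].
Proof. by rewrite /cL !hornerF. Qed.
Lemma horner_top_cubic u v p q x :
  (top_cubic cP u v p q).[x] = top_cubic c u.[x] v.[x] p.[x] q.[x].
Proof. by rewrite /top_cubic /cK !hornerF. Qed.

Lemma horner_pJ x : pJ.[x] = fJ x.
Proof. by rewrite horner_cJ hornerX horner_sP horner_tP. Qed.
Lemma horner_pE x : pE.[x] = fE x.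
Proof. by rewrite horner_cE hornerX horner_sP horner_tP. Qed.
Lemma horner_pQ x : pQ.[x] = fQ x.
Proof. by rewrite horner_cQ hornerX horner_sP horner_tP. Qed.
Lemma horner_pY x : pY.[x] = fY x.
Proof. by rewrite horner_cY hornerX horner_sP horner_tP. Qed.
Lemma horner_pL x : pL.[x] = fL x.
Proof. by rewrite horner_cL hornerX horner_sP horner_tP. Qed.

Lemma deriv_sP : sP^`() = cubic_x (cfb c)^P 'X 1. Proof. exact: deriv_cubic. Qed.
Lemma deriv_tP : tP^`() = - cubic_x (cfa c)^P 'X 1.
Proof. by rewrite derivN; congr (- _); exact: deriv_cubic. Qed.

Lemma deriv_pJ : pJ^`() = pE.
Proof.
rewrite /pJ /cJ derivD !derivM deriv_sP deriv_tP /= !deriv_cubic_x /pE /cE /=.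
by ring.
Qed.

Lemma pJE : pJ = (cfa c 0 * cfb c 1 - cfa c 1 * cfb c 0)%:P * 'X ^+ 4
  + (2 * (cfa c 0 * cfb c 2 - cfa c 2 * cfb c 0))%:P * 'X ^+ 3
  + (3 * (cfa c 0 * cfb c 3 - cfa c 3 * cfb c 0)
     + (cfa c 1 * cfb c 2 - cfa c 2 * cfb c 1))%:P * 'X ^+ 2
  + (2 * (cfa c 1 * cfb c 3 - cfa c 3 * cfb c 1))%:P * 'X
  + (cfa c 2 * cfb c 3 - cfa c 3 * cfb c 2)%:P.
Proof.
rewrite !(polyCD, polyCN, polyCM, polyC_natr).
rewrite /pJ /cJ /cubic_x /sP /tP /cubic /=; ring.
Qed.

(** The coefficient of X^4 is the one that [unram] keeps nonzero: (1 : 0 : 0 : 0) is not a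
    ramification point, so no root of J escapes to infinity. *)
Lemma size_pJ : size pJ = 5%N.
Proof.
rewrite pJE -!addrA size_polyDl size_Cmul ?size_polyXn//.
set q := (X in size (polyseq X)); have : deg_le 3 q by apply: deg_leW; first by rewrite /q; deg_bound.
by [].
Qed.

(* Up to a constant, the Hessian determinant of the residual cubic at the point of the line. *)
Definition flexion (R : comNzRingType) (e j q y l : R) : R :=
  e * q ^+ 2 - 2 * j * q * y + 2 * j ^+ 2 * l.
Definition pR := flexion pE pJ pQ pY pL.

Lemma horner_flexion (e j q y l : {poly K}) x :
  (flexion e j q y l).[x] = flexion e.[x] j.[x] q.[x] y.[x] l.[x].
Proof. by rewrite /flexion !hornerR. Qed.

Lemma horner_pR x : pR.[x] = flexion (fE x) (fJ x) (fQ x) (fY x) (fL x).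
Proof.
by rewrite horner_flexion horner_pE horner_pJ horner_pQ horner_pY horner_pL.
Qed.

Lemma deg_sP : deg_le 3 sP.
Proof. by apply: (@deg_cubic (cfb c) 1); [apply: deg_leX | apply: deg_le1]. Qed.
Lemma deg_tP : deg_le 3 tP.
Proof. by apply: deg_leN; apply: (@deg_cubic (cfa c) 1); [apply: deg_leX | apply: deg_le1]. Qed.
Lemma deg_pJ : deg_le 4 pJ. Proof. by rewrite /deg_le size_pJ. Qed.
Lemma deg_quadP a : deg_le 6 (quad a^P sP tP).
Proof. exact: deg_quad deg_sP deg_tP. Qed.
Lemma deg_cubicP a : deg_le 9 (cubic a^P sP tP).
Proof. exact: deg_cubic deg_sP deg_tP. Qed.
Lemma deg_biquadP a : deg_le 12 (biquad a^P sP tP).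
Proof. exact: deg_biquad deg_sP deg_tP. Qed.
Lemma deg_pQ : deg_le 8 pQ.
Proof.
rewrite /pQ /cQ /=; have hA := deg_quadP (cfA c); have hB := deg_quadP (cfB c).
have hC := deg_quadP (cfC c).
by apply: deg_leW; first by deg_bound.
Qed.
Lemma deg_pL : deg_le 10 pL.
Proof.
rewrite /pL /cL /=; have hU := deg_cubicP (cfU c); have hV := deg_cubicP (cfV c).
by apply: deg_leW; first by deg_bound.
Qed.

(** Termwise the degree is 19. In E Q - 2 J Y, expanded along A, B, C, the only excess comes from
    the factor E X - 4 J of A, where the leading terms cancel because E is the derivative of the
    quartic J. *)
Lemma deg_pR : deg_le 18 pR.
Proof.
have hA := deg_quadP (cfA c); have hB := deg_quadP (cfB c); have hC := deg_quadP (cfC c).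
have -> : pR = pQ * (quad (cfA c)^P sP tP * 'X * (pE * 'X - 4 * pJ)
   + quad (cfB c)^P sP tP * (pE * 'X - 2 * pJ)
   + pE * quad (cfC c)^P sP tP) + 2 * pJ ^+ 2 * pL.
  rewrite /pR /flexion /pQ /pY /cQ /cY /=; ring.
have hE : deg_le 3 pE.
  have /lt_size_deriv : pJ != 0 by rewrite -size_poly_eq0 size_pJ.
  by rewrite size_pJ deriv_pJ.
have hEJ : deg_le 3 (pE * 'X - 4 * pJ).
  rewrite -deriv_pJ pJE !derivE /=.
  set j4 := (_ - _)%:P; set j3 := (2 * _)%:P; set j2 := (3 * _ + _)%:P.
  set j1 := (2 * _)%:P; set j0 := (_ - _)%:P.
  set q := (X in deg_le 3 X).
  have -> : q = - (j3 * 'X ^+ 3 + 2%:P * j2 * 'X ^+ 2 + 3%:P * j1 * 'X + 4%:P * j0).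
    by rewrite /q !polyC_natr; clear q; move: j4 j3 j2 j1 j0 => j4 j3 j2 j1 j0; ring.
  by rewrite /j3 /j2 /j1 /j0; apply: deg_leW; first by deg_bound.
have hQ := deg_pQ; have hJ := deg_pJ; have hL := deg_pL.
move: (pE * 'X - 4 * pJ) hEJ => D hEJ.
by apply: deg_leW; first by deg_bound.
Qed.

End Poly.

(** * Counting lines when the flex condition is nontrivial *)

Section Counting.
Variable K : closedFieldType.
Hypotheses (nz2 : 2 != 0 :> K) (nz3 : 3 != 0 :> K).
Implicit Types (p q : {poly K}) (x n : K).

Lemma double_root_factor p x : p.[x] = 0 -> p^`().[x] = 0 ->
  exists r, p = r * ('X - x%:P) ^+ 2.
Proof.
move=> /eqP/factor_theorem[q ->]; rewrite derivM derivXsubC mulr1 !hornerE subrr mulr0 add0r.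
by move=> /eqP/factor_theorem[r ->]; exists r; rewrite expr2 mulrA.
Qed.

Lemma uniq_roots_Poly (l : seq K) (ns : seq K) : uniq ns ->
  (forall n, n \in ns -> (Poly l).[n] = 0) -> last 0 l != 0 -> (size ns < size l)%N.
Proof.
move=> u h l0; have sl : size (Poly l) = size l by rewrite (@PolyK _ 0 _ l0).
rewrite -sl; apply: max_poly_roots => //.
  by rewrite -size_poly_eq0 sl; case: (l) l0 => //=; rewrite eqxx.
by apply/allP => n /h /eqP.
Qed.

Variable c : quartic K.
Hypothesis (sm : forall x y s t, gradient_zero c x y s t -> [/\ x = 0, y = 0, s = 0 & t = 0]).
Hypothesis (unram : cfa c 0 * cfb c 1 - cfa c 1 * cfb c 0 != 0).

(** On the line the gradient is (0, 0, a, b), so a common zero of the two cubics is a singular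
    point. *)
Lemma cubics_coprime x y : cubic (cfa c) x y = 0 -> cubic (cfb c) x y = 0 -> x = 0 /\ y = 0.
Proof.
move=> a0 b0; suff: gradient_zero c x y 0 0 by case/sm.
split; rewrite /quart_1 /quart_2 /quart_3 /quart_4 ?a0 ?b0 /quad /quad_x /quad_y /cubic
  /cubic_x /cubic_y /biquad_x /biquad_y; ring.
Qed.

Lemma st_neq0 x : sF c x = 0 -> tF c x = 0 -> False.
Proof.
move=> s0 /eqP; rewrite oppr_eq0 => /eqP t0.
by have [_ /eqP] := cubics_coprime t0 s0; rewrite oner_eq0.
Qed.

(** If [cK] vanished along with E, then (s, t) would annihilate both the x^3 and the x^2 y
    coefficients of the pair a, b. By [unram] these two vectors are independent, which leaves s = t
    = 0. *)
Lemma cK_neq0 x : fE c x = 0 -> cK c (sF c x) (tF c x) != 0.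
Proof.
move=> E0; apply/eqP => k0; move: E0; rewrite /fE /cE /cubic_xx.
move: (@st_neq0 x) k0; set s := sF c x; set t := tF c x => st0 k0 E0.
have k1 : s * cfa c 1 + t * cfb c 1 = 0.
  apply: (mulfI nz2); rewrite mulr0 -E0 -[RHS]addr0 -(mulr0 (- 6 * x)) -k0 /cK; ring.
apply: st0; apply: (mulIf unram); rewrite mul0r.
  transitivity (cfb c 1 * cK c s t - cfb c 0 * (s * cfa c 1 + t * cfb c 1)).
    by rewrite /cK; ring.
  by rewrite k0 k1 !mulr0 subrr.
transitivity (cfa c 0 * (s * cfa c 1 + t * cfb c 1) - cfa c 1 * cK c s t).
  by rewrite /cK; ring.
by rewrite k0 k1 !mulr0 subrr.
Qed.

(* The pair [(x, n)] encodes the line through [(x : 1 : 0 : 0)] and [(n : 0 : s : t)]. *)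
Definition line_pair (z : K * K) :=
  [/\ fJ c z.1 * z.2 + fQ c z.1 = 0,
      fE c z.1 * z.2 ^+ 2 + 2 * fY c z.1 * z.2 + 2 * fL c z.1 = 0
    & top_cubic c (sF c z.1) (tF c z.1) z.2 1 = 0].

Lemma lines_at_J x ns : uniq ns -> (forall n, n \in ns -> line_pair (x, n)) ->
  fJ c x != 0 -> (size ns <= 1)%N.
Proof.
case: ns => [|n [|n' ns]] //= /and3P[+ _ _] h J0; rewrite inE negb_or => /andP[/eqP nn' _].
have [+ _ _] := h n (mem_head _ _); have [+ _ _] := h n' (mem_nth 0 (isT : 1 < size [:: n, n' & ns])%N).
move=> /= e1 e2; case: nn'; apply: (mulfI J0); apply: (addIr (fQ c x)); by rewrite e1 e2.
Qed.

Lemma lines_at_E x ns : uniq ns -> (forall n, n \in ns -> line_pair (x, n)) ->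
  fE c x != 0 -> (size ns <= 2)%N.
Proof.
move=> u h E0; apply: (@uniq_roots_Poly [:: 2 * fL c x; 2 * fY c x; fE c x]) => //.
by move=> n /h[_ <- _]; rewrite horner_Poly /=; ring.
Qed.

Lemma lines_at_triple x ns : uniq ns -> (forall n, n \in ns -> line_pair (x, n)) ->
  fE c x = 0 -> (size ns <= 3)%N.
Proof.
move=> u h /cK_neq0 k0; set s := sF c x; set t := tF c x.
apply: (@uniq_roots_Poly [:: biquad (cfG c) s t; cubic (cfU c) s t; quad (cfA c) s t; cK c s t]) => //.
by move=> n /h[_ _ <-]; rewrite horner_Poly /top_cubic /=; ring.
Qed.

(** R is quadratic in (J, Q). At an unramified point, eliminating n from the first two equations
    gives R = 0. At a ramified one a line forces Q = 0, so R has order at least 2, which covers the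
    two lines possible when E is nonzero. If E = 0 as well, J has a double root, every term has
    order at least 3, and there are at most three lines. *)
Lemma lines_at_pR x ns : uniq ns -> (forall n, n \in ns -> line_pair (x, n)) ->
  ('X - x%:P) ^+ size ns %| pR c.
Proof.
move=> u h; have [J0|J0] := eqVneq (fJ c x) 0; last first.
  have := lines_at_J u h J0; case: ns u h => [|n [|//]] _ h _; first by rewrite expr0 dvd1p.
  rewrite expr1 dvdp_XsubCl; have [/= Q0 E0 _] := h n (mem_head _ _).
  rewrite /root horner_pR /flexion.
  have -> : fQ c x = - (fJ c x * n) by apply/eqP; rewrite -addr_eq0 addrC Q0.
  by apply/eqP; rewrite -(mulr0 (fJ c x ^+ 2)) -E0; ring.
case: (ns =P [::]) => [-> | ns0]; first by rewrite expr0 dvd1p.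
have Q0 : fQ c x = 0.
  by case: ns ns0 h {u} => // n ns _ /(_ n (mem_head _ _)) [/=]; rewrite J0 mul0r add0r.
have [q qE] : exists q, pQ c = q * ('X - x%:P) by apply/factor_theorem/eqP; rewrite horner_pQ.
have [E0|E0] := eqVneq (fE c x) 0; last first.
  have [j jE] : exists j, pJ c = j * ('X - x%:P) by apply/factor_theorem/eqP; rewrite horner_pJ.
  apply: dvdp_trans (dvdp_exp2l _ (lines_at_E u h E0)) _.
  apply/dvdpP; exists (pE c * q ^+ 2 - 2 * j * q * pY c + 2 * j ^+ 2 * pL c).
  by rewrite /pR /flexion qE jE; ring.
apply: dvdp_trans (dvdp_exp2l _ (lines_at_triple u h E0)) _.
have [j jE] : exists j, pJ c = j * ('X - x%:P) ^+ 2.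
  by apply: double_root_factor; rewrite ?deriv_pJ ?horner_pJ ?horner_pE.
have [e eE] : exists e, pE c = e * ('X - x%:P) by apply/factor_theorem/eqP; rewrite horner_pE.
apply/dvdpP; exists (e * q ^+ 2 - 2 * j * q * pY c + 2 * j ^+ 2 * ('X - x%:P) * pL c).
by rewrite /pR /flexion qE jE eE; ring.
Qed.

Lemma lines_first_kind (zs : seq (K * K)) : uniq zs -> (forall z, z \in zs -> line_pair z) ->
  pR c != 0 -> (size zs <= 18)%N.
Proof.
move=> u h R0; rewrite -(size_map fst).
suff: (size (map fst zs) < size (pR c))%N.
  by move=> lt; have := leq_trans lt (deg_pR unram).
apply: size_roots_lt => // x.
rewrite count_map -size_filter -(size_map snd); apply: lines_at_pR.
  rewrite map_inj_in_uniq ?filter_uniq// => -[x1 n1] [x2 n2]; rewrite !mem_filter /=.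
  by move=> /andP[/eqP-> _] /andP[/eqP-> _] ->.
by move=> n /mapP[[x1 n1]]; rewrite mem_filter /= => /andP[/eqP-> /h] + ->.
Qed.

End Counting.

(** * Counting lines when every point is a flex *)

Section SecondKind.
Variable K : closedFieldType.
Hypotheses (nz2 : 2 != 0 :> K) (nz3 : 3 != 0 :> K).
Implicit Types (p q : {poly K}) (x n : K).
Notation "a ^P" := (polyC \o a) (at level 2).

Lemma separable_dvdp p q : p != 0 -> (forall x, root p x -> p^`().[x] != 0) ->
  (forall x, root p x -> root q x) -> p %| q.
Proof.
move=> p0 sep pq; have [rs Dp] := closed_field_poly_normal p.
have lp : lead_coef p != 0 by rewrite lead_coef_eq0.
have up : uniq rs.
  rewrite -separable_prod_XsubC -(@eqp_separable _ (lead_coef p *: \prod_(z <- rs) ('X - z%:P))).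
    by rewrite -Dp unlock; apply/Pdiv.ClosedField.coprimepP.
  by apply: eqp_scale.
rewrite Dp dvdpZl// uniq_roots_dvdp ?uniq_rootsE//.
apply/allP => x xrs; apply: pq; rewrite Dp rootZ// root_prod_XsubC.
exact: xrs.
Qed.

(** Euler's relation: where (p', q') = l (p, q), a form of degree d in (p, q) has derivative d l
    times its value. *)
Lemma deriv_quad_at a p q x l : p^`().[x] = l * p.[x] -> q^`().[x] = l * q.[x] ->
  (quad a^P p q)^`().[x] = 2 * l * quad a p.[x] q.[x].
Proof.
move=> hp hq; rewrite /quad /= !expr2 !derivE ?(mul1r, mulr1).
by rewrite !(hornerD, hornerM, hornerC, horner0) hp hq; ring.
Qed.
Lemma deriv_cubic_at a p q x l : p^`().[x] = l * p.[x] -> q^`().[x] = l * q.[x] ->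
  (cubic a^P p q)^`().[x] = 3 * l * cubic a p.[x] q.[x].
Proof.
move=> hp hq; rewrite /cubic /= !exprS !expr0 !derivE ?(mul1r, mulr1).
by rewrite !(hornerD, hornerM, hornerC, horner0) hp hq; ring.
Qed.

Variable c : quartic K.
Hypothesis (sm : forall x y s t, gradient_zero c x y s t -> [/\ x = 0, y = 0, s = 0 & t = 0]).
Hypothesis (unram : cfa c 0 * cfb c 1 - cfa c 1 * cfb c 0 != 0).

Let cP := map_quartic polyC c.
Let sP : {poly K} := cubic (cfb cP) 'X 1.
Let tP : {poly K} := - cubic (cfa cP) 'X 1.

(** J equals t s' - s t', so at a ramification point the tangent plane is stationary to first order;
    l only records the scaling of (s, t). *)
Lemma ramification_ratio x : fJ c x = 0 ->
  exists l, sP^`().[x] = l * sP.[x] /\ tP^`().[x] = l * tP.[x].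
Proof.
rewrite deriv_sP deriv_tP !horner_sP horner_tP hornerN !horner_cubic_x hornerX hornerC.
rewrite /fJ /cJ => J0; have [s0|s0] := eqVneq (sF c x) 0.
  have t0 : tF c x != 0 by apply/eqP => t0; exact: st_neq0 s0 t0.
  exists (- cubic_x (cfa c) x 1 / tF c x); rewrite divfK// s0 mulr0; split=> //.
  by apply: (mulfI t0); rewrite mulr0 -J0 s0 mul0r add0r.
exists (cubic_x (cfb c) x 1 / sF c x); rewrite divfK//; split=> //.
apply: (mulfI s0); rewrite [RHS]mulrA [sF c x * (_ / _)]mulrC divfK// mulrN.
by rewrite -[LHS]add0r -J0; ring.
Qed.

Section AtRamification.
Variables x l : K.
Hypotheses (hs : sP^`().[x] = l * sP.[x]) (ht : tP^`().[x] = l * tP.[x]).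

Lemma deriv_pQ_at : (pQ c)^`().[x] = fY c x + 2 * l * fQ c x.
Proof.
have := deriv_quad_at (cfA c) hs ht; have := deriv_quad_at (cfB c) hs ht.
have := deriv_quad_at (cfC c) hs ht; rewrite horner_sP horner_tP.
rewrite /pQ /fY /fQ /cQ /cY -/cP -/sP -/tP /=.
have := horner_quad (cfA c) sP tP x; have := horner_quad (cfB c) sP tP x.
rewrite horner_sP horner_tP.
move: (quad (cfA c)^P sP tP) (quad (cfB c)^P sP tP) (quad (cfC c)^P sP tP) => A B C.
move=> hB hA hC' hB' hA'; rewrite expr2 !derivE ?(mul1r, mulr1).
rewrite !(hornerD, hornerM, hornerX, hornerC).
by rewrite hA hB hA' hB' hC'; ring.
Qed.

Lemma deriv_pY_at : (pY c)^`().[x] = 2 * quad (cfA c) (sF c x) (tF c x) + 2 * l * fY c x.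
Proof.
have := deriv_quad_at (cfA c) hs ht; have := deriv_quad_at (cfB c) hs ht.
rewrite horner_sP horner_tP /pY /fY /cY -/cP -/sP -/tP /=.
have := horner_quad (cfA c) sP tP x; rewrite horner_sP horner_tP.
move: (quad (cfA c)^P sP tP) (quad (cfB c)^P sP tP) => A B.
move=> hA hB' hA'; rewrite -polyC_natr !derivE ?(mul1r, mulr1).
rewrite !(hornerD, hornerM, hornerX, hornerC, horner0).
by rewrite hA hA' hB'; ring.
Qed.

Lemma deriv_pL_at : (pL c)^`().[x] = cubic (cfU c) (sF c x) (tF c x) + 3 * l * fL c x.
Proof.
have := deriv_cubic_at (cfU c) hs ht; have := deriv_cubic_at (cfV c) hs ht.
rewrite horner_sP horner_tP /pL /fL /cL -/cP -/sP -/tP /=.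
have := horner_cubic (cfU c) sP tP x; rewrite horner_sP horner_tP.
move: (cubic (cfU c)^P sP tP) (cubic (cfV c)^P sP tP) => A B.
move=> hA hB' hA'; rewrite !derivE ?(mul1r, mulr1).
rewrite !(hornerD, hornerM, hornerX, hornerC, horner0).
by rewrite hA hA' hB'; ring.
Qed.

Lemma deriv_pE_at : (pE c)^`().[x] = 6 * cK c (sF c x) (tF c x) + l * fE c x.
Proof.
rewrite /pE /fE /cE /cK -/cP -/sP -/tP.
have h1 := deriv_cubic_xx (cfa c); have h2 := deriv_cubic_xx (cfb c).
have h3 := horner_cubic_xx (cfa c) 'X 1 x; have h4 := horner_cubic_xx (cfb c) 'X 1 x.
move: hs ht h1 h2 h3 h4; rewrite /= !hornerX !hornerC !horner_sP !horner_tP.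
have := horner_sP c x; have := horner_tP c x; rewrite -/sP -/tP.
move: (cubic_xx (cfa c)^P 'X 1) (cubic_xx (cfb c)^P 'X 1) => A B.
move: sP tP => u v hv hu hu' hv' hA' hB' hA hB.
rewrite derivD !derivM !(hornerD, hornerM) hA' hB' hu' hv' !hornerC hA hB hu hv; ring.
Qed.
End AtRamification.

(* The hypotheses say that the residual cubic contains [X = n z] doubly; the surface is then
   singular where the derivative transversal to the plane, a cubic in [u], vanishes on it. *)
Lemma double_line_singular x n : fJ c x = 0 -> fQ c x = 0 -> fE c x * n + fY c x = 0 ->
  fE c x * n ^+ 2 + 2 * fY c x * n + 2 * fL c x = 0 ->
  3 * cK c (sF c x) (tF c x) * n ^+ 2 + 2 * quad (cfA c) (sF c x) (tF c x) * n
    + cubic (cfU c) (sF c x) (tF c x) = 0 ->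
  top_cubic c (sF c x) (tF c x) n 1 = 0 -> False.
Proof.
move=> J0 Q0 Y0 W0 b0 top0; set s := sF c x; set t := tF c x.
have cres0 : cres c x s t = 0 by rewrite /cres /s /t /sF /tF; ring.
(* (d3, d4) is a direction transversal to the plane. As a = - t and b = s at x, this normalisation
   makes the derivative along it monic of degree 3 in u. *)
have [d3 [d4 d1]] : exists d3 d4, - t * d3 + s * d4 = 1.
  have [s0|s0] := eqVneq s 0.
    have t0 : t != 0 by apply/eqP => t0; exact: st_neq0 s0 t0.
    by exists (- t^-1), 0; rewrite mulrNN mulfV// mulr0 addr0.
  by exists 0, s^-1; rewrite mulr0 add0r mulfV.
pose k2 := d3 * (n * cubic_x (cfa c) x 1 + quad_x (cfA c) s t * x ^+ 2
      + quad_x (cfB c) s t * x + quad_x (cfC c) s t)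
  + d4 * (n * cubic_x (cfb c) x 1 + quad_y (cfA c) s t * x ^+ 2
      + quad_y (cfB c) s t * x + quad_y (cfC c) s t).
pose k1 := d3 * (n ^+ 2 * (3 * cfa c 0 * x + cfa c 1) + 2 * quad_x (cfA c) s t * x * n
      + quad_x (cfB c) s t * n + cubic_x (cfU c) s t * x + cubic_x (cfV c) s t)
  + d4 * (n ^+ 2 * (3 * cfb c 0 * x + cfb c 1) + 2 * quad_y (cfA c) s t * x * n
      + quad_y (cfB c) s t * n + cubic_y (cfU c) s t * x + cubic_y (cfV c) s t).
pose k0 := d3 * (n ^+ 3 * cfa c 0 + quad_x (cfA c) s t * n ^+ 2
      + cubic_x (cfU c) s t * n + biquad_x (cfG c) s t)
  + d4 * (n ^+ 3 * cfb c 0 + quad_y (cfA c) s t * n ^+ 2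
      + cubic_y (cfU c) s t * n + biquad_y (cfG c) s t).
(* A root of that derivative gives the singular point on the double line. *)
have [u hu] := @solve_monicpoly K 3 (nth 0 [:: - k0; - k1; - k2]) isT.
rewrite !big_ord_recr big_ord0 /= in hu.
set q1 := quart_1 c (u * x + n) u s t; set q2 := quart_2 c (u * x + n) u s t.
set q3 := quart_3 c (u * x + n) u s t; set q4 := quart_4 c (u * x + n) u s t.
have kE : d3 * q3 + d4 * q4 = 0.
  have -> : d3 * q3 + d4 * q4 = (- t * d3 + s * d4) * u ^+ 3 + k2 * u ^+ 2 + k1 * u + k0.
    rewrite /q3 /q4 /quart_3 /quart_4 /k0 /k1 /k2.
    move: (quad_x (cfA c) s t) (quad_x (cfB c) s t) (quad_x (cfC c) s t) => A B C.
    move: (quad_y (cfA c) s t) (quad_y (cfB c) s t) (quad_y (cfC c) s t) => A' B' C'.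
    move: (cubic_x (cfU c) s t) (cubic_x (cfV c) s t) (biquad_x (cfG c) s t) => U V G.
    move: (cubic_y (cfU c) s t) (cubic_y (cfV c) s t) (biquad_y (cfG c) s t) => U' V' G'.
    by rewrite /t /s /tF /sF /cubic /cubic_x; ring.
  by rewrite d1 hu; ring.
have q10 : q1 = 0.
  have -> : q1 = u ^+ 2 * fJ c x + u * (fE c x * n + fY c x)
     + (3 * cK c s t * n ^+ 2 + 2 * quad (cfA c) s t * n + cubic (cfU c) s t).
    rewrite /q1 /quart_1 /fJ /fE /fY /cJ /cE /cY /cK -/s -/t.
    move: (quad (cfA c) s t) (quad (cfB c) s t) (cubic (cfU c) s t) => A B U.
    by rewrite /cubic_x /cubic_xx; ring.
  by rewrite J0 Y0 b0; ring.
have q20 : q2 = 0.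
  apply: (mulfI nz2); rewrite mulr0.
  have -> : 2 * q2 = 6 * u ^+ 2 * cres c x s t + 4 * u * (fJ c x * n + fQ c x)
    + (fE c x * n ^+ 2 + 2 * fY c x * n + 2 * fL c x) - 2 * x * q1.
    rewrite /q1 /q2 /quart_1 /quart_2 /cres /fJ /fQ /fE /fY /fL /cJ /cQ /cE /cY /cL -/s -/t.
    move: (quad (cfA c) s t) (quad (cfB c) s t) (quad (cfC c) s t) => A B C.
    move: (cubic (cfU c) s t) (cubic (cfV c) s t) => U V.
    by rewrite /cubic /cubic_x /cubic_xx /cubic_y; ring.
  by rewrite cres0 J0 Q0 W0 q10; ring.
have F0 : quart c (u * x + n) u s t = 0.
  have := quart_plane c s t (u * x + n) u 1; rewrite !mul1r => ->.
  apply: (mulfI nz2); rewrite plane_cubic_pencil !mulr1 expr1n !mulr1.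
  rewrite -[cJ _ _ _ _]/(fJ c x) -[cQ _ _ _ _]/(fQ c x) -[cE _ _ _ _]/(fE c x).
  rewrite -[cY _ _ _ _]/(fY c x) -[cL _ _ _ _]/(fL c x).
  by rewrite cres0 J0 Q0 W0 top0; ring.
(* The pair (q3, q4) is annihilated by (s, t), through Euler's relation, and by (d3, d4), which are
   independent. *)
have := quart_euler c (u * x + n) u s t; rewrite -/q1 -/q2 -/q3 -/q4 q10 q20 F0 => e0.
have q30 : q3 = 0.
  have -> : q3 = (- t * d3 + s * d4) * q3 by rewrite d1 mul1r.
  have -> : (- t * d3 + s * d4) * q3 = - t * (d3 * q3 + d4 * q4) + d4 * (s * q3 + t * q4).
    by ring.
  have -> : s * q3 + t * q4 = 0 by rewrite -[RHS](mulr0 4) -e0; ring.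
  by rewrite kE; ring.
have q40 : q4 = 0.
  have -> : q4 = (- t * d3 + s * d4) * q4 by rewrite d1 mul1r.
  have -> : (- t * d3 + s * d4) * q4 = s * (d3 * q3 + d4 * q4) - d3 * (s * q3 + t * q4).
    by ring.
  have -> : s * q3 + t * q4 = 0 by rewrite -[RHS](mulr0 4) -e0; ring.
  by rewrite kE; ring.
have [_ _ s0 t0] : [/\ u * x + n = 0, u = 0, s = 0 & t = 0] by apply: sm; split.
exact: st_neq0 s0 t0.
Qed.

End SecondKind.

Section SecondKindCount.
Variable K : closedFieldType.
Hypotheses (nz2 : 2 != 0 :> K) (nz3 : 3 != 0 :> K).
Implicit Types (p q : {poly K}) (x n : K).
Notation "a ^P" := (polyC \o a) (at level 2).

Variable c : quartic K.
Hypothesis (sm : forall x y s t, gradient_zero c x y s t -> [/\ x = 0, y = 0, s = 0 & t = 0]).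
Hypothesis (unram : cfa c 0 * cfb c 1 - cfa c 1 * cfb c 0 != 0).
Hypothesis R0 : pR c = 0.

Let cP := map_quartic polyC c.
Let sP : {poly K} := cubic (cfb cP) 'X 1.
Let tP : {poly K} := - cubic (cfa cP) 'X 1.

(** Where E = 0 its derivative is 6 [cK]; hence a total ramification point is a root of J of order
    exactly two. *)
Lemma double_root_pE x : fJ c x = 0 -> fE c x = 0 -> (pE c)^`().[x] != 0.
Proof.
move=> J0 E0; have [l [hs ht]] := ramification_ratio sm J0.
rewrite (deriv_pE_at hs ht) E0 mulr0 addr0.
have -> : 6 = 2 * 3 :> K by ring.
by rewrite !mulf_neq0// cK_neq0.
Qed.

Lemma double_root_pJ x : fJ c x = 0 -> fE c x = 0 ->
  exists2 j, pJ c = j * ('X - x%:P) ^+ 2 & j.[x] != 0.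
Proof.
move=> J0 E0; have [j jE] : exists j, pJ c = j * ('X - x%:P) ^+ 2.
  by apply: double_root_factor; rewrite ?deriv_pJ ?horner_pJ ?horner_pE.
exists j => //; have := double_root_pE J0 E0; rewrite -deriv_pJ jE expr2 !derivE.
rewrite !(hornerD, hornerM, hornerX, hornerN, hornerC) /=; apply: contra_neq => ->.
by ring.
Qed.

(** Where J = 0, the identity R = 0 reads E Q^2 = 0. If E vanishes as well, one factor X - x is
    first divided out of R, which leaves the nonvanishing cofactor of E in front of Q^2. *)
Lemma ramified_pQ x : fJ c x = 0 -> fQ c x = 0.
Proof.
move=> J0; have [E0|E0] := eqVneq (fE c x) 0; last first.
  have := horner_pR c x; rewrite R0 horner0 /flexion J0 => h.
  apply/eqP; rewrite -[_ == 0](expf_eq0 (fQ c x) 2); apply/eqP.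
  by apply: (mulfI E0); rewrite mulr0 [RHS]h; ring.
have [j jE j0] := double_root_pJ J0 E0.
have [e eE] : exists e, pE c = e * ('X - x%:P) by apply/factor_theorem/eqP; rewrite horner_pE.
have e0 : e.[x] != 0.
  have := double_root_pE J0 E0; rewrite eE !derivE.
  by rewrite !(hornerD, hornerM, hornerX, hornerN, hornerC) /= subrr mulr0 add0r mulr1.
have h : e * pQ c ^+ 2 - 2 * ('X - x%:P) * j * pQ c * pY c
    + 2 * ('X - x%:P) ^+ 3 * j ^+ 2 * pL c = 0.
  have Xx0 : 'X - x%:P != 0 by rewrite polyXsubC_eq0.
  apply: (mulIf Xx0).
  by rewrite mul0r -R0 /pR /flexion jE eE; ring.
have /eqP : e.[x] * fQ c x ^+ 2 = 0.
  rewrite -horner_pQ -(horner0 x) -h; move: (pQ c) (pY c) (pL c) => q y l.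
  rewrite !(hornerD, hornerN, hornerM, @horner_exp K, hornerX, hornerC).
  by rewrite subrr; ring.
by rewrite mulf_eq0 (negbTE e0) expf_eq0 /= => /eqP.
Qed.

Lemma pJ_neq0 : pJ c != 0.
Proof. by rewrite -size_poly_eq0 size_pJ. Qed.

(* [p] carries the repeated factor of [J], at the total ramification point if there is one. *)
Lemma ramification_split :
  (forall x y, fJ c x = 0 -> fE c x = 0 -> fJ c y = 0 -> fE c y = 0 -> x = y) ->
  exists k p j, [/\ pJ c = p * j,
    [/\ (k <= 1)%N, size p = k.+1 & forall x y, p.[x] = 0 -> p.[y] = 0 -> k = 1%N /\ x = y],
    forall x, p.[x] = 0 -> fE c x = 0,
    forall x, root j x -> j^`().[x] != 0 &
    exists2 x, fJ c x = 0 & p.[x] != 0].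
Proof.
move=> one.
have [[x0 [J0 E0]]|none] := boolp.EM (exists x, fJ c x = 0 /\ fE c x = 0).
  have [j jE j0] := double_root_pJ J0 E0.
  (* The cofactor of p keeps one copy of X - x0, so that it is squarefree and still vanishes at
     every ramification point. *)
  exists 1%N, ('X - x0%:P), (j * ('X - x0%:P)); split.
  - by rewrite jE; ring.
  - split; rewrite ?size_XsubC// => x y; rewrite !hornerE.
    by move=> /eqP + /eqP; rewrite !subr_eq0 => /eqP-> /eqP->.
  - by move=> x; rewrite !hornerE => /eqP; rewrite subr_eq0 => /eqP->.
  - move=> x; rewrite rootM root_XsubC => /orP[|/eqP->]; last first.
      by rewrite derivM derivXsubC hornerD !hornerM hornerXsubC subrr mulr0 add0r hornerC mulr1.
    move=> jx; apply/eqP => dx.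
    have Jx : fJ c x = 0 by rewrite -horner_pJ jE hornerM (rootP jx) mul0r.
    have xx0 : x = x0.
      apply: one => //; rewrite -horner_pE -deriv_pJ jE expr2 mulrA derivM hornerD !hornerM dx.
      by rewrite (rootP jx); ring.
    by move: j0; rewrite -xx0 (rootP jx) eqxx.
  have sj : size j = 3%N.
    have : size (pJ c) = 5%N by apply: size_pJ.
    rewrite jE size_Mmonic; last 2 first.
    - by apply/eqP => j00; move: j0; rewrite j00 horner0 eqxx.
    - by rewrite monic_exp// monicXsubC.
    by rewrite size_exp_XsubC addn3 => -[->].
  have /closed_rootP[x jx] : size j != 1 by rewrite sj.
  exists x; first by rewrite -horner_pJ jE hornerM (rootP jx) mul0r.
  by rewrite hornerXsubC subr_eq0; apply: contraTneq jx => ->.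
exists 0%N, 1, (pJ c); split=> //.
- by rewrite mul1r.
- by split; rewrite ?size_poly1// => x y; rewrite hornerC => /eqP; rewrite oner_eq0.
- by move=> x; rewrite hornerC => /eqP; rewrite oner_eq0.
- move=> x; rewrite /root horner_pJ deriv_pJ horner_pE => /eqP Jx.
  by apply/eqP => Ex; apply: none; exists x.
have /closed_rootP[x jx] : size (pJ c) != 1 by rewrite size_pJ.
by exists x; rewrite ?hornerC ?oner_neq0// -horner_pJ (rootP jx).
Qed.

Section FlexTangents.
Variables (k : nat) (p j m : {poly K}).
Hypotheses (pJE' : pJ c = p * j) (k1 : (k <= 1)%N) (sp : size p = k.+1)
  (mE : pQ c = - (m * j)).

Let j0 : j != 0. Proof. by apply: contraNneq pJ_neq0 => j0; rewrite pJE' j0 mulr0. Qed.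

(** The flex tangent at x has n = - Q / J = m / p after the common factor j is cancelled. The pair
    (m, p) thus still describes it at simple ramification points, where J = Q = 0. *)
Lemma tangent_eq : pJ c * m + pQ c * p = 0.
Proof. by rewrite pJE' mE; ring. Qed.

Lemma flex_eq : pE c * m ^+ 2 + 2 * pY c * m * p + 2 * pL c * p ^+ 2 = 0.
Proof.
have j20 : j ^+ 2 != 0 by rewrite expf_neq0.
by apply: (mulIf j20); rewrite mul0r -[RHS]R0 /pR /flexion mE pJE'; ring.
Qed.

(** Away from the zeros of p, its roots are the points whose flex tangent lies on the surface; the
    other two conditions are the identities [tangent_eq] and [flex_eq]. *)
Let N := top_cubic cP sP tP m p.

(* Rewriting [(m, p)] as [(m(0), - b, p)] along the line lowers the degrees of the entries. *)
Lemma deg_residual : deg_le (12 + 3 * k) N.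
Proof.
have sj : (size j = 5 - k)%N.
  have : size (pJ c) = 5%N by apply: size_pJ.
  rewrite pJE' size_mul ?sp//; last by rewrite -size_poly_gt0 sp.
  by rewrite addSn -pred_Sn => <-; rewrite addKn.
have hm : deg_le (4 + k) m.
  have := deg_pQ c; rewrite mE /deg_le size_polyN.
  have [->|m0] := eqVneq m 0; first by rewrite size_poly0.
  rewrite size_mul// sj; lia.
have [b bE] : exists b, m = b * 'X + (m.[0])%:P.
  have /factor_theorem[b bE] : root (m - (m.[0])%:P) 0 by rewrite /root !hornerE subrr.
  by exists b; rewrite subr0 in bE; rewrite -bE subrK.
have hb : deg_le (3 + k) b.
  have : deg_le (4 + k) (b * 'X).
    have -> : b * 'X = m + (- m.[0])%:P by rewrite {1}bE polyCN addrK.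
    by apply: deg_leW (deg_leD hm (deg_leC _)) _; rewrite maxn0.
  rewrite /deg_le; have [->|b0] := eqVneq b 0; first by rewrite size_poly0.
  by rewrite size_mulX.
have hp : deg_le k p by rewrite /deg_le sp.
(* By those identities the residual cubic is constant in u at (u x + m : u : p), so N may be read at
   u = - b instead of u = 0. Each term then has degree at most 12 + 3k. *)
have -> : N = plane_cubic cP sP tP (m.[0])%:P (- b) p.
  have nz2' : 2 != 0 :> {poly K} by rewrite -polyC_natr polyC_eq0.
  apply: (mulfI nz2').
  have -> : (m.[0])%:P = (- b) * 'X + m by rewrite [X in _ = _ + X]bE; ring.
  rewrite plane_cubic_pencil.
  have -> : cres cP 'X sP tP = 0 by rewrite /cres /sP /tP mulrC mulNr addrN.
  rewrite -[cJ cP _ _ _]/(pJ c) -[cE cP _ _ _]/(pE c) -[cQ cP _ _ _]/(pQ c).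
  rewrite -[cY cP _ _ _]/(pY c) -[cL cP _ _ _]/(pL c) tangent_eq flex_eq -/N.
  ring.
rewrite /plane_cubic.
have hA := deg_quadP c (cfA c); have hB := deg_quadP c (cfB c); have hC := deg_quadP c (cfC c).
have hU := deg_cubicP c (cfU c); have hV := deg_cubicP c (cfV c).
have hG := deg_biquadP c (cfG c).
have hs := deg_sP c; have ht := deg_tP c; have h0 := deg_leC m.[0].
rewrite -/cP -/sP -/tP in hA hB hC hU hV hG hs ht.
rewrite [cubic (cfa cP) _ _]/cubic [cubic (cfb cP) (m.[0])%:P _]/cubic /=.
move: (quad _ sP tP) (quad _ sP tP) (quad _ sP tP) hA hB hC => A B C hA hB hC.
move: (cubic _ sP tP) (cubic _ sP tP) (biquad _ sP tP) hU hV hG => U V G hU hV hG.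
move: sP tP hs ht => s t hs ht.
apply: deg_leW; first by deg_bound.
case: (k) k1 => [|[|]] //.
Qed.

(** Differentiating [tangent_eq] and [flex_eq] at x, where J = Q = 0, gives E n + Y = 0 and the
    vanishing of the n-derivative of [top_cubic]. If N vanished too, the flex tangent would be a
    double component of the residual cubic, against [double_line_singular]. *)
Lemma residual_simple x : fJ c x = 0 -> fE c x != 0 -> p.[x] != 0 ->
  fE c x * m.[x] + fY c x * p.[x] = 0 /\ N.[x] != 0.
Proof.
move=> J0 E0 px.
have [l [hs ht]] := ramification_ratio sm J0.
have Q0 := ramified_pQ J0.
have dQ := deriv_pQ_at hs ht; have dY := deriv_pY_at hs ht.
have dL := deriv_pL_at hs ht; have dE := deriv_pE_at hs ht.
have e1 : fE c x * m.[x] + fY c x * p.[x] = 0.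
  have := congr1 (fun q => q^`().[x]) tangent_eq.
  have := horner_pJ c x; have := horner_pE c x; have := horner_pQ c x.
  rewrite -deriv_pJ.
  move: (pJ c) (pQ c) dQ => J Q dQ hQ hE hJ.
  rewrite !derivE !(hornerD, hornerM) dQ hQ hE hJ J0 Q0 horner0 => h.
  by rewrite -[RHS]h; ring.
split=> //.
set s := sF c x; set t := tF c x.
set n := m.[x] / p.[x].
have mn : m.[x] = n * p.[x] by rewrite divfK.
have e1n : fE c x * n + fY c x = 0.
  by apply: (mulIf px); rewrite mul0r -e1 mn; ring.
have p20 : p.[x] ^+ 2 != 0 by rewrite expf_neq0.
have e2 : fE c x * n ^+ 2 + 2 * fY c x * n + 2 * fL c x = 0.
  apply: (mulIf p20); rewrite mul0r.
  have := congr1 (fun q => q.[x]) flex_eq.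
  have := horner_pE c x; have := horner_pY c x; have := horner_pL c x.
  move: (pE c) (pY c) (pL c) => E Y L hL hY hE.
  rewrite -(polyC_natr _ 2) !(hornerD, hornerM, @horner_exp K, hornerC) hL hY hE mn => h.
  by rewrite -[RHS]h; ring.
have e3 : 3 * cK c s t * n ^+ 2 + 2 * quad (cfA c) s t * n + cubic (cfU c) s t = 0.
  have two2 : 2 * p.[x] ^+ 2 != 0 by rewrite mulf_neq0.
  apply: (mulIf two2); rewrite mul0r.
  have := congr1 (fun q => q^`().[x]) flex_eq.
  have := horner_pE c x; have := horner_pY c x; have := horner_pL c x.
  move: (pE c) (pY c) (pL c) dE dY dL => E Y L dE dY dL hL hY hE.
  rewrite -(polyC_natr _ 2) !expr2 !derivE.
  rewrite !(hornerD, hornerM, @horner_exp K, hornerC) dE dY dL hL hY hE mn -/s -/t.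
  have YE : fY c x = - (fE c x * n) by apply/eqP; rewrite -addr_eq0 addrC e1n.
  have LE : 2 * fL c x = fE c x * n ^+ 2.
    by apply/eqP; rewrite -subr_eq0 -[X in _ == X]e2 YE; apply/eqP; ring.
  move=> h; rewrite -[RHS]h YE.
  move: (m^`().[x]) (p^`().[x]) => m' p'.
  transitivity (2 * (cubic (cfU c) s t * p.[x] ^+ 2 + 3 * cK c s t * n ^+ 2 * p.[x] ^+ 2
    + 2 * quad (cfA c) s t * n * p.[x] ^+ 2)
    + (2 * fL c x - fE c x * n ^+ 2) * (2 * p.[x] * p' + 3 * l * p.[x] ^+ 2)); last by ring.
  by rewrite LE; ring.
apply/eqP => N0; apply: (@double_line_singular K nz2 c sm x n) => //.
have p30 : p.[x] ^+ 3 != 0 by rewrite expf_neq0.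
apply: (mulIf p30); rewrite mul0r -N0 /N horner_top_cubic horner_sP horner_tP mn.
by rewrite /top_cubic; ring.
Qed.

(** At an unramified point n solves a linear equation. At a simple ramification point that equation
    is void, but by [residual_simple] the quadratic one has the double root m / p. *)
Lemma line_pair_residual z : line_pair c z -> (fJ c z.1 = 0 -> fE c z.1 != 0) ->
  p.[z.1] != 0 -> z.2 = m.[z.1] / p.[z.1] /\ N.[z.1] = 0.
Proof.
case: z => x n [/=]; set s := sF c x; set t := tF c x => e1 e2 e3 ram px.
have mn : m.[x] = n * p.[x].
  have [J0|J0] := eqVneq (fJ c x) 0; last first.
    have := congr1 (fun q => q.[x]) tangent_eq.
    rewrite hornerD !hornerM horner_pJ horner_pQ horner0 => h.
    apply: (mulfI J0); apply: (addIr (fQ c x * p.[x])); rewrite h.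
    by rewrite -[LHS](mul0r p.[x]) -e1; ring.
  have E0 := ram J0; have [f1 _] := residual_simple J0 E0 px.
  have := congr1 (fun q => q.[x]) flex_eq.
  have := horner_pE c x; have := horner_pY c x; have := horner_pL c x.
  move: (pE c) (pY c) (pL c) => E Y L hL hY hE.
  rewrite -(polyC_natr _ 2) !(hornerD, hornerM, @horner_exp K, hornerC) hL hY hE => h.
  apply: (mulfI E0); apply/eqP; rewrite -subr_eq0 -[_ == 0](expf_eq0 _ 2); apply/eqP.
  have f2 : fY c x * p.[x] = - (fE c x * m.[x]) by apply/eqP; rewrite -addr_eq0 addrC f1.
  transitivity (fE c x * (fE c x * m.[x] ^+ 2 - 2 * m.[x] * n * fE c x * p.[x]
     + fE c x * n ^+ 2 * p.[x] ^+ 2)); first by ring.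
  have -> : fE c x * n ^+ 2 = - (2 * fY c x * n + 2 * fL c x).
    by apply/eqP; rewrite -addr_eq0 addrA e2.
  rewrite -[RHS](mulr0 (fE c x)); congr (_ * _); rewrite -[RHS]oppr0 -h.
  transitivity (fE c x * m.[x] ^+ 2 + 2 * n * p.[x] * (- (fE c x * m.[x]))
     - 2 * n * p.[x] * (fY c x * p.[x]) - 2 * fL c x * p.[x] ^+ 2); first by ring.
  have -> : 2 * fY c x * m.[x] * p.[x] = 2 * m.[x] * (fY c x * p.[x]) by ring.
  by rewrite f2; ring.
split; first by rewrite mn mulfK.
rewrite /N horner_top_cubic horner_sP horner_tP mn -/s -/t.
by rewrite -[RHS](mul0r (p.[x] ^+ 3)) -e3 /top_cubic; ring.
Qed.

End FlexTangents.

(** Off the roots of p, lines inject into the roots of N, at most 12 + 3k in number; over the root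
    of p, present only for k = 1, there are at most three. The total 12 + 6k is at most 18. *)
Lemma lines_second_kind (zs : seq (K * K)) :
  (forall x y, fJ c x = 0 -> fE c x = 0 -> fJ c y = 0 -> fE c y = 0 -> x = y) ->
  uniq zs -> (forall z, z \in zs -> line_pair c z) -> (size zs <= 18)%N.
Proof.
move=> one u h.
have [k [p [j [pJE' [k1 sp px] pE0 sep [x0 J0 p0]]]]] := ramification_split one.
have j0 : j != 0 by apply: contraNneq pJ_neq0 => j0; rewrite pJE' j0 mulr0.
have [m mE] : exists m, pQ c = - (m * j).
  have /dvdpP[q qE] : j %| pQ c.
    apply: separable_dvdp => // x jx; rewrite /root horner_pQ ramified_pQ//.
    by rewrite -horner_pJ pJE' hornerM (rootP jx) mulr0.
  by exists (- q); rewrite mulNr opprK.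
have jp x : fJ c x = 0 -> p.[x] != 0 -> fE c x != 0.
  move=> Jx px0; rewrite -horner_pE -deriv_pJ pJE' derivM hornerD !hornerM.
  have jx : root j x.
    by have := horner_pJ c x; rewrite Jx pJE' hornerM => /eqP; rewrite mulf_eq0 (negbTE px0).
  by rewrite (rootP jx) mulr0 add0r mulf_neq0// sep.
have [_ N0] := residual_simple pJE' mE J0 (jp _ J0 p0) p0.
set N := top_cubic _ _ _ m p in N0.
pose P1 (z : K * K) := p.[z.1] != 0.
rewrite -(count_predC P1 zs).
have sN : (size N <= (12 + 3 * k).+1)%N by apply: (deg_residual pJE').
have N00 : N != 0 by apply/eqP => N00; move: N0; rewrite N00 horner0 eqxx.
have c1 : (count P1 zs <= 12 + 3 * k)%N.
  rewrite -ltnS; apply: leq_trans sN.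
  rewrite -size_filter -(size_map fst); apply: max_poly_roots => //.
    apply/allP => x /mapP[z]; rewrite mem_filter /P1 => /andP[pz /h lz] ->.
    by apply/rootP; have [_ ] := line_pair_residual pJE' mE lz (fun Jz => jp _ Jz pz) pz.
  rewrite map_inj_in_uniq ?filter_uniq// => -[x n] [y n'].
  rewrite !mem_filter /P1 => /andP[px1 /h l1] /andP[py1 /h l2] /= xy; subst y.
  have [/= -> _] := line_pair_residual pJE' mE l1 (fun Jz => jp _ Jz px1) px1.
  by have [/= -> _] := line_pair_residual pJE' mE l2 (fun Jz => jp _ Jz px1) px1.
set P2 := predC P1.
have c2 : (count P2 zs <= 3 * k)%N.
  rewrite -size_filter.
  have [->|[[x n] xn]] : [seq z <- zs | P2 z] = [::] \/ exists z, z \in [seq z <- zs | P2 z].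
  - by case: [seq z <- zs | P2 z] => [|z l]; [left | right; exists z; rewrite mem_head].
  - by [].
  move: xn; rewrite mem_filter /= /P1 negbK => /andP[/eqP /= px0 _].
  have [-> _] := px _ _ px0 px0.
  rewrite -(size_map snd) muln1; apply: (@lines_at_triple K nz2 c sm unram x) => //.
  - rewrite map_inj_in_uniq ?filter_uniq// => -[x1 n1] [x2 n2].
    rewrite !mem_filter /= /P1 !negbK => /andP[/eqP /= p1 _] /andP[/eqP /= p2 _] ->.
    by have [_ ->] := px _ _ p1 p2.
  - move=> n1 /mapP[[x1 n2]]; rewrite mem_filter /= /P1 negbK => /andP[/eqP /= p1 /h l1] ->.
    by have [_ <-] := px _ _ p1 px0.
  - exact: pE0.
apply: leq_trans (leq_add c1 c2) _; clear -k1; lia.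
Qed.

End SecondKindCount.

(** * Coordinates adapted to a line *)

Section Mpoly.
Variable R : comNzRingType.

Lemma comp_mpolyA n k l (p : {mpoly R[n]}) (lq : n.-tuple {mpoly R[k]}) (lr : k.-tuple {mpoly R[l]}) :
  (p \mPo lq) \mPo lr = p \mPo [tuple (tnth lq i) \mPo lr | i < n].
Proof.
rewrite [p \mPo lq]comp_mpolyEX [RHS]comp_mpolyEX raddf_sum /=; apply: eq_bigr => m _.
rewrite comp_mpolyZ !comp_mpolyX rmorph_prod /=; congr (_ *: _).
by apply: eq_bigr => i _; rewrite rmorphXn tnth_mktuple.
Qed.

Lemma homog_expand n d (p : {mpoly R[n]}) (ms : seq 'X_{1..n}) : p \is d.-homog -> uniq ms ->
  (forall m : 'X_{1..n}, mdeg m = d -> m \in ms) -> p = \sum_(m <- ms) p@_m *: 'X_[m].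
Proof.
move=> hp u hms; apply/mpolyP => m; rewrite raddf_sum /=.
have [mms|mms] := boolP (m \in ms).
  rewrite (bigD1_seq m)//= mcoeffZ mcoeffX eqxx mulr1 big1 ?addr0// => m' m'm.
  by rewrite mcoeffZ mcoeffX (negbTE m'm) mulr0.
rewrite (dhomog_nemf_coeff hp); last by apply: contra mms => /eqP/hms.
rewrite big1_seq// => m' /andP[_ m'ms]; rewrite mcoeffZ mcoeffX.
by case: eqP => [m'm|_]; rewrite ?mulr0//; rewrite -m'm m'ms in mms.
Qed.

Definition mnm_seq n (s : seq nat) : 'X_{1..n} := [multinom nth 0%N s i | i < n].

Lemma mnm_seqE n (m : 'X_{1..n}) : m = mnm_seq n [seq m i | i <- enum 'I_n].
Proof.
apply/mnmP => i; rewrite mnmE (nth_map i) ?size_enum_ord//.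
by rewrite nth_ord_enum.
Qed.

End Mpoly.

Lemma homog2_expand (R : comNzRingType) d (p : {mpoly R[2]}) : p \is d.-homog ->
  p = \sum_(i < d.+1) (p@_(mnm_seq 2 [:: d - i; i : nat])%N) *: ('X_0 ^+ (d - i) * 'X_1 ^+ i).
Proof.
move=> hp; pose ms := [seq mnm_seq 2 [:: d - i; i]%N | i <- iota 0 d.+1].
have u : uniq ms.
  rewrite map_inj_in_uniq ?iota_uniq// => i j _ _ /mnmP/(_ 1).
  by rewrite !mnmE.
rewrite {1}(@homog_expand _ _ _ _ ms hp u); last first.
  move=> m; rewrite mdegE !big_ord_recr big_ord0 /= add0n => md.
  apply/mapP; exists (m ord_max); first by rewrite mem_iota; lia.
  apply/mnmP => i; rewrite mnmE; case: i => -[|[|]]// hi /=.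
  - rewrite -md addnK; congr (m _); exact: val_inj.
  - by congr (m _); exact: val_inj.
rewrite /ms; have -> : iota 0 d.+1 = index_iota 0 d.+1 by rewrite /index_iota subn0.
rewrite big_map big_mkord; apply: eq_bigr => i _; congr (_ *: _).
rewrite mpolyXE_id !big_ord_recr big_ord0 /= mul1r !mnmE /=.
by congr ('X__ ^+ _ * 'X__ ^+ _); exact: val_inj.
Qed.

Definition mono4 : seq (seq nat) :=
  [seq e <- [seq a :: e | a <- iota 0 5,
     e <- [seq b :: e | b <- iota 0 5,
       e <- [seq [:: c; d] | c <- iota 0 5, d <- iota 0 5]]] | sumn e == 4%N].

Definition quartic_of (R : Type) (h : seq nat -> R) : quartic R := Quartic
  (fun i => h [:: 3 - i; i; 1; 0]%N) (fun i => h [:: 3 - i; i; 0; 1]%N)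
  (fun i => h [:: 2; 0; 2 - i; i]%N) (fun i => h [:: 1; 1; 2 - i; i]%N)
  (fun i => h [:: 0; 2; 2 - i; i]%N)
  (fun i => h [:: 1; 0; 3 - i; i]%N) (fun i => h [:: 0; 1; 3 - i; i]%N)
  (fun i => h [:: 0; 0; 4 - i; i]%N).

Lemma sum_mono4 (R : comNzRingType) (h : seq nat -> R) x y s t :
  \sum_(e <- mono4) h e * (x ^+ nth 0%N e 0 * y ^+ nth 0%N e 1 * s ^+ nth 0%N e 2 * t ^+ nth 0%N e 3)
  = biquad (fun i => h [:: 4 - i; i; 0; 0]%N) x y + quart (quartic_of h) x y s t.
Proof.
(* The 35 exponent vectors are computed once, so that the sum unfolds into terms fit for [ring]. *)
have -> : mono4 = ltac:(let x := eval vm_compute in mono4 in exact x) by vm_compute.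
rewrite !big_cons big_nil /quart /quad /cubic /biquad /=; ring.
Qed.

Section Frames.
Variable K : closedFieldType.
Implicit Types (F : {mpoly K[4]}) (A : 'M[K]_4) (v : 'rV[K]_4).

Lemma homog4_expand F : F \is 4.-homog -> F = \sum_(e <- mono4) F@_(mnm_seq 4 e) *:
  ('X_0 ^+ nth 0%N e 0 * 'X_1 ^+ nth 0%N e 1 * 'X_2 ^+ nth 0%N e 2 * 'X_3 ^+ nth 0%N e 3).
Proof.
move=> hF; pose ms := [seq mnm_seq 4 e | e <- mono4].
have size4 e : e \in mono4 -> size e = 4%N.
  have /allP h : all (fun e => size e == 4%N) mono4 by vm_compute.
  by move=> /h /eqP.
have u : uniq ms.
  rewrite map_inj_in_uniq; first by vm_compute.
  move=> e f /size4 se /size4 sf ef; apply: (@eq_from_nth _ 0%N); first by rewrite se.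
  move=> i; rewrite se => i4.
  by have /mnmP/(_ (Ordinal i4)) := ef; rewrite !mnmE.
rewrite {1}(@homog_expand _ _ _ _ ms hF u); last first.
  move=> m md; rewrite (mnm_seqE m) map_f//.
  rewrite mdegE !big_ord_recr big_ord0 /= add0n in md.
  rewrite enum_ordSl enum_ordSl enum_ordSl enum_ordSl enum_ord0 /=.
  set a := m _; set b := m _; set c := m _; set d := m _.
  have sm : (a + b + c + d)%N = 4%N.
    by rewrite -md; congr (_ + _ + _ + _)%N; congr (m _); exact: val_inj.
  rewrite mem_filter; apply/andP; split; first by rewrite /= addn0 !addnA sm.
  have h x : (x <= 4)%N -> x \in iota 0 5 by rewrite mem_iota.
  apply: (allpairs_f cons); first by apply: h; lia.
  apply: (allpairs_f cons); first by apply: h; lia.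
  by apply: (allpairs_f (fun c d => [:: c; d])); apply: h; lia.
rewrite big_map; apply: eq_bigr => e _; congr (_ *: _).
rewrite mpolyXE_id !big_ord_recr big_ord0 /= mul1r !mnmE /=.
by congr ('X__ ^+ _ * 'X__ ^+ _ * 'X__ ^+ _ * 'X__ ^+ _); exact: val_inj.
Qed.

Lemma Poly_eq0 (l : seq K) : (forall x, (Poly l).[x] = 0) -> forall i, nth 0 l i = 0.
Proof.
move=> h i; rewrite -coef_Poly.
have -> : Poly l = 0; last by rewrite coef0.
by apply/eqP; apply: contraTT isT => /closed_nonrootP[x]; rewrite /root h eqxx.
Qed.

Definition mpoly_quartic (c : quartic K) : quartic {mpoly K[4]} := map_quartic (@mpolyC 4 K) c.

Definition frame F A c := F = quart (mpoly_quartic c)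
  (coordinate_form A 0) (coordinate_form A 1) (coordinate_form A 2) (coordinate_form A 3).

Lemma homog4_quart F : F \is 4.-homog -> (forall x y, F.@[fun i => nth 0 [:: x; y; 0; 0] i] = 0) ->
  exists c, F = quart (mpoly_quartic c) 'X_0 'X_1 'X_2 'X_3.
Proof.
move=> hF h0; pose h e := F@_(mnm_seq 4 e).
have FE : F = biquad (fun i => (h [:: 4 - i; i; 0; 0]%N)%:MP) 'X_0 'X_1
    + quart (mpoly_quartic (quartic_of h)) 'X_0 'X_1 'X_2 'X_3.
  rewrite {1}(homog4_expand hF) -/(h _) -(sum_mono4 (fun e => (h e)%:MP)).
  by apply: eq_bigr => e _; rewrite -mul_mpolyC.
have g0 : forall i, nth 0 [:: h [:: 0; 4; 0; 0]; h [:: 1; 3; 0; 0]; h [:: 2; 2; 0; 0];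
    h [:: 3; 1; 0; 0]; h [:: 4; 0; 0; 0]]%N i = 0.
  apply: Poly_eq0 => x; rewrite -(h0 x 1) horner_Poly.
  rewrite (homog4_expand hF) raddf_sum /=.
  transitivity (\sum_(e <- mono4) h e * (x ^+ nth 0%N e 0 * 1 ^+ nth 0%N e 1
      * 0 ^+ nth 0%N e 2 * 0 ^+ nth 0%N e 3)).
    rewrite sum_mono4 /quart /cubic /quad /biquad /=; move: h {FE} => h.
    ring.
  apply: eq_bigr => e _; rewrite -/(h e); move: (h e) (nth 0%N e) => a f.
  rewrite mevalZ !mevalM; congr (_ * (_ * _ * _ * _)).
  - by rewrite rmorphXn /= mevalXU.
  - by rewrite rmorphXn /= mevalXU.
  - by rewrite rmorphXn /= mevalXU.
  - by rewrite rmorphXn /= mevalXU.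
exists (quartic_of h); rewrite {1}FE.
move: (g0 0%N) (g0 1%N) (g0 2%N) (g0 3%N) (g0 4%N) => /= z0 z1 z2 z3 z4.
by rewrite /biquad /= z0 z1 z2 z3 z4 mpolyC0 !mul0r !add0r.
Qed.

End Frames.

(** * Partial derivatives and ring morphisms on quartic forms *)

Section Derivation.
Variables (R : comNzRingType) (D : R -> R).
Hypotheses (DD : {morph D : x y / x + y}) (DM : forall x y, D (x * y) = D x * y + x * D y).
Variable c : quartic R.
Hypotheses (Da : forall i, D (cfa c i) = 0) (Db : forall i, D (cfb c i) = 0)
  (DA : forall i, D (cfA c i) = 0) (DB : forall i, D (cfB c i) = 0)
  (DC : forall i, D (cfC c i) = 0) (DU : forall i, D (cfU c i) = 0)
  (DV : forall i, D (cfV c i) = 0) (DG : forall i, D (cfG c i) = 0).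

Lemma derivation_quad a x y : (forall i, D (a i) = 0) ->
  D (quad a x y) = quad_x a x y * D x + quad_y a x y * D y.
Proof.
move=> Dai; rewrite /quad /quad_x /quad_y !expr2.
by rewrite !DD !DM !Dai; ring.
Qed.
Lemma derivation_cubic a x y : (forall i, D (a i) = 0) ->
  D (cubic a x y) = cubic_x a x y * D x + cubic_y a x y * D y.
Proof.
move=> Dai; rewrite /cubic /cubic_x /cubic_y !(expr2, exprSr, expr0, mul1r).
by rewrite !DD !DM !Dai; ring.
Qed.
Lemma derivation_biquad a x y : (forall i, D (a i) = 0) ->
  D (biquad a x y) = biquad_x a x y * D x + biquad_y a x y * D y.
Proof.
move=> Dai; rewrite /biquad /biquad_x /biquad_y !(expr2, exprSr, expr0, mul1r).
by rewrite !DD !DM !Dai; ring.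
Qed.

Lemma derivation_quart x y s t : D (quart c x y s t) =
  quart_1 c x y s t * D x + quart_2 c x y s t * D y
  + quart_3 c x y s t * D s + quart_4 c x y s t * D t.
Proof.
rewrite /quart /quart_1 /quart_2 /quart_3 /quart_4.
have := derivation_cubic x y Da; have := derivation_cubic x y Db.
have := derivation_quad s t DA; have := derivation_quad s t DB.
have := derivation_quad s t DC; have := derivation_cubic s t DU.
have := derivation_cubic s t DV; have := derivation_biquad s t DG.
move: (cubic (cfa c) x y) (cubic (cfb c) x y) => a b.
move: (quad (cfA c) s t) (quad (cfB c) s t) (quad (cfC c) s t) => A B C.
move: (cubic (cfU c) s t) (cubic (cfV c) s t) (biquad (cfG c) s t) => U V G.
move=> eG eV eU eC eB eA eb ea.
by rewrite !expr2 !DD !DM eG eV eU eC eB eA eb ea; ring.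
Qed.
End Derivation.

Section QuartMorphism.
Variables (R S : comNzRingType) (f : {rmorphism R -> S}).

Lemma rmorph_quad a x y : f (quad a x y) = quad (f \o a) (f x) (f y).
Proof. by rewrite /quad !(rmorphD, rmorphM, rmorphXn). Qed.
Lemma rmorph_cubic a x y : f (cubic a x y) = cubic (f \o a) (f x) (f y).
Proof. by rewrite /cubic !(rmorphD, rmorphM, rmorphXn). Qed.
Lemma rmorph_biquad a x y : f (biquad a x y) = biquad (f \o a) (f x) (f y).
Proof. by rewrite /biquad !(rmorphD, rmorphM, rmorphXn). Qed.

Lemma rmorph_quart c x y s t :
  f (quart c x y s t) = quart (map_quartic f c) (f x) (f y) (f s) (f t).
Proof.
rewrite /quart /= -!rmorph_quad -!rmorph_cubic -rmorph_biquad.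
move: (cubic (cfa c) x y) (cubic (cfb c) x y) => a b.
move: (quad (cfA c) s t) (quad (cfB c) s t) (quad (cfC c) s t) => A B C.
move: (cubic (cfU c) s t) (cubic (cfV c) s t) (biquad (cfG c) s t) => U V G.
by rewrite !(rmorphD, rmorphM, rmorphXn).
Qed.

Lemma rmorph_quart_1 c x y s t :
  f (quart_1 c x y s t) = quart_1 (map_quartic f c) (f x) (f y) (f s) (f t).
Proof. by rewrite /quart_1 /cubic_x /quad /cubic !(rmorphD, rmorphM, rmorphXn, rmorph_nat). Qed.
Lemma rmorph_quart_2 c x y s t :
  f (quart_2 c x y s t) = quart_2 (map_quartic f c) (f x) (f y) (f s) (f t).
Proof. by rewrite /quart_2 /cubic_y /quad /cubic !(rmorphD, rmorphM, rmorphXn, rmorph_nat). Qed.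
Lemma rmorph_quart_3 c x y s t :
  f (quart_3 c x y s t) = quart_3 (map_quartic f c) (f x) (f y) (f s) (f t).
Proof.
by rewrite /quart_3 /quad_x /cubic_x /biquad_x /cubic !(rmorphD, rmorphM, rmorphXn, rmorph_nat).
Qed.
Lemma rmorph_quart_4 c x y s t :
  f (quart_4 c x y s t) = quart_4 (map_quartic f c) (f x) (f y) (f s) (f t).
Proof.
by rewrite /quart_4 /quad_y /cubic_y /biquad_y /cubic !(rmorphD, rmorphM, rmorphXn, rmorph_nat).
Qed.
End QuartMorphism.

Section CompHomog.
Variable R : comNzRingType.

Lemma dhomog_comp n k d (p : {mpoly R[n]}) (lq : n.-tuple {mpoly R[k]}) : p \is d.-homog ->
  (forall i, tnth lq i \is 1.-homog) -> p \mPo lq \is d.-homog.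
Proof.
move=> hp hq; rewrite comp_mpolyE big_seq; apply: rpred_sum => m mp.
apply: dhomogZ; rewrite -(dhomog_mf hp mp) /= mdegE.
elim/big_rec2: _ => [|i e q _ hq']; first exact: dhomog1.
by apply: dhomogM => //; rewrite -[X in X.-homog]mul1n; apply: dhomogMn.
Qed.
End CompHomog.

Section FrameTheory.
Variable K : closedFieldType.
Hypotheses (nz2 : 2 != 0 :> K) (nz3 : 3 != 0 :> K).
Implicit Types (F : {mpoly K[4]}) (A : 'M[K]_4) (v : 'rV[K]_4).

Definition row4 (x y s t : K) : 'rV[K]_4 := \row_i nth 0 [:: x; y; s; t] i.

Lemma row4E (v : 'rV[K]_4) : v = row4 (v 0 0) (v 0 1) (v 0 2) (v 0 3).
Proof.
apply/rowP => i; rewrite mxE; case: i => -[|[|[|[|]]]]// hi /=;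
  by congr (v _ _); apply: val_inj.
Qed.

Lemma row4_entry x y s t :
  [/\ row4 x y s t 0 0 = x, row4 x y s t 0 1 = y, row4 x y s t 0 2 = s & row4 x y s t 0 3 = t].
Proof. by split; rewrite mxE. Qed.

Lemma row4_eq0 x y s t : row4 x y s t = 0 -> [/\ x = 0, y = 0, s = 0 & t = 0].
Proof.
have [e0 e1 e2 e3] := row4_entry x y s t.
by move=> e; split; [rewrite -e0|rewrite -e1|rewrite -e2|rewrite -e3]; rewrite e mxE.
Qed.

Lemma row4_lin u x y s t w x' y' s' t' : u *: row4 x y s t + w *: row4 x' y' s' t' =
  row4 (u * x + w * x') (u * y + w * y') (u * s + w * s') (u * t + w * t').
Proof. by apply/rowP => i; rewrite !mxE; case: i => -[|[|[|[|]]]]. Qed.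

Lemma meval_coordinate_form A i v : (coordinate_form A i).@[fun j => v 0 j] = (v *m A) 0 i.
Proof.
rewrite /coordinate_form raddf_sum mxE /=; apply: eq_bigr => j _.
by rewrite mevalZ mevalXU mulrC.
Qed.

Lemma mderiv_coordinate_form A i j : (coordinate_form A i)^`M(j) = (A j i)%:MP.
Proof.
rewrite /coordinate_form raddf_sum /= (bigD1 j)//= big1 => [|k kj]; last first.
  by rewrite mderivZ mderivX mnm1E (negbTE kj) scale0r scaler0.
rewrite mderivZ mderivX mnm1E eqxx scale1r addr0.
have -> : (U_(j) - U_(j))%MM = 0%MM by apply/mnmP => k; rewrite mnmBE mnm0E subnn.
by rewrite mpolyX0 alg_mpolyC.
Qed.

Definition at_coord (T : Type) (f : K -> K -> K -> K -> T) v := f (v 0 0) (v 0 1) (v 0 2) (v 0 3).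

Lemma meval_quart (c : quartic K) (v : 'I_4 -> K) x y s t :
  (quart (mpoly_quartic c) x y s t).@[v] = quart c x.@[v] y.@[v] s.@[v] t.@[v].
Proof.
rewrite rmorph_quart /=.
by rewrite /quart /quad /cubic /biquad /= !mevalC.
Qed.

Lemma frame_eval F A c v : frame F A c -> form_at F v = at_coord (quart c) (v *m A).
Proof. by move=> ->; rewrite /form_at meval_quart !meval_coordinate_form. Qed.

Lemma meval_quart_partials c (v : 'I_4 -> K) x y s t (x' y' s' t' : {mpoly K[4]}) :
  (quart_1 (mpoly_quartic c) x y s t * x' + quart_2 (mpoly_quartic c) x y s t * y'
   + quart_3 (mpoly_quartic c) x y s t * s' + quart_4 (mpoly_quartic c) x y s t * t').@[v]
  = quart_1 c x.@[v] y.@[v] s.@[v] t.@[v] * x'.@[v]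
    + quart_2 c x.@[v] y.@[v] s.@[v] t.@[v] * y'.@[v]
    + quart_3 c x.@[v] y.@[v] s.@[v] t.@[v] * s'.@[v]
    + quart_4 c x.@[v] y.@[v] s.@[v] t.@[v] * t'.@[v].
Proof.
have := rmorph_quart_1 (meval v) (mpoly_quartic c) x y s t.
have := rmorph_quart_2 (meval v) (mpoly_quartic c) x y s t.
have := rmorph_quart_3 (meval v) (mpoly_quartic c) x y s t.
have := rmorph_quart_4 (meval v) (mpoly_quartic c) x y s t.
move: (quart_1 _ _ _ _ _) (quart_2 _ _ _ _ _) (quart_3 _ _ _ _ _) (quart_4 _ _ _ _ _).
move=> q1 q2 q3 q4 e4 e3 e2 e1; rewrite !mevalD !mevalM e1 e2 e3 e4.
rewrite /quart_1 /quart_2 /quart_3 /quart_4 /cubic_x /cubic_y /quad /quad_x /quad_y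
  /cubic /biquad_x /biquad_y /= .
by rewrite !mevalC.
Qed.

Lemma coordinate_form_homog A i : coordinate_form A i \is 1.-homog.
Proof.
by apply: rpred_sum => j _; apply: dhomogZ; rewrite dhomogX /= mdeg1.
Qed.

Lemma coordinate_form_comp A B i :
  coordinate_form B i \mPo [tuple coordinate_form A j | j < 4] = coordinate_form (A *m B) i.
Proof.
rewrite /coordinate_form raddf_sum /=.
under eq_bigr => j _ do rewrite comp_mpolyZ comp_mpolyXU -tnth_nth tnth_mktuple scaler_sumr.
rewrite exchange_big /=; apply: eq_bigr => j _; rewrite mxE scaler_suml.
by apply: eq_bigr => k _; rewrite scalerA mulrC.
Qed.

Lemma coordinate_form1 i : coordinate_form 1%:M i = 'X_i :> {mpoly K[4]}.
Proof.
rewrite /coordinate_form (bigD1 i)//= mxE eqxx scale1r big1 ?addr0// => j ji.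
by rewrite mxE (negbTE ji) scale0r.
Qed.

Lemma frame_gradient F A c v j : frame F A c -> form_at F^`M(j) v =
  at_coord (quart_1 c) (v *m A) * A j 0 + at_coord (quart_2 c) (v *m A) * A j 1
  + at_coord (quart_3 c) (v *m A) * A j 2 + at_coord (quart_4 c) (v *m A) * A j 3.
Proof.
move=> ->; rewrite (@derivation_quart _ (mderiv j)); last first.
all: try by move=> *; rewrite /= mderivC.
  exact: mderivM.
  exact: mderivD.
by rewrite /form_at meval_quart_partials !meval_coordinate_form !mderiv_coordinate_form !mevalC.
Qed.

(** A zero of the gradient lies on the surface by Euler's relation, because 4 is invertible. *)
Lemma frame_smooth F A c : A \in unitmx -> frame F A c -> smooth_surface F ->
  forall x y s t, gradient_zero c x y s t -> [/\ x = 0, y = 0, s = 0 & t = 0].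
Proof.
move=> Au fr sm x y s t [g1 g2 g3 g4]; pose v := row4 x y s t *m invmx A.
have vA : v *m A = row4 x y s t by rewrite mulmxKV.
have [e0 e1 e2 e3] := row4_entry x y s t.
have [v0|v0] := eqVneq v 0; first by apply: row4_eq0; rewrite -vA v0 mul0mx.
have Fv : form_at F v = 0.
  rewrite (frame_eval v fr) vA /at_coord e0 e1 e2 e3.
  have nz4 : 4 != 0 :> K by have -> : 4 = 2 * 2 :> K by [ring]; rewrite mulf_neq0.
  by apply: (mulfI nz4); rewrite -quart_euler g1 g2 g3 g4 !mulr0 !addr0.
have [j /eqP[]] := sm v v0 Fv.
by rewrite (frame_gradient v j fr) vA /at_coord e0 e1 e2 e3 g1 g2 g3 g4 !mul0r !addr0.
Qed.

Lemma frame_exists F A (L : {vspace 'rV[K]_4}) : F \is 4.-homog -> A \in unitmx ->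
  (forall v, v \in L <-> (v *m A) 0 2 = 0 /\ (v *m A) 0 3 = 0) ->
  (forall v, v \in L -> form_at F v = 0) -> exists c, frame F A c.
Proof.
move=> hF Au LA FL; pose F' := F \mPo [tuple coordinate_form (invmx A) i | i < 4].
have hF' : F' \is 4.-homog.
  by apply: dhomog_comp => // i; rewrite tnth_mktuple coordinate_form_homog.
have F0 x y : F'.@[fun i => nth 0 [:: x; y; 0; 0] i] = 0.
  rewrite comp_mpoly_meval.
  pose v := row4 x y 0 0 *m invmx A.
  have vL : v \in L by apply/LA; rewrite mulmxKV//; have [_ _ -> ->] := row4_entry x y 0 0.
  rewrite -[RHS](FL v vL); apply: meval_eq => i; rewrite tnth_mktuple.
  rewrite -(meval_coordinate_form (invmx A) i (row4 x y 0 0)).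
  by apply: meval_eq => j; rewrite /row4 mxE.
have [c F'E] := homog4_quart hF' F0; exists c.
have FE : F = F' \mPo [tuple coordinate_form A i | i < 4].
  rewrite comp_mpolyA -[LHS]comp_mpoly_id; congr (comp_mpoly _ _).
  apply: eq_from_tnth => i; rewrite !tnth_mktuple.
  by rewrite coordinate_form_comp mulmxV// coordinate_form1.
rewrite /frame {1}FE F'E rmorph_quart /= !comp_mpolyXU -!tnth_nth !tnth_mktuple.
by rewrite /quart /quad /cubic /biquad /= !comp_mpolyC.
Qed.
End FrameTheory.

(** * Lines meeting a given line *)

Section VSpace.
Variables (K : fieldType) (V : vectType K).

Lemma dim_plane (a b : V) : a != 0 -> b \notin <[a]>%VS -> \dim (<[a]> + <[b]>) = 2%N.
Proof.
move=> a0 ba; have : free [:: b; a] by rewrite free_cons span_seq1 ba seq1_free.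
by rewrite /free => /eqP; rewrite span_cons span_seq1 addvC.
Qed.

Lemma mem_plane (a b v : V) : v \in (<[a]> + <[b]>)%VS -> exists u w, v = u *: a + w *: b.
Proof. by move=> /memv_addP[_ /vlineP[u ->] [_ /vlineP[w ->] ->]]; exists u, w. Qed.
End VSpace.

Section Lines.
Variable K : closedFieldType.
Hypotheses (nz2 : 2 != 0 :> K) (nz3 : 3 != 0 :> K).
Implicit Types (F : {mpoly K[4]}) (A : 'M[K]_4) (v : 'rV[K]_4) (L M : {vspace 'rV[K]_4}).

Definition adapted A L := A \in unitmx /\
  forall v, v \in L <-> (v *m A) 0 2 = 0 /\ (v *m A) 0 3 = 0.

Lemma adapted_exists L : \dim L = 2%N -> exists A, adapted A L.
Proof.
move=> dL; have [a [b [frab LE]]] : exists a b, free [:: a; b] /\ L = (<[a]> + <[b]>)%VS.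
  have := vbasisP L; move: (vbasis L); rewrite dL => -[[|a [|b [|]]]] //= sz.
  by move=> /andP[/eqP <- fr]; exists a, b; rewrite span_cons span_seq1.
pose U := \matrix_(i < 2) nth 0 [:: a; b] i.
have DU (D : 'rV_2) : D *m U = D 0 0 *: a + D 0 1 *: b.
  rewrite mulmx_sum_row !big_ord_recr big_ord0 /= add0r !rowK /=.
  by congr (D _ _ *: _ + D _ _ *: _); exact: val_inj.
have UL v : (v \in L) = (v <= U)%MS.
  apply/idP/submxP => [|[D ->]].
    rewrite LE => /mem_plane[u [w ->]]; exists (\row_i nth 0 [:: u; w] i).
    by rewrite DU !mxE.
  by rewrite DU LE memv_add// memvZ// memv_line.
have rU : \rank U = 2%N.
  apply/eqP; apply: inj_row_free => D; rewrite DU => D0.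
  have := frab; rewrite free_cons span_seq1 seq1_free => /andP[ab b0].
  have D00 : D 0 0 = 0.
    apply/eqP; apply: contraNT ab => D00; apply/vlineP; exists (- (D 0 1 / D 0 0)).
    apply: (scalerI D00); move/eqP: D0; rewrite addr_eq0 => /eqP ->.
    by rewrite scalerA mulrN mulrC divfK// scaleNr.
  move/eqP: D0; rewrite D00 scale0r add0r scaler_eq0 (negbTE b0) orbF => /eqP D01.
  apply/rowP => i; rewrite mxE; case: i => -[|[|]]// hi.
    by rewrite -[RHS]D00; congr (D _ _); exact: val_inj.
  by rewrite -[RHS]D01; congr (D _ _); exact: val_inj.
(* Multiplication by [row_ebase U] carries the span of the first two unit rows onto the row space of
   U, so its inverse turns membership in L into the vanishing of the last two coordinates. *)
exists (invmx (row_ebase U)); split; first by rewrite unitmx_inv row_ebase_unit.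
move=> v; rewrite UL submxE /cokermx mulmxA rU.
move: (v *m _) => w; rewrite /copid_mx mulmxBr mulmx1 subr_eq0.
have pE : w *m pid_mx 2 = row4 (w 0 0) (w 0 1) 0 0.
  apply/rowP => j; rewrite !mxE !big_ord_recr big_ord0 /= !mxE /=.
  case: j => -[|[|[|[|]]]]// hj /=; rewrite ?mulr1 ?mulr0 ?addr0 ?add0r //;
   by congr (w _ _); exact: val_inj.
have [_ _ e2 e3] := row4_entry (w 0 0) (w 0 1) 0 0.
rewrite pE; split => [/eqP e | [w2 w3]]; first by rewrite e; split; rewrite ?e2 ?e3.
by rewrite {1}[w]row4E w2 w3.
Qed.

Definition pt A x y s t := row4 x y s t *m invmx A.

Lemma pt_coord A x y s t : A \in unitmx -> pt A x y s t *m A = row4 x y s t.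
Proof. by move=> Au; rewrite mulmxKV. Qed.

Lemma pt_of A v : A \in unitmx ->
  v = pt A ((v *m A) 0 0) ((v *m A) 0 1) ((v *m A) 0 2) ((v *m A) 0 3).
Proof. by move=> Au; rewrite /pt -row4E mulmxK. Qed.

Lemma pt_lin A u x y s t w x' y' s' t' : u *: pt A x y s t + w *: pt A x' y' s' t' =
  pt A (u * x + w * x') (u * y + w * y') (u * s + w * s') (u * t + w * t').
Proof. by rewrite /pt -row4_lin mulmxDl !scalemxAl. Qed.

Lemma pt_inj A x y s t x' y' s' t' : A \in unitmx -> pt A x y s t = pt A x' y' s' t' ->
  [/\ x = x', y = y', s = s' & t = t'].
Proof.
move=> Au /(congr1 (mulmx^~ A)); rewrite !pt_coord// => e.
have [e0 e1 e2 e3] := row4_entry x y s t; have [f0 f1 f2 f3] := row4_entry x' y' s' t'.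
by split; [rewrite -e0 e|rewrite -e1 e|rewrite -e2 e|rewrite -e3 e].
Qed.

Lemma pt_eq0 A x y s t : A \in unitmx -> pt A x y s t = 0 -> [/\ x = 0, y = 0, s = 0 & t = 0].
Proof.
move=> Au e; apply: (pt_inj Au); rewrite e /pt (_ : row4 0 0 0 0 = 0) ?mul0mx//.
by apply/rowP => i; rewrite !mxE; case: i => -[|[|[|[|]]]].
Qed.

Lemma pt_mem A L x y s t : adapted A L -> (pt A x y s t \in L) <-> s = 0 /\ t = 0.
Proof.
by move=> [Au LA]; rewrite LA pt_coord//; have [_ _ -> ->] := row4_entry x y s t.
Qed.

Lemma frame_pt F A c x y s t : A \in unitmx -> frame F A c ->
  form_at F (pt A x y s t) = quart c x y s t.
Proof.
move=> Au fr; rewrite (frame_eval _ fr) pt_coord// /at_coord.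
by have [-> -> -> ->] := row4_entry x y s t.
Qed.

Lemma cubic_const (a b d e f : K) : (forall u, a * u ^+ 3 + b * u ^+ 2 + d * u + e = f) ->
  [/\ a = 0, b = 0, d = 0 & e = f].
Proof.
move=> h; have g : forall i, nth 0 [:: e - f; d; b; a] i = 0.
  by apply: Poly_eq0 => x; rewrite horner_Poly /= -[RHS](subrr f) -[X in _ = X - f](h x); ring.
by move: (g 0%N) (g 1%N) (g 2%N) (g 3%N) => /= /eqP; rewrite subr_eq0 => /eqP.
Qed.

(** Constancy in u means contact of order at least four with the surface at (x : 1 : 0 : 0). The
    case e = 0 gives lines on the surface; a general e gives flex tangents, and is what carries the
    flex condition to another frame. Contact makes (s, t) proportional to ([sF], [tF]), with factor
    r. *)
Lemma osculating_normal (c : quartic K) x m s t e :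
  (forall x y, cubic (cfa c) x y = 0 -> cubic (cfb c) x y = 0 -> x = 0 /\ y = 0) ->
  ~ (s = 0 /\ t = 0) -> (forall u, quart c (u * x + m) u s t = e) ->
  exists n r, [/\ r != 0, m = r * n, s = r * sF c x, t = r * tF c x &
   [/\ fJ c x * n + fQ c x = 0, fE c x * n ^+ 2 + 2 * fY c x * n + 2 * fL c x = 0 &
     r ^+ 4 * top_cubic c (sF c x) (tF c x) n 1 = e]].
Proof.
move=> cop st0 h.
have h2 u : 2 * cres c x s t * u ^+ 3 + 2 * (cJ c x s t * m + cQ c x s t) * u ^+ 2
    + (cE c x s t * m ^+ 2 + 2 * cY c x s t * m + 2 * cL c x s t) * u
    + 2 * top_cubic c s t m 1 = 2 * e.
  rewrite -(h u); have := plane_cubic_pencil c s t x u m 1.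
  by have := quart_plane c s t (u * x + m) u 1; rewrite !mul1r => -> ->; ring.
have [a0 b0 d0 e0] := cubic_const h2.
have {}a0 : s * cubic (cfa c) x 1 + t * cubic (cfb c) x 1 = 0 by apply: (mulfI nz2); rewrite mulr0 -a0 /cres; ring.
have {}b0 : cJ c x s t * m + cQ c x s t = 0 by apply: (mulfI nz2); rewrite mulr0.
have {}e0 : top_cubic c s t m 1 = e by apply: (mulfI nz2).
have [r [sr tr]] : exists r, s = r * sF c x /\ t = r * tF c x.
  have [s0|s0] := eqVneq (sF c x) 0.
    have t0 : tF c x != 0.
      by apply/eqP => /eqP; rewrite oppr_eq0 => /eqP t0; have [_ /eqP] := cop _ _ t0 s0; rewrite oner_eq0.
    exists (t / tF c x); rewrite s0 mulr0 divfK//; split=> //.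
    apply: (mulIf t0); rewrite mul0r -[RHS]oppr0 -a0.
    by rewrite (s0 : cubic (cfb c) x 1 = 0) /tF; ring.
  exists (s / sF c x); rewrite divfK//; split=> //.
  apply: (mulIf s0); rewrite mulrAC divfK// /tF /sF.
  by apply/eqP; rewrite -subr_eq0 -a0; apply/eqP; ring.
have r0 : r != 0 by apply: contra_notN st0 => /eqP r0; rewrite sr tr r0 !mul0r.
exists (m / r), r; have mr : m = r * (m / r) by rewrite mulrC divfK.
move: (m / r) mr => n mr; split=> //; subst m; move: b0 d0 e0; rewrite sr tr.
set s1 := sF c x; set t1 := tF c x => b0 d0 e0; split.
- have r2 : r ^+ 2 != 0 by rewrite expf_neq0.
  apply: (mulfI r2); rewrite mulr0 -[RHS]b0 /fJ /fQ /cJ /cQ /quad -/s1 -/t1; ring.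
- have r3 : r ^+ 3 != 0 by rewrite expf_neq0.
  apply: (mulfI r3); rewrite mulr0 -[RHS]d0 /fE /fY /fL /cE /cY /cL /quad /cubic -/s1 -/t1; ring.
- by rewrite -e0 /top_cubic /cK /quad /cubic /biquad; ring.
Qed.

Section InFrame.
Variables (F : {mpoly K[4]}) (L : {vspace 'rV[K]_4}) (A : 'M[K]_4) (c : quartic K).
Hypotheses (AL : adapted A L) (fr : frame F A c) (smF : smooth_surface F).
Hypothesis L_on : line_on F L.
Let Au : A \in unitmx. Proof. by case: AL. Qed.
Let sm := frame_smooth nz2 Au fr smF.
Let cop := cubics_coprime sm.

Definition line_of (z : K * K) : {vspace 'rV[K]_4} :=
  (<[pt A z.1 1 0 0]> + <[pt A z.2 0 (sF c z.1) (tF c z.1)]>)%VS.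

Lemma line_of_dim z : \dim (line_of z) = 2%N.
Proof.
apply: dim_plane.
  by apply/eqP => /(pt_eq0 Au)[_ /eqP]; rewrite oner_eq0.
apply/negP => /vlineP[u e]; have : pt A z.2 0 (sF c z.1) (tF c z.1) \in L.
  by rewrite e memvZ//; apply/(pt_mem _ _ _ _ AL).
by move=> /(pt_mem _ _ _ _ AL) [s0 t0]; exact: (st_neq0 sm s0 t0).
Qed.

Lemma line_of_meet z x y : pt A x y 0 0 \in line_of z -> x = z.1 * y.
Proof.
move=> /mem_plane[u [w]]; rewrite pt_lin => /(pt_inj Au)[].
rewrite !mulr0 !add0r !addr0 mulr1 => -> -> s0 t0.
have -> : w = 0; last by rewrite mul0r addr0 mulrC.
apply/eqP; apply: contraT => w0.
by case: (@st_neq0 _ _ sm z.1); apply: (mulfI w0); rewrite mulr0.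
Qed.

Lemma quart_line_of z u w : line_pair c z ->
  quart c (u * z.1 + w * z.2) u (w * sF c z.1) (w * tF c z.1) = 0.
Proof.
case: z => x n [/=]; set s := sF c x; set t := tF c x => e1 e2 e3.
rewrite quart_plane; apply: (mulfI nz2); rewrite mulr0 mulrCA plane_cubic_pencil.
have -> : cres c x s t = 0 by rewrite /cres /s /t /sF /tF; ring.
rewrite -[cJ _ _ _ _]/(fJ c x) -[cQ _ _ _ _]/(fQ c x) -[cE _ _ _ _]/(fE c x).
rewrite -[cY _ _ _ _]/(fY c x) -[cL _ _ _ _]/(fL c x).
transitivity (w * (2 * u ^+ 2 * w * (fJ c x * n + fQ c x)
   + u * w ^+ 2 * (fE c x * n ^+ 2 + 2 * fY c x * n + 2 * fL c x)
   + 2 * w ^+ 3 * top_cubic c s t n 1)); last by rewrite e1 e2 e3; ring.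
rewrite /top_cubic; ring.
Qed.

Lemma line_of_line z : line_pair c z -> other_lines_meeting F L (line_of z).
Proof.
move=> lz; split.
- split; first exact: line_of_dim.
  move=> v /mem_plane[u [w ->]]; rewrite pt_lin (frame_pt _ _ _ _ Au fr).
  by rewrite !mulr0 !add0r addr0 mulr1 quart_line_of.
- move=> e; have : pt A 1 0 0 0 \in line_of z by rewrite e; apply/(pt_mem _ _ _ _ AL).
  by move=> /line_of_meet /eqP; rewrite mulr0 oner_eq0.
- exists (pt A z.1 1 0 0); split.
  + by apply/eqP => /(pt_eq0 Au)[_ /eqP]; rewrite oner_eq0.
  + exact/(pt_mem _ _ _ _ AL).
  + by apply: (subvP (addvSl _ _)); exact: memv_line.
Qed.

Lemma line_ofP M : other_lines_meeting F L M -> pt A 1 0 0 0 \notin M ->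
  exists2 z, line_pair c z & M = line_of z.
Proof.
move=> [[dM FM] ML [v [v0 vL vM]]] e1M.
have [v2 v3] : (v *m A) 0 2 = 0 /\ (v *m A) 0 3 = 0 by apply/(proj2 AL).
have := pt_of v Au; rewrite v2 v3; set x := (v *m A) 0 0; set y := (v *m A) 0 1 => vE.
have y0 : y != 0.
  apply/eqP => y0; have x0 : x != 0.
    apply/eqP => x0; move: v0; rewrite vE x0 y0 /pt (_ : row4 0 0 0 0 = 0) ?mul0mx ?eqxx//.
    by apply/rowP => i; rewrite !mxE; case: i => -[|[|[|[|]]]].
  have vx : x^-1 *: v \in M by rewrite memvZ.
  move: e1M; have -> : pt A 1 0 0 0 = x^-1 *: v; last by rewrite vx.
  have := pt_lin A x^-1 x y 0 0 0 0 0 0 0; rewrite -vE scale0r addr0 => ->.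
  by rewrite y0 !mulr0 !addr0 mulVf.
have xi := pt_lin A y^-1 x y 0 0 0 0 0 0 0; rewrite -vE scale0r in xi.
rewrite !mul0r !mulr0 !addr0 mulVf// mulrC in xi.
set X := x / y in xi.
have vX : pt A X 1 0 0 \in M by rewrite -xi memvZ.
have [w wM wL] : exists2 w, w \in M & w \notin L.
  apply/subvPn; apply/negP => sML; apply: ML; apply/eqP.
  by rewrite -(geq_leqif (dimv_leqif_eq sML)) dM; case: L_on => ->.
have := pt_of w Au; set w0 := (w *m A) 0 0; set w1 := (w *m A) 0 1.
set w2 := (w *m A) 0 2; set w3 := (w *m A) 0 3 => wE.
have w23 : ~ (w2 = 0 /\ w3 = 0) by move=> h; move: wL; apply/negP; rewrite negbK; apply/(proj2 AL).
pose m := w0 - w1 * X.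
have w'M : pt A m 0 w2 w3 \in M.
  have -> : pt A m 0 w2 w3 = 1 *: w + (- w1) *: pt A X 1 0 0.
    by rewrite wE pt_lin; congr (pt A); rewrite /m; ring.
  by apply: memvD; apply: memvZ.
have osc u : quart c (u * X + m) u w2 w3 = 0.
  rewrite -(frame_pt _ _ _ _ Au fr); apply: FM.
  have -> : pt A (u * X + m) u w2 w3 = u *: pt A X 1 0 0 + 1 *: pt A m 0 w2 w3.
    by rewrite pt_lin; congr (pt A); ring.
  by apply: memvD; apply: memvZ.
have [n [r [r0 mE sE tE [h1 h2 h3]]]] := osculating_normal cop w23 osc.
exists (X, n).
  split=> //; apply/eqP; move/eqP: h3; by rewrite mulf_eq0 expf_eq0 (negbTE r0) andbF.
apply/eqP; rewrite eq_sym -(geq_leqif (dimv_leqif_eq _)) ?dM ?line_of_dim//.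
rewrite subv_add; apply/andP; split; first by rewrite -memvE.
have -> : pt A n 0 (sF c X) (tF c X) = r^-1 *: pt A m 0 w2 w3.
  have := pt_lin A r^-1 m 0 w2 w3 0 0 0 0 0; rewrite scale0r addr0 => ->.
  by rewrite mE sE tE !mul0r !mulr0 !addr0 !mulKf.
by rewrite -memvE memvZ.
Qed.

Lemma lines_pairs (Ms : seq {vspace 'rV[K]_4}) :
  (forall M, M \in Ms -> other_lines_meeting F L M) ->
  (forall M, M \in Ms -> pt A 1 0 0 0 \notin M) ->
  exists2 zs, Ms = [seq line_of z | z <- zs] & forall z, z \in zs -> line_pair c z.
Proof.
elim: Ms => [|M Ms ih] h1 h2; first by exists [::].
have [||zs -> hz] := ih.
- by move=> N hN; apply: h1; rewrite inE hN orbT.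
- by move=> N hN; apply: h2; rewrite inE hN orbT.
have [z lz ->] := line_ofP (h1 M (mem_head _ _)) (h2 M (mem_head _ _)).
by exists (z :: zs) => // z'; rewrite inE => /orP[/eqP->//|/hz].
Qed.

End InFrame.
End Lines.

(** * Reduction to the normal form *)

Section Ramification.
Variable K : closedFieldType.
Hypotheses (nz2 : 2 != 0 :> K) (nz3 : 3 != 0 :> K).

Lemma cubic_zero (a : nat -> K) : exists x y, ~ (x = 0 /\ y = 0) /\ cubic a x y = 0.
Proof.
have [a0|a0] := eqVneq (a 0%N) 0.
  exists 1, 0; split; first by case=> /eqP; rewrite oner_eq0.
  by rewrite /cubic a0; ring.
have /closed_rootP[x /rootP px] : size (Poly [:: a 3; a 2; a 1; a 0])%N != 1%N.
  by rewrite (@PolyK _ 0).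
exists x, 1; split; first by case=> _ /eqP; rewrite oner_eq0.
by rewrite -[RHS]px horner_Poly /cubic /=; ring.
Qed.

Variable c : quartic K.
Hypothesis (sm : forall x y s t, gradient_zero c x y s t -> [/\ x = 0, y = 0, s = 0 & t = 0]).

(** The binary cubic s a + t b vanishes at z together with its first two derivatives, which are J
    and E; hence it is a multiple of (x - z y)^3. *)
Lemma total_ramification z x y : fJ c z = 0 -> fE c z = 0 ->
  sF c z * cubic (cfa c) x y + tF c z * cubic (cfb c) x y =
  cK c (sF c z) (tF c z) * (x - z * y) ^+ 3.
Proof.
have : cres c z (sF c z) (tF c z) = 0 by rewrite /cres /sF /tF; ring.
rewrite /fJ /fE /cres /cJ /cE /cK; move: (sF c z) (tF c z) => s t r0 j0 e0.
set g0 := s * cfa c 0 + t * cfb c 0; pose g1 := s * cfa c 1 + t * cfb c 1.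
pose g2 := s * cfa c 2 + t * cfb c 2; pose g3 := s * cfa c 3 + t * cfb c 3.
have e1 : g1 = - (3 * g0 * z).
  apply: (mulfI nz2); apply/eqP; rewrite -subr_eq0 -[X in _ == X]e0 /cubic_xx.
  by apply/eqP; rewrite /g0 /g1; ring.
have e2 : g2 = - (3 * g0 * z ^+ 2 + 2 * g1 * z).
  apply/eqP; rewrite -subr_eq0 -[X in _ == X]j0 /cubic_x.
  by apply/eqP; rewrite /g0 /g1 /g2; ring.
have e3 : g3 = - (g0 * z ^+ 3 + g1 * z ^+ 2 + g2 * z).
  apply/eqP; rewrite -subr_eq0 -[X in _ == X]r0 /cubic.
  by apply/eqP; rewrite /g0 /g1 /g2 /g3; ring.
transitivity (g0 * x ^+ 3 + g1 * x ^+ 2 * y + g2 * x * y ^+ 2 + g3 * y ^+ 3).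
  by rewrite /cubic /g0 /g1 /g2 /g3; ring.
by rewrite e3 e2 e1; ring.
Qed.

(** If J = 0 identically, then so are E and its derivative, and [cK] vanishes at the point 0. By
    [total_ramification], s a + t b is there the zero cubic, so that a and b have a common zero. The
    choice of a generic frame rests on this. *)
Lemma pJ_nonzero : pJ c != 0.
Proof.
apply/eqP => J0.
have E0 : pE c = 0 by rewrite -deriv_pJ J0 deriv0.
have fJ0 : fJ c 0 = 0 by rewrite -horner_pJ J0 horner0.
have fE0 : fE c 0 = 0 by rewrite -horner_pE E0 horner0.
have [l [hs ht]] := ramification_ratio sm fJ0.
have k0 : cK c (sF c 0) (tF c 0) = 0.
  have nz6 : 6 != 0 :> K by have -> : 6 = 2 * 3 :> K by [ring]; rewrite mulf_neq0.
  apply: (mulfI nz6); rewrite mulr0.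
  by have := deriv_pE_at hs ht; rewrite E0 deriv0 horner0 fE0 mulr0 addr0.
have h x y := total_ramification x y fJ0 fE0.
have [s0|s0] := eqVneq (sF c 0) 0.
  have t0 : tF c 0 != 0 by apply/eqP => t0; exact: (st_neq0 sm s0 t0).
  have [x [y [xy a0]]] := cubic_zero (cfa c).
  apply: xy; apply: (cubics_coprime sm) => //.
  by apply: (mulfI t0); rewrite mulr0; have := h x y; rewrite k0 s0 !mul0r add0r.
have [x [y [xy b0]]] := cubic_zero (cfb c).
apply: xy; apply: (cubics_coprime sm) => //.
by apply: (mulfI s0); rewrite mulr0; have := h x y; rewrite k0 b0 mul0r mulr0 addr0.
Qed.

End Ramification.

(** * Changes of frame preserving the line *)

Section ChangeOfFrame.
Variable K : closedFieldType.
Hypotheses (nz2 : 2 != 0 :> K) (nz3 : 3 != 0 :> K).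
Implicit Types (F : {mpoly K[4]}) (A : 'M[K]_4) (v : 'rV[K]_4) (L M : {vspace 'rV[K]_4}).

Definition mx4 (r : seq (seq K)) : 'M[K]_4 := \matrix_(i, j) nth 0 (nth [::] r i) j.

Lemma row4_mx4 x y s t r0 r1 r2 r3 : row4 x y s t *m mx4 [:: r0; r1; r2; r3] =
  \row_j (x * nth 0 r0 j + y * nth 0 r1 j + s * nth 0 r2 j + t * nth 0 r3 j).
Proof.
by apply/rowP => j; rewrite !mxE !big_ord_recr big_ord0 /= !mxE /= add0r.
Qed.

Definition block4 (a b d e p q r u : K) :=
  mx4 [:: [:: a; b; 0; 0]; [:: d; e; 0; 0]; [:: 0; 0; p; q]; [:: 0; 0; r; u]].

Lemma row4_block4 x y s t a b d e p q r u : row4 x y s t *m block4 a b d e p q r u =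
  row4 (x * a + y * d) (x * b + y * e) (s * p + t * r) (s * q + t * u).
Proof.
rewrite row4_mx4; apply/rowP => j; rewrite !mxE.
by case: j => -[|[|[|[|]]]]//= _; rewrite !mulr0 ?addr0 ?add0r.
Qed.

Lemma mx_row4P (A B : 'M[K]_4) : (forall x y s t, row4 x y s t *m A = row4 x y s t *m B) -> A = B.
Proof.
move=> h; apply/row_matrixP => i; rewrite !rowE.
by rewrite [delta_mx 0 i]row4E h.
Qed.

Lemma block4_unit a b d e p q r u : a * e - b * d != 0 -> p * u - q * r != 0 ->
  block4 a b d e p q r u \in unitmx.
Proof.
move=> D1 D2.
suff : block4 a b d e p q r u *m block4 (e / (a * e - b * d)) (- b / (a * e - b * d))
   (- d / (a * e - b * d)) (a / (a * e - b * d)) (u / (p * u - q * r)) (- q / (p * u - q * r))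
   (- r / (p * u - q * r)) (p / (p * u - q * r)) = 1%:M by case/mulmx1_unit.
apply: mx_row4P => x y s t; rewrite mulmxA !row4_block4 mulmx1.
by congr row4; field; rewrite ?D1 ?D2.
Qed.

Lemma adapted_block4 A L a b d e p q r u : adapted A L ->
  a * e - b * d != 0 -> p * u - q * r != 0 -> adapted (A *m block4 a b d e p q r u) L.
Proof.
move=> [Au LA] D1 D2; split; first by rewrite unitmx_mul Au block4_unit.
move=> v; rewrite mulmxA [v *m A]row4E row4_block4.
have [_ _ -> ->] := row4_entry ((v *m A) 0 0 * a + (v *m A) 0 1 * d)
  ((v *m A) 0 0 * b + (v *m A) 0 1 * e) ((v *m A) 0 2 * p + (v *m A) 0 3 * r)
  ((v *m A) 0 2 * q + (v *m A) 0 3 * u).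
rewrite LA; move: ((v *m A) 0 2) ((v *m A) 0 3) => s t.
split=> [[-> ->]|[h1 h2]]; first by rewrite !mul0r addr0.
split; apply: (mulIf D2); rewrite mul0r.
  by transitivity (u * (s * p + t * r) - r * (s * q + t * u)); [ring|rewrite h1 h2; ring].
by transitivity (p * (s * q + t * u) - q * (s * p + t * r)); [ring|rewrite h1 h2; ring].
Qed.

Lemma gradient_dir F A c (d : 'rV[K]_4) v : frame F A c ->
  \sum_j d 0 j * form_at F^`M(j) v =
  at_coord (quart_1 c) (v *m A) * (d *m A) 0 0 + at_coord (quart_2 c) (v *m A) * (d *m A) 0 1
  + at_coord (quart_3 c) (v *m A) * (d *m A) 0 2 + at_coord (quart_4 c) (v *m A) * (d *m A) 0 3.
Proof.
move=> fr; rewrite !mxE !mulr_sumr -!big_split /=; apply: eq_bigr => j _.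
by rewrite (frame_gradient v j fr); ring.
Qed.

(** At a point of the line, s a + t b is the derivative of the form in the direction d, whatever the
    frame. The cubics of a new frame are thus found without expanding the form. *)
Lemma normal_derivative F A c A' c' x y (d : 'rV[K]_4) : frame F A c -> frame F A' c' ->
  forall v, v *m A = row4 x y 0 0 -> forall x' y', v *m A' = row4 x' y' 0 0 ->
  forall s t s' t', d *m A = row4 0 0 s t -> d *m A' = row4 0 0 s' t' ->
  s * cubic (cfa c) x y + t * cubic (cfb c) x y =
  s' * cubic (cfa c') x' y' + t' * cubic (cfb c') x' y'.
Proof.
move=> fr fr' v vA x' y' vA' s t s' t' dA dA'.
have := gradient_dir d v fr; rewrite (gradient_dir d v fr') /at_coord vA vA' dA dA'.
have [-> -> -> ->] := row4_entry x y 0 0; have [-> -> -> ->] := row4_entry x' y' 0 0.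
have [-> -> -> ->] := row4_entry 0 0 s t; have [-> -> -> ->] := row4_entry 0 0 s' t'.
rewrite !mulr0 !add0r /quart_3 /quart_4 /quad_x /quad_y /cubic_x /cubic_y /biquad_x /biquad_y.
rewrite !expr0n /= !(mulr0, mul0r, addr0).
by move=> h; rewrite mulrC [t * _]mulrC -h mulrC [t' * _]mulrC.
Qed.
End ChangeOfFrame.

(** * Generic frames, and the ramification forced by many lines *)

Section Special.
Variable K : closedFieldType.
Hypotheses (nz2 : 2 != 0 :> K) (nz3 : 3 != 0 :> K).
Implicit Types (A : 'M[K]_4) (v : 'rV[K]_4) (M : {vspace 'rV[K]_4}).

Lemma cubic_coef (a b : nat -> K) : (forall x, cubic a x 1 = cubic b x 1) ->
  [/\ a 0%N = b 0%N, a 1%N = b 1%N, a 2%N = b 2%N & a 3%N = b 3%N].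
Proof.
move=> h; have g : forall i, nth 0 [:: a 3 - b 3; a 2 - b 2; a 1 - b 1; a 0 - b 0] i = 0.
  apply: Poly_eq0 => x; rewrite horner_Poly /= -[RHS](subrr (cubic b x 1)) -[in X in _ = X - _]h.
  by rewrite /cubic; ring.
by split; apply/eqP; rewrite -subr_eq0; apply/eqP; [exact: (g 3%N)|exact: (g 2%N)|exact: (g 1%N)|exact: (g 0%N)].
Qed.

Variables (F : {mpoly K[4]}) (L : {vspace 'rV[K]_4}).
Hypotheses (hF : F \is 4.-homog) (smF : smooth_surface F) (L_on : line_on F L).

Lemma adapted_frame A : adapted A L -> exists c, frame F A c.
Proof. by move=> [Au LA]; apply: frame_exists hF Au LA (proj2 L_on). Qed.

Lemma meeting_at_most_once A M : adapted A L -> other_lines_meeting F L M ->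
  exists z, forall x, pt A x 1 0 0 \in M -> x = z.
Proof.
move=> AL [[dM _] ML _].
have [[z zM]|no] := boolp.EM (exists z, pt A z 1 0 0 \in M); last first.
  by exists 0 => x xM; case: no; exists x.
exists z => x xM; apply/eqP; apply: contraT => xz; case: ML.
apply/eqP; rewrite eq_sym -(geq_leqif (dimv_leqif_eq _)); last first.
  apply/subvP => v vL.
  have [Au LA] := AL; have [v2 v3] : (v *m A) 0 2 = 0 /\ (v *m A) 0 3 = 0 by apply/LA.
  have := pt_of v Au; rewrite v2 v3; move: ((v *m A) 0 0) ((v *m A) 0 1) => a b ->.
  have xz0 : x - z != 0 by rewrite subr_eq0.
  have -> : pt A a b 0 0 = ((a - z * b) / (x - z)) *: pt A x 1 0 0
      + (b - (a - z * b) / (x - z)) *: pt A z 1 0 0.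
    rewrite pt_lin; congr (pt A); last 3 first; try ring.
    by field.
  by apply: memvD; apply: memvZ.
by rewrite dM (proj1 L_on).
Qed.

Lemma generic_frame (Ms : seq {vspace 'rV[K]_4}) :
  (forall M, M \in Ms -> other_lines_meeting F L M) ->
  exists A c, [/\ adapted A L, frame F A c, cfa c 0 * cfb c 1 - cfa c 1 * cfb c 0 != 0
    & forall M, M \in Ms -> pt A 1 0 0 0 \notin M].
Proof.
move=> hM; have [A0 A0L] := adapted_exists (proj1 L_on).
have [c0 fr0] := adapted_frame A0L; have [A0u _] := A0L.
have sm0 := frame_smooth nz2 A0u fr0 smF.
have [p p0 pM] : exists2 p : {poly K}, p != 0 &
    forall M x, M \in Ms -> pt A0 x 1 0 0 \in M -> root p x.
  elim: Ms hM => [|M Ms ih] hM; first by exists 1; rewrite ?oner_neq0.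
  have [|p p0 pM] := ih; first by move=> N hN; apply: hM; rewrite inE hN orbT.
  have [z hz] := meeting_at_most_once A0L (hM M (mem_head _ _)).
  exists (p * ('X - z%:P)); first by rewrite mulf_neq0// polyXsubC_eq0.
  move=> N x; rewrite inE rootM root_XsubC => /orP[/eqP-> /hz ->|hN xN]; first by rewrite eqxx orbT.
  by rewrite (pM _ _ hN xN).
have /closed_nonrootP[l] : p * pJ c0 != 0 by rewrite mulf_neq0// pJ_nonzero.
rewrite rootM negb_or => /andP[pl]; rewrite /root horner_pJ => Jl.
(* The chosen point (l : 1 : 0 : 0) becomes (1 : 0 : 0 : 0). *)
pose A := A0 *m block4 0 1 1 (- l) 1 0 0 1.
have AL : adapted A L.
  by apply: adapted_block4 => //; rewrite ?mul0r ?mulr1 ?sub0r ?subr0 ?oppr_eq0 oner_neq0.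
have [c fr] := adapted_frame AL; have [Au _] := AL.
have ptA x y s t : pt A x y s t = pt A0 (l * x + y) x s t.
  rewrite [RHS](pt_of _ Au) mulmxA pt_coord// row4_block4.
  set r := row4 _ _ _ _; have [-> -> -> ->] := row4_entry ((l * x + y) * 0 + x * 1)
    ((l * x + y) * 1 + x * - l) (s * 1 + t * 0) (s * 0 + t * 1).
  by congr (pt A); ring.
have normal x y s t : s * cubic (cfa c) x y + t * cubic (cfb c) x y =
    s * cubic (cfa c0) (l * x + y) x + t * cubic (cfb c0) (l * x + y) x.
  apply: (normal_derivative fr fr0 (v := pt A x y 0 0) (d := pt A 0 0 s t)); rewrite ?pt_coord//.
  - by rewrite ptA pt_coord.
  - by rewrite ptA pt_coord// mulr0 addr0.
(* The Taylor coefficients of a(x, 1) at l. *)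
pose b (a : nat -> K) i := nth 0 [:: cubic a l 1; cubic_x a l 1; 3 * a 0%N * l + a 1%N; a 0%N] i.
have bE a x : cubic a (l * x + 1) x = cubic (b a) x 1.
  by rewrite /b /cubic /cubic_x /=; ring.
have [a0 a1 _ _] : [/\ cfa c 0 = b (cfa c0) 0, cfa c 1 = b (cfa c0) 1, cfa c 2 = b (cfa c0) 2
    & cfa c 3 = b (cfa c0) 3]%N.
  by apply: cubic_coef => x; have := normal x 1 1 0; rewrite !mul1r !mul0r !addr0 bE.
have [b0 b1 _ _] : [/\ cfb c 0 = b (cfb c0) 0, cfb c 1 = b (cfb c0) 1, cfb c 2 = b (cfb c0) 2
    & cfb c 3 = b (cfb c0) 3]%N.
  by apply: cubic_coef => x; have := normal x 1 0 1; rewrite !mul1r !mul0r !add0r bE.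
exists A, c; split=> //.
  (* The determinant in the new frame is - J(l). *)
  rewrite a0 a1 b0 b1 /b /=; apply: contraNneq Jl => h.
  by rewrite -oppr_eq0 -h /fJ /cJ /sF /tF; apply/eqP; ring.
move=> M hMs; apply: contra pl; rewrite ptA mulr1 addr0.
exact: pM.
Qed.

Lemma many_lines_ramification (Ms : seq {vspace 'rV[K]_4}) : uniq Ms ->
  (forall M, M \in Ms -> other_lines_meeting F L M) -> (18 < size Ms)%N ->
  exists A c z1 z2, [/\ adapted A L, frame F A c, pR c = 0 /\ pJ c != 0, z1 <> z2 &
    [/\ fJ c z1 = 0, fE c z1 = 0, fJ c z2 = 0 & fE c z2 = 0] /\
    (cK c (sF c z1) (tF c z1) != 0 /\ cK c (sF c z2) (tF c z2) != 0)].
Proof.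
move=> uM hM sz; have [A [c [AL fr unram e1M]]] := generic_frame hM.
have [Au _] := AL; have sm := frame_smooth nz2 Au fr smF.
have [zs ME hz] := lines_pairs nz2 AL fr smF L_on hM e1M.
have uz : uniq zs by apply: (@map_uniq _ _ (line_of A c)); rewrite -ME.
have szz : (18 < size zs)%N by move: sz; rewrite ME size_map.
have R0 : pR c = 0.
  apply/eqP; apply: contraT => R0; move: szz; rewrite ltnNge.
  by rewrite (lines_first_kind nz2 sm unram uz hz R0).
have [[z1 [z2 [z12 J]]]|no] := boolp.EM (exists z1 z2, z1 <> z2 /\
    [/\ fJ c z1 = 0, fE c z1 = 0, fJ c z2 = 0 & fE c z2 = 0]).
  exists A, c, z1, z2; split=> //; first by rewrite pJ_nonzero.
  by split=> //; case: J => J1 E1 J2 E2; rewrite !cK_neq0.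
move: szz; rewrite ltnNge (lines_second_kind nz2 nz3 sm unram R0)// => x y Jx Ex Jy Ey.
by apply/eqP; apply: contraT => /eqP xy; case: no; exists x, y.
Qed.

End Special.

(** * Frames with total ramification at zero and infinity *)

Section SpecialFrame.
Variable K : closedFieldType.
Hypotheses (nz2 : 2 != 0 :> K) (nz3 : 3 != 0 :> K).
Implicit Types (A : 'M[K]_4) (v : 'rV[K]_4) (M : {vspace 'rV[K]_4}).

Definition monomial_cubics (c : quartic K) :=
  [/\ cfa c 0 = 1, cfa c 1 = 0, cfa c 2 = 0 & cfa c 3 = 0] /\
  [/\ cfb c 0 = 0, cfb c 1 = 0, cfb c 2 = 0 & cfb c 3 = 1].

Lemma flexion_root (e j q y l n : K) : j * n + q = 0 -> e * n ^+ 2 + 2 * y * n + 2 * l = 0 ->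
  flexion e j q y l = 0.
Proof.
move=> h1 h2; have -> : q = - (j * n) by apply/eqP; rewrite -addr_eq0 addrC h1.
by rewrite -[RHS](mulr0 (j ^+ 2)) -h2 /flexion; ring.
Qed.

Variables (F : {mpoly K[4]}) (L : {vspace 'rV[K]_4}).
Hypotheses (hF : F \is 4.-homog) (smF : smooth_surface F) (L_on : line_on F L).

(** In the coordinates x - z1 y and x - z2 y, with the tangent planes at z1 and z2 as coordinate
    planes, [total_ramification] turns the two cubics into cubes. Flex tangents do not depend on the
    frame, so the new R vanishes at all but finitely many points. *)
Lemma special_frame (Ms : seq {vspace 'rV[K]_4}) : uniq Ms ->
  (forall M, M \in Ms -> other_lines_meeting F L M) -> (18 < size Ms)%N ->
  exists A c, [/\ adapted A L, frame F A c, monomial_cubics c & pR c = 0].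
Proof.
move=> uM hM sz.
have [A [c [z1 [z2 [AL fr [R0 J0] /eqP z12 [[J1 E1 J2 E2] [k1 k2]]]]]]] :=
  many_lines_ramification nz2 nz3 hF smF L_on uM hM sz.
have [Au _] := AL; have sm := frame_smooth nz2 Au fr smF.
have h1 x y := total_ramification nz2 x y J1 E1; have h2 x y := total_ramification nz2 x y J2 E2.
move: k1 k2 h1 h2; set k1 := cK _ _ _; set k2 := cK _ _ _.
set s1 := sF c z1; set t1 := tF c z1; set s2 := sF c z2; set t2 := tF c z2.
move=> k10 k20 h1 h2.
have D0 : s1 * t2 - s2 * t1 != 0.
  have -> : s1 * t2 - s2 * t1 = k2 * (z1 - z2) ^+ 3.
    by rewrite -[z2]mulr1 -h2 /s1 /t1 /sF /tF; ring.
  by rewrite mulf_neq0// expf_neq0// subr_eq0.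
set D := s1 * t2 - s2 * t1 in D0.
(* The second block is the dual basis of (s1, t1) / k1 and (s2, t2) / k2; this scaling makes both
   cubes monic. *)
pose B := block4 1 1 (- z1) (- z2) (k1 * t2 / D) (- k2 * t1 / D) (- k1 * s2 / D) (k2 * s1 / D).
have A2L : adapted (A *m B) L.
  apply: adapted_block4 => //.
    by rewrite !mul1r addrC opprK subr_eq0.
  have -> : k1 * t2 / D * (k2 * s1 / D) - - k2 * t1 / D * (- k1 * s2 / D) = k1 * k2 / D.
    by rewrite /D; field; rewrite -/D D0.
  by rewrite !mulf_neq0// invr_eq0.
have [c' fr'] := adapted_frame hF L_on A2L; exists (A *m B), c'.
have [A2u _] := A2L; have sm' := frame_smooth nz2 A2u fr' smF.
have ptB x y s t : pt A x y s t = pt (A *m B) (x - y * z1) (x - y * z2)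
    (k1 * (s * t2 - t * s2) / D) (k2 * (t * s1 - s * t1) / D).
  rewrite [LHS](pt_of _ A2u) mulmxA pt_coord// row4_block4.
  set r := row4 _ _ _ _; have [-> -> -> ->] := row4_entry (x * 1 + y * - z1) (x * 1 + y * - z2)
     (s * (k1 * t2 / D) + t * (- k1 * s2 / D)) (s * (- k2 * t1 / D) + t * (k2 * s1 / D)).
  by congr (pt _); field.
have normal x y s t :
    k1 * (s * t2 - t * s2) / D * cubic (cfa c') (x - y * z1) (x - y * z2)
    + k2 * (t * s1 - s * t1) / D * cubic (cfb c') (x - y * z1) (x - y * z2)
    = s * cubic (cfa c) x y + t * cubic (cfb c) x y.
  apply: (normal_derivative fr' fr (v := pt A x y 0 0) (d := pt A 0 0 s t)); rewrite ?pt_coord//.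
  - by rewrite ptB pt_coord// !mul0r subrr !mulr0 !mul0r.
  - by rewrite ptB pt_coord// !mul0r subrr.
have xy x : exists x' y', x = x' - y' * z1 /\ 1 = x' - y' * z2.
  have z120 : z2 - z1 != 0 by rewrite subr_eq0 eq_sym.
  by exists (x + (x - 1) / (z2 - z1) * z1), ((x - 1) / (z2 - z1)); split; field.
have ca : [/\ cfa c' 0 = 1, cfa c' 1 = 0, cfa c' 2 = 0 & cfa c' 3 = 0].
  apply: (@cubic_coef _ _ (nth 0 [:: 1; 0; 0; 0])) => x.
  have [x' [y' [xE yE]]] := xy x; rewrite {1}yE xE.
  have := normal x' y' (s1 / k1) (t1 / k1).
  have -> : k2 * (t1 / k1 * s1 - s1 / k1 * t1) / D = 0 by ring.
  have -> : k1 * (s1 / k1 * t2 - t1 / k1 * s2) / D = 1.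
    by rewrite /D; field; rewrite -/D D0.
  rewrite mul1r mul0r addr0 => ->.
  transitivity (k1^-1 * (s1 * cubic (cfa c) x' y' + t1 * cubic (cfb c) x' y')); first by ring.
  by rewrite h1 mulKf// /cubic /=; ring.
have cb : [/\ cfb c' 0 = 0, cfb c' 1 = 0, cfb c' 2 = 0 & cfb c' 3 = 1].
  apply: (@cubic_coef _ _ (nth 0 [:: 0; 0; 0; 1])) => x.
  have [x' [y' [xE yE]]] := xy x; rewrite {1}yE xE.
  have := normal x' y' (s2 / k2) (t2 / k2).
  have -> : k1 * (s2 / k2 * t2 - t2 / k2 * s2) / D = 0 by ring.
  have -> : k2 * (t2 / k2 * s1 - s2 / k2 * t1) / D = 1.
    by rewrite /D; field; rewrite -/D D0.
  rewrite mul1r mul0r add0r => ->.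
  transitivity (k2^-1 * (s2 * cubic (cfa c) x' y' + t2 * cubic (cfb c) x' y')); first by ring.
  rewrite h2 mulKf// /cubic /=.
  have -> : x' - z2 * y' = 1 by rewrite [RHS]yE; ring.
  by ring.
split=> //.
(* Where J is nonzero, the flex tangent is given by n = - Q / J; [osculating_normal] reads it in the
   new frame, in which z has the coordinate (z - z1) / (z - z2). *)
have flex z : fJ c z != 0 -> z != z2 -> (pR c').[(z - z1) / (z - z2)] = 0.
  move=> Jz zz2; set x := (z - z1) / (z - z2).
  have zz20 : z - z2 != 0 by rewrite subr_eq0.
  pose n := - (fQ c z / fJ c z).
  have e1 : fJ c z * n + fQ c z = 0 by rewrite /n; field.
  have e2 : fE c z * n ^+ 2 + 2 * fY c z * n + 2 * fL c z = 0.
    have Jz2 : fJ c z ^+ 2 != 0 by rewrite expf_neq0.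
    apply: (mulfI Jz2); rewrite mulr0.
    have := horner_pR c z; rewrite R0 horner0 /flexion => h.
    by rewrite [RHS]h /n; field.
  set s := sF c z; set t := tF c z.
  have st0 : ~ (s = 0 /\ t = 0) by case=> s0 t0; exact: (st_neq0 sm s0 t0).
  set S := k1 * (s * t2 - t * s2) / D; set T := k2 * (t * s1 - s * t1) / D.
  have ST0 : ~ (S = 0 /\ T = 0).
    move=> ST; have /(pt_mem _ _ _ _ AL) : pt A n 0 s t \in L; last exact: st0.
    by rewrite ptB; apply/(pt_mem _ _ _ _ A2L).
  have osc u : quart c' (u * x + (n - n * x)) u S T = top_cubic c s t n 1.
    pose w := (u - n) / (z - z2).
    have -> : quart c' (u * x + (n - n * x)) u S T = quart c (w * z + n) w s t.
      rewrite -(frame_pt _ _ _ _ A2u fr') -(frame_pt _ _ _ _ Au fr) ptB -/S -/T.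
      by congr (form_at _ (pt _ _ _ _ _)); rewrite /w /x; field.
    apply: (mulfI nz2).
    have := plane_cubic_pencil c s t z w n 1.
    have := quart_plane c s t (w * z + n) w 1; rewrite !mul1r => -> ->.
    have -> : cres c z s t = 0 by rewrite /cres /s /t /sF /tF; ring.
    rewrite -[cJ _ _ _ _]/(fJ c z) -[cQ _ _ _ _]/(fQ c z) -[cE _ _ _ _]/(fE c z).
    rewrite -[cY _ _ _ _]/(fY c z) -[cL _ _ _ _]/(fL c z) expr1n !mulr1 e1 e2.
    by ring.
  have [n' [r [r0 _ _ _ [f1 f2 _]]]] := osculating_normal nz2 (cubics_coprime sm') ST0 osc.
  by rewrite horner_pR; apply: flexion_root f1 f2.
have [rs Jrs] := closed_field_poly_normal (pJ c).
(* [fac z] vanishes at the new coordinate of z, and 1 is the new coordinate of the old point at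
   infinity. A point avoiding these values for the roots z of J contradicts [flex] if the new R is
   nonzero. *)
pose fac z : {poly K} := (z1 - z)%:P + (z - z2)%:P * 'X.
have fac0 z : fac z != 0.
  apply/eqP => f0; move/eqP: z12; apply.
  have := congr1 (fun p : {poly K} => p.[1]) f0; rewrite /fac !hornerE /= => e.
  by apply/eqP; rewrite -subr_eq0 -e; apply/eqP; ring.
apply/eqP; apply: contraT => R0'.
have P0 : pR c' * ('X - 1%:P) * \prod_(z <- rs) fac z != 0.
  rewrite !mulf_neq0 ?polyXsubC_eq0// prodf_seq_neq0.
  by apply/allP => z _; rewrite fac0.
have /closed_nonrootP[x] := P0.
rewrite !rootM !negb_or root_XsubC => /andP[/andP[Rx x1] facx].
have x10 : 1 - x != 0 by rewrite subr_eq0 eq_sym.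
pose z := (z1 - x * z2) / (1 - x).
have zz2 : z - z2 = (z1 - z2) / (1 - x) by rewrite /z; field.
have zz1 : z - z1 = x * (z1 - z2) / (1 - x) by rewrite /z; field.
have z120 : z1 - z2 != 0 by rewrite subr_eq0.
have zn2 : z != z2 by rewrite -subr_eq0 zz2 mulf_neq0// invr_eq0.
have xz : (z - z1) / (z - z2) = x by rewrite zz1 zz2; field; rewrite z120 x10.
case/negP: Rx; rewrite /root -xz flex//.
apply: contra facx => Jz; have : root (pJ c) z by rewrite /root horner_pJ.
rewrite Jrs rootZ ?lead_coef_eq0// root_prod_XsubC => zrs.
rewrite (big_rem z)//= rootM; apply/orP; left.
by rewrite /root /fac !hornerE /=; apply/eqP; rewrite /z; field.
Qed.

End SpecialFrame.

Lemma big_ord4 (V : nmodType) (f : 'I_4 -> V) : \sum_i f i = f 0 + f 1 + f 2 + f 3.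
Proof.
rewrite !big_ord_recr big_ord0 /= add0r.
by congr (f _ + f _ + f _ + f _); exact: val_inj.
Qed.

(** * Completing the cubes *)

Section NormalFrame.
Variable K : closedFieldType.
Hypotheses (nz2 : 2 != 0 :> K) (nz3 : 3 != 0 :> K).
Implicit Types (A : 'M[K]_4) (v : 'rV[K]_4) (M : {vspace 'rV[K]_4}).

(** Here s = 1, t = - x^3, J = 3 x^2 and E = 6 x, so R = 6 x (Q^2 - x Q Y + 3 x^3 L). Its lowest and
    highest coefficients are squares up to sign, and the others determine U and V from A, B, C. *)
Lemma special_relations (c : quartic K) : monomial_cubics c -> pR c = 0 ->
  [/\ cfC c 0 = 0 /\ cfA c 2 = 0,
    [/\ 3 * cfU c 0 = cfA c 0 ^+ 2 + cfB c 0 * cfC c 1,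
       3 * cfU c 1 = 2 * cfA c 0 * cfA c 1 + cfB c 0 * cfC c 2 + cfB c 1 * cfC c 1,
       3 * cfU c 2 = cfA c 1 ^+ 2 + cfB c 1 * cfC c 2 + cfB c 2 * cfC c 1
     & 3 * cfU c 3 = cfB c 2 * cfC c 2]
  & [/\ 3 * cfV c 0 = cfA c 0 * cfB c 0,
       3 * cfV c 1 = cfC c 1 ^+ 2 + cfA c 0 * cfB c 1 + cfA c 1 * cfB c 0,
       3 * cfV c 2 = 2 * cfC c 1 * cfC c 2 + cfA c 0 * cfB c 2 + cfA c 1 * cfB c 1
     & 3 * cfV c 3 = cfC c 2 ^+ 2 + cfA c 1 * cfB c 2]].
Proof.
move=> [[a0 a1 a2 a3] [b0 b1 b2 b3]] R0.
pose A := cfA c; pose B := cfB c; pose C := cfC c; pose U := cfU c; pose V := cfV c.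
(* The coefficients of R / (6 x) by increasing powers of x; the 0 put in front of them below
   restores the factor x. *)
pose l := [:: C 0 ^+ 2; B 0 * C 0; 0;
  - (2 * C 0 * C 1) - A 0 * B 0 + 3 * V 0;
  - (B 0 * C 1 + B 1 * C 0) - A 0 ^+ 2 + 3 * U 0; 0;
  C 1 ^+ 2 + 2 * C 0 * C 2 + (A 0 * B 1 + A 1 * B 0) - 3 * V 1;
  B 0 * C 2 + B 1 * C 1 + B 2 * C 0 + 2 * A 0 * A 1 - 3 * U 1; 0;
  - (2 * C 1 * C 2) - (A 0 * B 2 + A 1 * B 1 + A 2 * B 0) + 3 * V 2;
  - (B 1 * C 2 + B 2 * C 1) - (A 1 ^+ 2 + 2 * A 0 * A 2) + 3 * U 2; 0;
  C 2 ^+ 2 + (A 1 * B 2 + A 2 * B 1) - 3 * V 3;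
  B 2 * C 2 + 2 * A 1 * A 2 - 3 * U 3; 0;
  - (A 2 * B 2); - (A 2 ^+ 2)].
have h : forall i, nth 0 (0 :: l) i = 0.
  apply: Poly_eq0 => x.
  have nz6 : 6 != 0 :> K by have -> : 6 = 2 * 3 :> K by [ring]; rewrite mulf_neq0.
  apply: (mulfI nz6); rewrite mulr0.
  transitivity (flexion (fE c x) (fJ c x) (fQ c x) (fY c x) (fL c x)); last first.
    by rewrite -horner_pR R0 horner0.
  have -> : fE c x = 6 * x by rewrite /fE /cE /sF /tF /cubic_xx /cubic a0 a1 a2 a3 b0 b1 b2 b3; ring.
  have -> : fJ c x = 3 * x ^+ 2.
    by rewrite /fJ /cJ /sF /tF /cubic_x /cubic a0 a1 a2 a3 b0 b1 b2 b3; ring.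
  have sE : sF c x = 1 by rewrite /sF /cubic b0 b1 b2 b3; ring.
  have tE : tF c x = - x ^+ 3 by rewrite /tF /cubic a0 a1 a2 a3; ring.
  rewrite /fQ /fY /fL /cQ /cY /cL sE tE /quad /cubic horner_Poly /l /= /flexion.
  rewrite -/A -/B -/C -/U -/V; ring.
have {}h i : nth 0 l i = 0 by have := h i.+1.
have C0 : C 0%N = 0 by have := h 0%N; rewrite /l /= => /eqP; rewrite expf_eq0 => /eqP.
have A2 : A 2%N = 0 by have := h 16%N; rewrite /l /= => /eqP; rewrite oppr_eq0 expf_eq0 => /eqP.
have fin (a b : K) : a - b = 0 -> b = a by move/eqP; rewrite subr_eq0 => /eqP.
split=> //; split; rewrite -/A -/B -/C -/U -/V; apply: fin.
- by rewrite -[RHS]oppr0 -(h 4%N) /l /= C0; ring.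
- by rewrite -[RHS](h 7%N) /l /= C0; ring.
- by rewrite -[RHS]oppr0 -(h 10%N) /l /= A2; ring.
- by rewrite -[RHS](h 13%N) /l /= A2; ring.
- by rewrite -[RHS]oppr0 -(h 3%N) /l /= C0; ring.
- by rewrite -[RHS](h 6%N) /l /= C0; ring.
- by rewrite -[RHS]oppr0 -(h 9%N) /l /= A2; ring.
- by rewrite -[RHS](h 12%N) /l /= A2; ring.
Qed.

(** Here g lists a quartic form G. That x3 divides G is [g 4 = 0], the case of the theorem; that x4
    divides G is [g 0 = 0]. *)
Definition normal_quartic (R : nzRingType) (q g : nat -> R) : quartic R :=
  Quartic (nth 0 [:: 1; 0; 0; 0]) (nth 0 [:: 0; 0; 0; 1]) (fun=> 0) q (fun=> 0)
    (fun=> 0) (fun=> 0) g.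

Lemma coordinate_form_mx4 A r0 r1 r2 r3 i : coordinate_form (A *m mx4 [:: r0; r1; r2; r3]) i =
  (nth 0 r0 i)%:MP * coordinate_form A 0 + (nth 0 r1 i)%:MP * coordinate_form A 1
  + (nth 0 r2 i)%:MP * coordinate_form A 2 + (nth 0 r3 i)%:MP * coordinate_form A 3.
Proof.
rewrite -coordinate_form_comp {1}/coordinate_form raddf_sum /= big_ord4 !mxE /=.
by rewrite !comp_mpolyZ !comp_mpolyXU -!tnth_nth !tnth_mktuple -!mul_mpolyC.
Qed.

Variables (F : {mpoly K[4]}) (L : {vspace 'rV[K]_4}).

(** The relations say that A = 3 s m and C = 3 t n for linear forms m, n in (s, t), with U = 3 s m^2
    + B n and V = 3 t n^2 + B m. The form is then s (x + m)^3 + t (y + n)^3 + B (x + m) (y + n) + g,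
    where g = G - s m^3 - t n^3 - B m n. *)
Lemma complete_cubes A c : adapted A L -> frame F A c -> monomial_cubics c -> pR c = 0 ->
  exists A' q g, adapted A' L /\ frame F A' (normal_quartic q g).
Proof.
move=> [Au LA] fr mc R0; have [[C0 A2] [U0 U1 U2 U3] [V0 V1 V2 V3]] := special_relations mc R0.
have [[a0 a1 a2 a3] [b0 b1 b2 b3]] := mc.
have div3_ex (x : K) : exists y, x = 3 * y by exists (3^-1 * x); rewrite mulVKf.
have [m0 A0] := div3_ex (cfA c 0%N); have [m1 A1] := div3_ex (cfA c 1%N).
have [n0 C1] := div3_ex (cfC c 1%N); have [n1 C2] := div3_ex (cfC c 2%N).
pose q := cfB c.
have div3 (x y : K) : 3 * x = 3 * y -> x = y by move/(mulfI nz3).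
have {}U0 : cfU c 0 = 3 * m0 ^+ 2 + q 0 * n0 by apply: div3; rewrite U0 A0 C1 -/q; ring.
have {}U1 : cfU c 1 = 6 * m0 * m1 + q 0 * n1 + q 1 * n0.
  by apply: div3; rewrite U1 A0 A1 C1 C2 -/q; ring.
have {}U2 : cfU c 2 = 3 * m1 ^+ 2 + q 1 * n1 + q 2 * n0.
  by apply: div3; rewrite U2 A1 C1 C2 -/q; ring.
have {}U3 : cfU c 3 = q 2 * n1 by apply: div3; rewrite U3 C2 -/q; ring.
have {}V0 : cfV c 0 = m0 * q 0 by apply: div3; rewrite V0 A0 -/q; ring.
have {}V1 : cfV c 1 = 3 * n0 ^+ 2 + m0 * q 1 + m1 * q 0.
  by apply: div3; rewrite V1 C1 A0 A1 -/q; ring.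
have {}V2 : cfV c 2 = 6 * n0 * n1 + m0 * q 2 + m1 * q 1.
  by apply: div3; rewrite V2 C1 C2 A0 A1 -/q; ring.
have {}V3 : cfV c 3 = 3 * n1 ^+ 2 + m1 * q 2 by apply: div3; rewrite V3 C2 A1 -/q; ring.
pose G := cfG c.
pose g := nth 0 [:: G 0 - (m0 ^+ 3 + q 0 * (m0 * n0));
  G 1 - (3 * m0 ^+ 2 * m1 + n0 ^+ 3 + q 0 * (m0 * n1 + m1 * n0) + q 1 * (m0 * n0));
  G 2 - (3 * m0 * m1 ^+ 2 + 3 * n0 ^+ 2 * n1 + q 0 * (m1 * n1) + q 1 * (m0 * n1 + m1 * n0)
         + q 2 * (m0 * n0));
  G 3 - (m1 ^+ 3 + 3 * n0 * n1 ^+ 2 + q 1 * (m1 * n1) + q 2 * (m0 * n1 + m1 * n0));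
  G 4 - (n1 ^+ 3 + q 2 * (m1 * n1))].
pose T := mx4 [:: [:: 1; 0; 0; 0]; [:: 0; 1; 0; 0]; [:: m0; n0; 1; 0]; [:: m1; n1; 0; 1]].
have Tu : T \in unitmx.
  suff : T *m mx4 [:: [:: 1; 0; 0; 0]; [:: 0; 1; 0; 0]; [:: - m0; - n0; 1; 0];
    [:: - m1; - n1; 0; 1]] = 1%:M by case/mulmx1_unit.
  apply: mx_row4P => x y s t; rewrite mulmxA mulmx1 row4_mx4 [X in X *m _]row4E row4_mx4.
  apply/rowP => j; rewrite !mxE /=; case: j => -[|[|[|[|]]]]//= _; ring.
have identity (R : comNzRingType) (f : {rmorphism K -> R}) x y s t :
    quart (map_quartic f c) x y s t = quart (map_quartic f (normal_quartic q g))
      (x + f m0 * s + f m1 * t) (y + f n0 * s + f n1 * t) s t.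
  rewrite /quart /quad /cubic /biquad /g /=.
  rewrite a0 a1 a2 a3 b0 b1 b2 b3 A0 A1 A2 C0 C1 C2 U0 U1 U2 U3 V0 V1 V2 V3 -/q -/G.
  ring.
exists (A *m T), q, g; split; first split.
- by rewrite unitmx_mul Au Tu.
- move=> v; rewrite LA mulmxA [v *m A]row4E row4_mx4 !mxE /=.
  by rewrite !mulr0 !mulr1 !addr0 !add0r.
rewrite /frame /T !coordinate_form_mx4 /= [LHS]fr /mpoly_quartic identity /=.
by rewrite !mpolyC0 !mpolyC1 !mul0r !mul1r !addr0 !add0r.
Qed.

(** The normal form is symmetric under exchanging x1 with x2 and x3 with x4. This brings (1 : 0 : 0
    : 0) into the affine chart and trades [g 4 = 0] for [g 0 = 0]. *)
Lemma frame_swap A q g : adapted A L -> frame F A (normal_quartic q g) ->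
  adapted (A *m block4 0 1 1 0 0 1 1 0) L /\
  frame F (A *m block4 0 1 1 0 0 1 1 0)
    (normal_quartic (fun i => q (2 - i)%N) (fun i => g (4 - i)%N)).
Proof.
move=> AL fr; split.
  by apply: adapted_block4 => //; rewrite mul0r mulr1 sub0r oppr_eq0 oner_neq0.
rewrite /frame !coordinate_form_mx4 /= !mpolyC0 !mpolyC1 !mul0r !mul1r !addr0 !add0r [LHS]fr.
move: (coordinate_form A 0) (coordinate_form A 1) => x y.
move: (coordinate_form A 2) (coordinate_form A 3) => s t.
rewrite /quart /quad /cubic /biquad /= !mpolyC0 !mpolyC1; ring.
Qed.

Definition quad_mpoly (q : nat -> K) : {mpoly K[2]} := quad (@mpolyC 2 K \o q) 'X_0 'X_1.
Definition cubic_mpoly (g : nat -> K) : {mpoly K[2]} := cubic (@mpolyC 2 K \o g) 'X_0 'X_1.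
Definition mul_x3 (g : nat -> K) := nth 0 [:: g 0; g 1; g 2; g 3; 0].

Lemma homog2_quad q : q \is 2.-homog -> exists q0, q = quad_mpoly q0.
Proof.
move=> hq; exists (fun i => q@_(mnm_seq 2 [:: 2 - i; i]%N)).
rewrite {1}(homog2_expand hq) !big_ord_recr big_ord0 /= /quad_mpoly /quad /= -!mul_mpolyC.
move: (q@__) (q@__) (q@__) => a b c; ring.
Qed.

Lemma homog3_cubic q : q \is 3.-homog -> exists q0, q = cubic_mpoly q0.
Proof.
move=> hq; exists (fun i => q@_(mnm_seq 2 [:: 3 - i; i]%N)).
rewrite {1}(homog2_expand hq) !big_ord_recr big_ord0 /= /cubic_mpoly /cubic /= -!mul_mpolyC.
move: (q@__) (q@__) (q@__) (q@__) => a b c d; ring.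
Qed.

Lemma quad_homog q : quad_mpoly q \is 2.-homog.
Proof.
have hX (i : 'I_2) : ('X_i : {mpoly K[2]}) \is 1%N.-homog by rewrite dhomogX /= mdeg1.
have h (i j : 'I_2) (a : K) : a%:MP * ('X_i * 'X_j) \is (1 + 1)%N.-homog.
  by rewrite mul_mpolyC; apply: dhomogZ; apply: dhomogM; apply: hX.
by rewrite /quad_mpoly /quad !expr2 -!mulrA /=; do 2! apply: rpredD => //; apply: h.
Qed.

Lemma cubic_homog q : cubic_mpoly q \is 3.-homog.
Proof.
have hX (i : 'I_2) : ('X_i : {mpoly K[2]}) \is 1%N.-homog by rewrite dhomogX /= mdeg1.
have h (i j k : 'I_2) (a : K) : a%:MP * ('X_i * ('X_j * 'X_k)) \is (1 + (1 + 1))%N.-homog.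
  by rewrite mul_mpolyC; apply: dhomogZ; do ![apply: dhomogM | apply: hX].
by rewrite /cubic_mpoly /cubic !exprS !expr0 !mulr1 -!mulrA /=; do 3! apply: rpredD => //; apply: h.
Qed.

Lemma quad_mpoly_comp n q (l : 2.-tuple {mpoly K[n]}) :
  quad_mpoly q \mPo l = quad (@mpolyC n K \o q) l`_0 l`_1.
Proof. by rewrite /quad_mpoly rmorph_quad /= !comp_mpolyXU /quad /= !comp_mpolyC. Qed.

Lemma cubic_mpoly_comp n q (l : 2.-tuple {mpoly K[n]}) :
  cubic_mpoly q \mPo l = cubic (@mpolyC n K \o q) l`_0 l`_1.
Proof. by rewrite /cubic_mpoly rmorph_cubic /= !comp_mpolyXU /cubic /= !comp_mpolyC. Qed.

Lemma normal_form_comp A q g :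
  normal_form (quad_mpoly q) (cubic_mpoly g) \mPo [tuple coordinate_form A i | i < 4] =
  quart (mpoly_quartic (normal_quartic q (mul_x3 g))) (coordinate_form A 0)
    (coordinate_form A 1) (coordinate_form A 2) (coordinate_form A 3).
Proof.
rewrite /normal_form quad_mpoly_comp cubic_mpoly_comp /=.
rewrite !(comp_mpolyD, rmorphM, rmorphXn) /= rmorph_quad rmorph_cubic /=.
rewrite !comp_mpolyXU -!tnth_nth !tnth_mktuple.
move: (coordinate_form A 0) (coordinate_form A 1) => x y.
move: (coordinate_form A 2) (coordinate_form A 3) => s t.
rewrite /quart /quad /cubic /biquad /= !comp_mpolyC !mpolyC0 !mpolyC1; ring.
Qed.

End NormalFrame.

(** * Counting lines on a surface in normal form *)

Section NormalCount.
Variable K : closedFieldType.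
Hypotheses (nz2 : 2 != 0 :> K) (nz3 : 3 != 0 :> K).

Let nz27 : 27 != 0 :> K.
Proof. by have -> : 27 = 3 * (3 * 3) :> K by [ring]; rewrite !mulf_neq0. Qed.

Let nz9 : 9 != 0 :> K.
Proof. by have -> : 9 = 3 * 3 :> K by [ring]; rewrite mulf_neq0. Qed.

Section Coefficients.
Variables q g : nat -> K.
Notation c := (normal_quartic q g).
Hypothesis sm : forall x y s t, gradient_zero c x y s t -> [/\ x = 0, y = 0, s = 0 & t = 0].
Notation B x := (quad q 1 (- x ^+ 3)).
Notation G x := (biquad g 1 (- x ^+ 3)).

(* Its nonzero roots are the points of the line on whose tangent plane the residual cubic
   [x1^3 - x^3 x2^3 + q x1 x2 z + G z^3] splits into lines. *)
Definition nodal : {poly K} := quad (polyC \o q) 1 (- 'X ^+ 3) ^+ 3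
  - 27 * 'X ^+ 3 * biquad (polyC \o g) 1 (- 'X ^+ 3).

Lemma horner_nodal x : nodal.[x] = B x ^+ 3 - 27 * x ^+ 3 * G x.
Proof.
have hX : (- 'X ^+ 3 : {poly K}).[x] = - x ^+ 3 by rewrite !hornerE.
have hB := horner_quad q 1 (- 'X ^+ 3) x; have hG := horner_biquad g 1 (- 'X ^+ 3) x.
rewrite hX hornerC in hB hG; move: hB hG; rewrite /nodal.
move: (quad (polyC \o q) 1 (- 'X ^+ 3)) (biquad (polyC \o g) 1 (- 'X ^+ 3)) => b d hb hd.
by rewrite -polyC_natr !(hornerD, hornerN, hornerM, @horner_exp K, hornerX, hornerC) hb hd.
Qed.

Lemma normal_sF x : sF c x = 1. Proof. by rewrite /sF /cubic /=; ring. Qed.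
Lemma normal_tF x : tF c x = - x ^+ 3. Proof. by rewrite /tF /cubic /=; ring. Qed.

Lemma line_pair_normal x n : line_pair c (x, n) <->
  [/\ 3 * x ^+ 2 * n + B x * x = 0, 6 * x * n ^+ 2 + 2 * B x * n = 0 & n ^+ 3 + G x = 0].
Proof.
rewrite /line_pair /fJ /fE /fQ /fY /fL /cJ /cE /cQ /cY /cL /top_cubic /cK /= normal_sF normal_tF.
have -> : (1 * cubic_x (nth 0 [:: 1; 0; 0; 0]) x 1 + - x ^+ 3 * cubic_x (nth 0 [:: 0; 0; 0; 1]) x 1) * n
   + (quad (fun=> 0) 1 (- x ^+ 3) * x ^+ 2 + B x * x + quad (fun=> 0) 1 (- x ^+ 3))
   = 3 * x ^+ 2 * n + B x * x.
  by move: (B x) => b; rewrite /cubic_x /quad /=; ring.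
have -> : (1 * cubic_xx (nth 0 [:: 1; 0; 0; 0]) x 1 + - x ^+ 3 * cubic_xx (nth 0 [:: 0; 0; 0; 1]) x 1)
   * n ^+ 2 + 2 * (2 * quad (fun=> 0) 1 (- x ^+ 3) * x + B x) * n
   + 2 * (cubic (fun=> 0) 1 (- x ^+ 3) * x + cubic (fun=> 0) 1 (- x ^+ 3))
   = 6 * x * n ^+ 2 + 2 * B x * n.
  by move: (B x) => b; rewrite /cubic_xx /quad /cubic /=; ring.
have -> : (1 * 1 + - x ^+ 3 * 0) * n ^+ 3 + quad (fun=> 0) 1 (- x ^+ 3) * n ^+ 2 * 1
   + cubic (fun=> 0) 1 (- x ^+ 3) * n * 1 ^+ 2 + G x * 1 ^+ 3 = n ^+ 3 + G x.
  by move: (G x) => d; rewrite /quad /cubic /=; ring.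
by [].
Qed.

Lemma line_pair_nodal x n : x != 0 -> line_pair c (x, n) -> n = - (B x / (3 * x)) /\ nodal.[x] = 0.
Proof.
move=> x0 /line_pair_normal[e1 _ e3].
have nE : n = - (B x / (3 * x)).
  have x3 : 3 * x ^+ 2 != 0 by rewrite mulf_neq0// expf_neq0.
  apply: (mulfI x3); apply: (addIr (B x * x)); rewrite e1.
  by move: (B x) => b; field; rewrite ?nz27 ?nz9 ?nz3 ?x0.
split=> //; rewrite horner_nodal.
have -> : G x = - n ^+ 3 by apply/eqP; rewrite -addr_eq0 addrC e3.
by rewrite nE; move: (B x) => b; field; rewrite ?nz27 ?nz9 ?nz3 ?x0.
Qed.

Lemma nodal_line_pair x : x != 0 -> nodal.[x] = 0 -> line_pair c (x, - (B x / (3 * x))).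
Proof.
move=> x0; rewrite horner_nodal => h; apply/line_pair_normal; split.
- by move: (B x) => b; field; rewrite ?nz27 ?nz9 ?nz3 ?x0.
- by move: (B x) => b; field; rewrite ?nz27 ?nz9 ?nz3 ?x0.
- have x3 : 27 * x ^+ 3 != 0 by rewrite mulf_neq0// expf_neq0.
  apply: (mulfI x3); rewrite mulr0 -[RHS]oppr0 -h.
  by move: (B x) (G x) => b d; field; rewrite ?nz27 ?nz9 ?nz3 ?x0.
Qed.

(** Otherwise the plane x4 = 0 cuts out x3 x1^3. On the triple line x1 = x4 = 0 the derivative in x4
    is the cubic x2^3 + g1 x3^3, which has a zero: a singular point. *)
Lemma normal_smooth0 : q 0%N = 0 -> g 0%N = 0 -> False.
Proof.
move=> q0 g0; have [y hy] := @solve_monicpoly K 3 (nth 0 [:: - g 1%N]) isT.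
rewrite !big_ord_recr big_ord0 /= in hy.
have [] : [/\ 0 = 0 :> K, y = 0, 1 = 0 :> K & 0 = 0 :> K].
  apply: sm; split; rewrite /quart_1 /quart_2 /quart_3 /quart_4 /cubic_x /cubic_y /quad /quad_x
    /quad_y /cubic /biquad_x /biquad_y /= ?q0 ?g0; try ring.
  transitivity (y ^+ 3 + g 1%N); first by ring.
  by rewrite hy; ring.
by move=> _ _ /eqP; rewrite oner_eq0.
Qed.

(** At x = 0 the conditions become q0 n = 0 and n^3 + g0 = 0. The three lines possible when q0 = 0
    are offset in [lines_off_zero]. *)
Lemma lines_at_zero ns : uniq ns -> (forall n, n \in ns -> line_pair c (0, n)) ->
  (size ns <= (g 0%N == 0)%R + 3 * (q 0%N == 0)%R)%N.
Proof.
move=> u h.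
have h0 n : n \in ns -> q 0%N * n = 0 /\ n ^+ 3 + g 0%N = 0.
  move=> /h /line_pair_normal[_ e2 e3]; split.
    by apply: (mulfI nz2); rewrite mulr0 -[RHS]e2 /quad; ring.
  by rewrite -[RHS]e3 /biquad; ring.
have [q0|q0] := eqVneq (q 0%N) 0.
  pose l := [:: g 0%N; 0; 0; 1].
  have : (size ns < size l)%N.
    apply: uniq_roots_Poly => //; last by rewrite oner_neq0.
    by move=> n /h0[_ <-]; rewrite horner_Poly /=; ring.
  by rewrite /= muln1 ltnS => /leq_trans; apply; rewrite leq_addl.
case: ns u h0 {h} => // n ns /andP[nns _] h0.
have n0 m : m \in n :: ns -> m = 0.
  by move=> /h0[/eqP]; rewrite mulf_eq0 (negbTE q0) => /eqP.
have -> : g 0%N = 0.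
  by have [_] := h0 n (mem_head _ _); rewrite (n0 n (mem_head _ _)) expr0n /= add0r.
rewrite eqxx; case: ns nns h0 n0 => // m ns nns _ n0.
by move: nns; rewrite inE negb_or (n0 n (mem_head _ _)) (n0 m) ?eqxx// !inE eqxx orbT.
Qed.

Lemma nodal_divX3 : q 0%N = 0 -> nodal = 'X ^+ 3 *
  ('X ^+ 6 * (- (q 1%N)%:P + (q 2)%:P * 'X ^+ 3) ^+ 3 - 27 * biquad (polyC \o g) 1 (- 'X ^+ 3)).
Proof.
move=> q0; rewrite /nodal; move: (biquad _ _ _) => d.
by rewrite /quad /= q0 polyC0; ring.
Qed.

(** Its constant term is q0^3 and, if that vanishes, its X^3 coefficient is - 27 g0; both cannot
    vanish by [normal_smooth0]. *)
Lemma nodal_neq0 : nodal != 0.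
Proof.
apply/eqP => N0.
have q0 : q 0%N = 0.
  have := horner_nodal 0; rewrite N0 horner0 => h; apply/eqP.
  by rewrite -[_ == 0](expf_eq0 _ 3) [X in _ == X]h /quad; apply/eqP; ring.
have X30 : ('X ^+ 3 : {poly K}) != 0 by rewrite expf_neq0// polyX_eq0.
have := nodal_divX3 q0; rewrite N0 => /esym/eqP; rewrite mulf_eq0 (negbTE X30) /= => /eqP D0.
apply: (normal_smooth0 q0); apply: (mulfI nz27); rewrite mulr0.
have hX : (- 'X ^+ 3 : {poly K}).[0] = 0 by rewrite !hornerE expr0n oppr0.
have := horner_biquad g 1 (- 'X ^+ 3) 0; rewrite hX hornerC.
have := congr1 (fun p : {poly K} => p.[0]) D0; move: (biquad (polyC \o g) _ _) => d.
rewrite -(polyC_natr _ 27) !(hornerD, hornerN, hornerM, @horner_exp K, hornerX, hornerC).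
rewrite !mul0r sub0r => /eqP; rewrite oppr_eq0 => /eqP h hd.
by rewrite -[RHS]h hd /biquad; ring.
Qed.

(** A nonzero x carries at most one line, with n = - B / (3 x), so the nonzero roots of [nodal] are
    counted, at most 18. If q0 = 0 it is divisible by X^3, and if q2 = 0 its degree drops by at
    least three. *)
Lemma lines_off_zero zs : uniq zs -> (forall z, z \in zs -> line_pair c z /\ z.1 != 0) ->
  (size zs + 3 * (q 0%N == 0)%R + 3 * (q 2 == 0)%R <= 18)%N.
Proof.
move=> u h.
have bound d (p : {poly K}) : p != 0 -> deg_le d p ->
    (forall x, x != 0 -> nodal.[x] = 0 -> p.[x] = 0) -> (size zs <= d)%N.
  move=> p0 dp rp; rewrite -ltnS; apply: leq_trans dp; rewrite -(size_map fst).
  apply: max_poly_roots => //.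
    apply/allP => x /mapP[[y n] /h[lz y0] ->]; apply/rootP; apply: rp => //=.
    by have [] := line_pair_nodal y0 lz.
  rewrite map_inj_in_uniq// => -[x n] [y m] /h[l1 x0] /h[l2 y0] /= xy; subst y.
  by have [-> _] := line_pair_nodal x0 l1; have [-> _] := line_pair_nodal x0 l2.
have dX : deg_le 3 (- 'X ^+ 3 : {poly K}) by apply: deg_leW; first by deg_bound.
have d1 : deg_le 3 (1 : {poly K}) by exact: deg_le1.
have dG := deg_biquad g d1 dX; have dB := deg_quad q d1 dX.
have [q0|q0] := eqVneq (q 0%N) 0.
  have ND := nodal_divX3 q0.
  set D1 := (_ - _) in ND.
  have D10 : D1 != 0 by apply: contraNneq nodal_neq0 => D10; rewrite ND D10 mulr0.
  have rD x : x != 0 -> nodal.[x] = 0 -> D1.[x] = 0.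
    move=> x0; rewrite ND hornerM horner_exp hornerX => /eqP.
    by rewrite mulf_eq0 expf_eq0 (negbTE x0) andbF => /eqP.
  have [q2|q2] := eqVneq (q 2%N) 0.
    have dD : deg_le 12 D1.
      rewrite /D1 q2 polyC0 mul0r addr0; move: (biquad _ _ _) dG => d dd.
      by apply: deg_leW; first by deg_bound.
    by have := bound _ _ D10 dD rD; rewrite ?eqxx; move: (size zs) => m; clear; lia.
  have dD : deg_le 15 D1.
    rewrite /D1; move: (biquad _ _ _) dG => d dd.
    by apply: deg_leW; first by deg_bound.
  by have := bound _ _ D10 dD rD; move: (size zs) => m; clear; lia.
have [q2|q2] := eqVneq (q 2%N) 0.
  have dD : deg_le 15 nodal.
    rewrite /nodal /quad /= q2 polyC0 mul0r addr0; move: (biquad _ _ _) dG => d dd.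
    rewrite expr1n mulr1 mulr1.
    by apply: deg_leW; first by deg_bound.
  by have := bound _ _ nodal_neq0 dD (fun x _ h => h); move: (size zs) => m; clear; lia.
have dD : deg_le 18 nodal.
  rewrite /nodal; move: (biquad _ _ _) (quad _ _ _) dG dB => d b dd db.
  by apply: deg_leW; first by deg_bound.
by have := bound _ _ nodal_neq0 dD (fun x _ h => h); move: (size zs) => m; clear; lia.
Qed.

(** At a root the residual cubic is u^3 + v^3 + w^3 - 3 u v w with u = x1, v = - x x2, w = B z / (3
    x). It is singular where u = v = w, at the point (X : Y : 1 : - x^3) below; for a double root
    the derivative transversal to the plane vanishes there too. *)
Lemma nodal_separable x : x != 0 -> nodal.[x] = 0 -> nodal^`().[x] != 0.
Proof.
move=> x0 N0; apply/eqP => dN.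
pose X := B x / (3 * x); pose Y := - (B x / (3 * x ^+ 2)).
pose Bt := quad_y q 1 (- x ^+ 3); pose Gt := biquad_y g 1 (- x ^+ 3).
have dNE : nodal^`().[x] = - 9 * x ^+ 2 * B x ^+ 2 * Bt - 81 * x ^+ 2 * G x + 81 * x ^+ 5 * Gt.
  have hX : (- 'X ^+ 3 : {poly K}).[x] = - x ^+ 3 by rewrite !hornerE.
  have dXx : (- 'X ^+ 3 : {poly K})^`().[x] = - (3 * x ^+ 2) by rewrite !exprS !expr0 !mulr1 !derivE !(mul1r, mulr1) !(hornerD, hornerN, hornerM, hornerX); ring.
  have hB := horner_quad q 1 (- 'X ^+ 3) x; have hG := horner_biquad g 1 (- 'X ^+ 3) x.
  rewrite hX hornerC in hB hG.
  have dB : (quad (polyC \o q) 1 (- 'X ^+ 3))^`().[x] = Bt * (- (3 * x ^+ 2)).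
    rewrite -dXx /quad /=; move: (- 'X ^+ 3) hX => T hT.
    rewrite !expr2 !mulr1 !derivE !(hornerD, hornerM, hornerC) hT /Bt /quad_y; ring.
  have dG : (biquad (polyC \o g) 1 (- 'X ^+ 3))^`().[x] = Gt * (- (3 * x ^+ 2)).
    rewrite -dXx /biquad /=; move: (- 'X ^+ 3) hX => T hT.
    rewrite !exprS !expr0 !mulr1 !derivE !(hornerD, hornerM, hornerC) hT /Gt /biquad_y; ring.
  move: hB hG dB dG; rewrite /nodal.
  move: (quad (polyC \o q) 1 (- 'X ^+ 3)) (biquad (polyC \o g) 1 (- 'X ^+ 3)) => b d hb hd db dd.
  rewrite -(polyC_natr _ 27) !exprS !expr0 !mulr1 !derivE.
  by rewrite !(hornerD, hornerN, hornerM, hornerX, hornerC) hb hd db dd; ring.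
rewrite dNE in dN.
have GE : G x = B x ^+ 3 / (27 * x ^+ 3).
  move: N0; rewrite horner_nodal; move: (B x) (G x) => b d /eqP; rewrite subr_eq0 => /eqP ->.
  by rewrite mulrC mulKf// mulf_neq0// expf_neq0.
have GtE : Gt = B x ^+ 2 * Bt / (9 * x ^+ 3) + B x ^+ 3 / (27 * x ^+ 6).
  have x5 : 81 * x ^+ 5 != 0.
    by have -> : 81 = 3 * 27 :> K by [ring]; rewrite !mulf_neq0// expf_neq0.
  apply: (mulfI x5); apply/eqP; rewrite -subr_eq0 -[X in _ == X]dN GE; apply/eqP.
  by field; rewrite ?nz27 ?nz9 ?nz3 ?x0.
suff [_ _ /eqP] : [/\ X = 0, Y = 0, 1 = 0 :> K & - x ^+ 3 = 0] by rewrite oner_eq0.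
have zq : quad (fun=> 0) 1 (- x ^+ 3) = 0 :> K by rewrite /quad; ring.
have zc : cubic (fun=> 0) 1 (- x ^+ 3) = 0 :> K by rewrite /cubic; ring.
have zqy : quad_y (fun=> 0) 1 (- x ^+ 3) = 0 :> K by rewrite /quad_y; ring.
have zcy : cubic_y (fun=> 0) 1 (- x ^+ 3) = 0 :> K by rewrite /cubic_y; ring.
have g1 : quart_1 c X Y 1 (- x ^+ 3) = 0.
  rewrite /quart_1 /= zq zc.
  by rewrite /cubic_x /X /Y /=; move: (B x) => b; field; rewrite ?nz27 ?nz9 ?nz3 ?x0.
have g2 : quart_2 c X Y 1 (- x ^+ 3) = 0.
  rewrite /quart_2 /= zq zc.
  by rewrite /cubic_y /X /Y /=; move: (B x) => b; field; rewrite ?nz27 ?nz9 ?nz3 ?x0.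
have g4 : quart_4 c X Y 1 (- x ^+ 3) = 0.
  rewrite /quart_4 /= -/Bt -/Gt GtE zqy zcy.
  rewrite /cubic /X /Y /=; clear dNE dN GtE.
  by move: Bt => bt; move: (B x) => b; field; rewrite ?nz27 ?nz9 ?nz3 ?x0.
apply: sm; split=> //.
have := quart_euler c X Y 1 (- x ^+ 3); rewrite g1 g2 g4 !mulr0 !add0r mul1r addr0 => ->.
rewrite /quart /= GE zq zc.
by rewrite /cubic /X /Y /=; move: (B x) => b; field; rewrite ?nz27 ?nz9 ?nz3 ?x0.
Qed.

(** The constant term is q0^3 and the leading coefficient q2^3, so there are 18 roots, all nonzero,
    and distinct by [nodal_separable]. *)
Lemma nodal_eighteen : q 0%N != 0 -> q 2 != 0 ->
  exists xs : seq K, [/\ uniq xs, size xs = 18%N & forall x, x \in xs -> x != 0 /\ nodal.[x] = 0].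
Proof.
move=> q0 q2; have [rs Nrs] := closed_field_poly_normal nodal.
have lN : lead_coef nodal != 0 by rewrite lead_coef_eq0 nodal_neq0.
have N00 : nodal.[0] != 0.
  rewrite horner_nodal; have -> : B 0 = q 0%N by rewrite /quad; ring.
  have -> : q 0%N ^+ 3 - 27 * 0 ^+ 3 * G 0 = q 0%N ^+ 3 by move: (G 0) => d; ring.
  by rewrite expf_neq0.
have rN x : x \in rs -> x != 0 /\ nodal.[x] = 0.
  move=> xrs; have Nx : nodal.[x] = 0.
    by apply/rootP; rewrite Nrs rootZ// root_prod_XsubC.
  by split=> //; apply: contraNneq N00 => x0; rewrite x0 in Nx; rewrite Nx.
exists rs; split=> //.
  rewrite -separable_prod_XsubC -(@eqp_separable _ (lead_coef nodal *: \prod_(z <- rs) ('X - z%:P))).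
    rewrite -Nrs unlock; apply/Pdiv.ClosedField.coprimepP => x Nx.
    apply: nodal_separable; last exact/rootP.
    by apply: contraNneq N00 => x0; rewrite x0 in Nx; apply/eqP/rootP.
  exact: eqp_scale.
have : size nodal = 19%N.
  have -> : nodal = (q 2 ^+ 3)%:P * 'X ^+ 18 + (nodal - (q 2 ^+ 3)%:P * 'X ^+ 18).
    by rewrite addrC subrK.
  have dX : deg_le 3 (- 'X ^+ 3 : {poly K}) by apply: deg_leW; first by deg_bound.
  have dG := deg_biquad g (deg_le1 _ 3 : deg_le 3 (1 : {poly K})) dX.
  rewrite size_polyDl size_Cmul ?size_polyXn ?expf_neq0//.
  set p := (X in size (polyseq X)); have : deg_le 17 p; last by [].
  have -> : p = ((q 0%N)%:P - (q 1%N)%:P * 'X ^+ 3) ^+ 3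
    + 3 * ((q 0%N)%:P - (q 1%N)%:P * 'X ^+ 3) ^+ 2 * (q 2)%:P * 'X ^+ 6
    + 3 * ((q 0%N)%:P - (q 1%N)%:P * 'X ^+ 3) * (q 2)%:P ^+ 2 * 'X ^+ 12
    - 27 * 'X ^+ 3 * biquad (polyC \o g) 1 (- 'X ^+ 3).
    rewrite /p /nodal; move: (biquad _ _ _) => d; rewrite /quad /= rmorphXn /=.
    by ring.
  move: (biquad _ _ _) dG => d dd.
  by apply: deg_leW; first by deg_bound.
by rewrite {1}Nrs size_scale// size_prod_XsubC => -[].
Qed.

End Coefficients.
End NormalCount.

(** * All lines meeting the given one, on a surface in normal form *)

Section NormalSurface.
Variable K : closedFieldType.
Hypotheses (nz2 : 2 != 0 :> K) (nz3 : 3 != 0 :> K).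
Variables (F : {mpoly K[4]}) (L : {vspace 'rV[K]_4}) (A : 'M[K]_4) (q g : nat -> K).
Notation c := (normal_quartic q g).
Hypotheses (AL : adapted A L) (fr : frame F A c) (smF : smooth_surface F) (L_on : line_on F L).

Let A' := A *m block4 0 1 1 0 0 1 1 0.
Let c' := normal_quartic (fun i => q (2 - i)%N) (fun i => g (4 - i)%N).
Let AL' : adapted A' L. Proof. by have [] := frame_swap AL fr. Qed.
Let fr' : frame F A' c'. Proof. by have [] := frame_swap AL fr. Qed.
Let sm := frame_smooth nz2 (proj1 AL) fr smF.
Let sm' := frame_smooth nz2 (proj1 AL') fr' smF.

Lemma pt_swap x y : pt A' x y 0 0 = pt A y x 0 0.
Proof.
have e : pt A y x 0 0 *m A' = row4 x y 0 0.
  by rewrite mulmxA pt_coord ?(proj1 AL)// row4_block4; congr row4; ring.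
rewrite [RHS](pt_of _ (proj1 AL')) e.
by have [-> -> -> ->] := row4_entry x y 0 0.
Qed.

Lemma no_line_through_both M : other_lines_meeting F L M ->
  pt A 1 0 0 0 \in M -> pt A 0 1 0 0 \in M -> False.
Proof.
move=> [[dM _] ML _] m1 m2; apply: ML; apply/eqP.
rewrite eq_sym -(geq_leqif (dimv_leqif_eq _)) ?dM ?(proj1 L_on)//.
apply/subvP => v /(proj2 AL)[v2 v3]; rewrite (pt_of v (proj1 AL)) v2 v3.
have -> : pt A ((v *m A) 0 0) ((v *m A) 0 1) 0 0 =
    (v *m A) 0 0 *: pt A 1 0 0 0 + (v *m A) 0 1 *: pt A 0 1 0 0.
  by rewrite pt_lin; congr (pt A); ring.
by apply: memvD; apply: memvZ.
Qed.

(** A line through (1 : 0 : 0 : 0) is counted at x = 0 in the swapped frame. In the sum of the three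
    bounds the contributions of q0 = 0 and q2 = 0 cancel. *)
Lemma normal_count (Ms : seq {vspace 'rV[K]_4}) : uniq Ms ->
  (forall M, M \in Ms -> other_lines_meeting F L M) ->
  (size Ms <= 18 + (g 0%N == 0)%R + (g 4 == 0)%R)%N.
Proof.
move=> uM hM; pose e1 (M : {vspace 'rV[K]_4}) := pt A 1 0 0 0 \in M.
have hM1 M : M \in [seq M <- Ms | e1 M] -> e1 M /\ other_lines_meeting F L M.
  by rewrite mem_filter => /andP[-> /hM].
have hM2 M : M \in [seq M <- Ms | predC e1 M] -> ~~ e1 M /\ other_lines_meeting F L M.
  by rewrite mem_filter => /andP[/= -> /hM].
have [||zs2 M2E hz2] := @lines_pairs _ nz2 F L A c AL fr smF L_on [seq M <- Ms | predC e1 M].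
- by move=> M /hM2[].
- by move=> M /hM2[].
have [||zs1 M1E hz1] := @lines_pairs _ nz2 F L A' c' AL' fr' smF L_on [seq M <- Ms | e1 M].
- by move=> M /hM1[].
- move=> M /hM1[m1 lM]; apply/negP; rewrite pt_swap => m2.
  exact: no_line_through_both lM m1 m2.
have u1 : uniq zs1 by apply: (@map_uniq _ _ (line_of A' c')); rewrite -M1E filter_uniq.
have u2 : uniq zs2 by apply: (@map_uniq _ _ (line_of A c)); rewrite -M2E filter_uniq.
have z10 z : z \in zs1 -> z.1 = 0.
  move=> zz; have /hM1[+ _] : line_of A' c' z \in [seq M <- Ms | e1 M] by rewrite M1E map_f.
  rewrite /e1 -pt_swap => /(line_of_meet nz2 AL' fr' smF).
  by rewrite mulr1.
have s1 : (size zs1 <= (g 4 == 0)%R + 3 * (q 2 == 0)%R)%N.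
  rewrite -(size_map snd); have := @lines_at_zero K nz2 (fun i => q (2 - i)%N) (fun i => g (4 - i)%N) [seq z.2 | z <- zs1]; apply.
    rewrite map_inj_in_uniq// => -[x n] [y m] /z10 /= -> /z10 /= -> -> //.
  by move=> n /mapP[[x m] zz ->]; have := hz1 _ zz; have /= -> := z10 _ zz.
pose P (z : K * K) := z.1 == 0.
have s0 : (size [seq z <- zs2 | P z] <= (g 0%N == 0)%R + 3 * (q 0%N == 0)%R)%N.
  rewrite -(size_map snd); apply: (lines_at_zero nz2).
    rewrite map_inj_in_uniq ?filter_uniq// => -[x n] [y m]; rewrite !mem_filter /P /=.
    by move=> /andP[/eqP-> _] /andP[/eqP-> _] ->.
  by move=> n /mapP[[x m]]; rewrite mem_filter /P /= => /andP[/eqP-> /hz2 zz] ->.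
have s2 : (size [seq z <- zs2 | predC P z] + 3 * (q 0%N == 0)%R + 3 * (q 2 == 0)%R <= 18)%N.
  apply: (lines_off_zero nz3 sm); first exact: filter_uniq.
  by move=> z; rewrite mem_filter /P /= => /andP[-> /hz2].
have : size Ms = (size zs1 + size [seq z <- zs2 | P z] + size [seq z <- zs2 | predC P z])%N.
  rewrite -(count_predC e1 Ms) -!size_filter M1E M2E !size_map -addnA; congr (_ + _)%N.
  by rewrite !size_filter count_predC.
move: s0 s1 s2; move: (size zs1) (size _) (size _) (size _) => a b d e.
case: (q 0%N == 0); case: (q 2%N == 0); case: (g 0%N == 0); case: (g 4%N == 0); clear; lia.
Qed.

(** Smoothness makes q0 and q2 nonzero, which gives 18 lines off the two ramification points. The
    pair (0, 0), read in the frame and in the swapped one, adds a line through each of them. *)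
Lemma normal_twenty : g 0%N = 0 -> g 4 = 0 ->
  exists Ms, [/\ uniq Ms, size Ms = 20%N & forall M, M \in Ms -> other_lines_meeting F L M].
Proof.
move=> g0 g4.
have q0 : q 0%N != 0 by apply/eqP => q0; exact: (normal_smooth0 sm q0 g0).
have q2 : q 2%N != 0 by apply/eqP => q2; exact: (normal_smooth0 sm' q2 g4).
have [xs [ux sx hx]] := nodal_eighteen nz3 sm q0 q2.
pose B x := quad q 1 (- x ^+ 3).
pose z x : K * K := (x, - (B x / (3 * x))).
have l0 : line_pair c (0, 0).
  by apply/line_pair_normal; rewrite /quad /biquad g0; split; ring.
have l0' : line_pair c' (0, 0).
  by apply/line_pair_normal; rewrite /quad /biquad /= g4; split; ring.
have lz y : y \in [seq z x | x <- xs] -> line_pair c y.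
  by move=> /mapP[x /hx[x0 Nx] ->]; exact: nodal_line_pair.
pose Ms := [seq line_of A c y | y <- (0, 0) :: [seq z x | x <- xs]].
have inj y y' : line_of A c y = line_of A c y' -> y.1 = y'.1.
  move=> e; have : pt A y.1 1 0 0 \in line_of A c y.
    by apply: (subvP (addvSl _ _)); exact: memv_line.
  by rewrite e => /(line_of_meet nz2 AL fr smF); rewrite mulr1.
exists (line_of A' c' (0, 0) :: Ms); split.
- rewrite cons_uniq; apply/andP; split.
    apply/mapP => -[y _ e].
    have : pt A 1 0 0 0 \in line_of A c y.
      by rewrite -e -pt_swap; apply: (subvP (addvSl _ _)); exact: memv_line.
    by move=> /(line_of_meet nz2 AL fr smF) /eqP; rewrite mulr0 oner_eq0.
  apply: (@map_uniq _ _ (fun M => M)); rewrite map_id /Ms map_inj_in_uniq.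
    rewrite cons_uniq map_inj_uniq ?ux ?andbT; last by move=> x y [].
    by apply/mapP => -[x /hx[x0 _] [e _]]; rewrite -e eqxx in x0.
  move=> y y' hy hy' /inj yy'.
  have sh w : w \in (0, 0) :: [seq z x | x <- xs] -> w = if w.1 == 0 then (0, 0) else z w.1.
    rewrite inE => /orP[/eqP->|/mapP[x /hx[x0 _] ->]] /=; first by rewrite eqxx.
    by rewrite (negbTE x0).
  by rewrite (sh _ hy) (sh _ hy') yy'.
- by rewrite /= !size_map sx.
move=> M; rewrite inE => /orP[/eqP->|/mapP[y]].
  exact: (line_of_line nz2 AL' fr' smF l0').
rewrite inE => /orP[/eqP->|/lz ly] ->; exact: (line_of_line nz2 AL fr smF).
Qed.

End NormalSurface.

(** * Cardinal inequalities through lists without repetition *)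

Section Cardinality.
Variables (T : eqType) (S : set T).

Lemma card_ge_seq n : (`I_n #<= S)%card ->
  exists s, [/\ uniq s, size s = n & forall x, x \in s -> S x].
Proof.
move=> /card_leP[f]; pose h (i : 'I_n) := set_val (f (SigSub (mem_set (ltn_ord i : `I_n i)))).
exists [seq h i | i <- enum 'I_n]; split.
- rewrite map_inj_uniq ?enum_uniq// => i j hij; apply: val_inj.
  by have /(congr1 \val) := @inj _ _ _ f _ _ (in_setT _) (in_setT _) (val_inj hij).
- by rewrite size_map size_enum_ord.
- by move=> x /mapP[i _ ->]; apply: set_valP.
Qed.

Lemma seq_card_le n s : (S #<= `I_n)%card -> uniq s -> (forall x, x \in s -> S x) -> (size s <= n)%N.
Proof.
move=> /card_leP[f] us sS.
(* The default n lies outside the target set, but [h] is only evaluated at members of S. *)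
pose h x := if boolp.pselect (S x) is left Sx then set_val (f (SigSub (mem_set Sx))) else n.
have hE x (Sx : S x) : h x = set_val (f (SigSub (mem_set Sx))).
  by rewrite /h; case: boolp.pselect => // Sx'; congr (set_val (f _)); exact: val_inj.
rewrite -(size_map h) -(size_iota 0 n); apply: uniq_leq_size.
  rewrite map_inj_in_uniq// => x y /sS Sx /sS Sy; rewrite (hE x Sx) (hE y Sy) => hxy.
  by have /(congr1 \val) := @inj _ _ _ f _ _ (in_setT _) (in_setT _) (val_inj hxy).
move=> i /mapP[x /sS Sx ->]; rewrite (hE x Sx) mem_iota /= add0n.
exact: (set_valP (f (SigSub (mem_set Sx)))).
Qed.

Lemma card_le_seqP n : (forall s, uniq s -> (forall x, x \in s -> S x) -> (size s <= n)%N) ->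
  (S #<= `I_n)%card.
Proof.
move=> h; have [/finite_setP[m Sm]|inf] := boolp.EM (finite_set S).
  have [Sle leS] := (card_eqPle _ _).1 Sm.
  have [s [us sm sS]] := card_ge_seq leS.
  by apply: card_le_trans Sle _; rewrite card_le_II -sm h.
have : (`I_n.+1 #<= S)%card.
  by move/infiniteP: inf; apply: card_le_trans; apply: subset_card_le.
by move=> /card_ge_seq[s [us sz sS]]; have := h s us sS; rewrite sz ltnn.
Qed.

Lemma seq_card_ge s : uniq s -> (forall x, x \in s -> S x) -> (`I_(size s) #<= S)%card.
Proof.
move=> us sS; have [/finite_setP[m Sm]|inf] := boolp.EM (finite_set S).
  have [Sle leS] := (card_eqPle _ _).1 Sm.
  by apply: card_le_trans _ leS; rewrite card_le_II (seq_card_le Sle).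
by move/infiniteP: inf; apply: card_le_trans; apply: subset_card_le.
Qed.
End Cardinality.

(** * Invariance under rescaling the equation *)

Section Scaling.
Variable K : closedFieldType.
Variables (F : {mpoly K[4]}) (a : K).
Hypothesis a0 : a != 0.

Lemma form_atZ v : form_at (a *: F) v = a * form_at F v.
Proof. by rewrite /form_at mevalZ. Qed.

Lemma form_atZ_eq0 v : form_at (a *: F) v = 0 <-> form_at F v = 0.
Proof.
rewrite form_atZ; split=> [/eqP|->]; last by rewrite mulr0.
by rewrite mulf_eq0 (negbTE a0) => /eqP.
Qed.

Lemma smooth_surfaceZ : smooth_surface F -> smooth_surface (a *: F).
Proof.
move=> sm v v0 /form_atZ_eq0/(sm v v0)[i hi]; exists i.
by rewrite mderivZ /form_at mevalZ mulf_neq0.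
Qed.

Lemma line_onZ L : line_on (a *: F) L <-> line_on F L.
Proof. by split=> -[dL h]; split=> // v /h /form_atZ_eq0. Qed.

Lemma other_lines_meetingZ L M :
  other_lines_meeting (a *: F) L M <-> other_lines_meeting F L M.
Proof. by split=> -[/line_onZ h1 h2 h3]. Qed.
End Scaling.

Lemma map_mpoly_homog n (R S : nzRingType) (f : {rmorphism R -> S}) d (p : {mpoly R[n]}) :
  p \is d.-homog -> map_mpoly f p \is d.-homog.
Proof.
move=> hp; apply/dhomogP => m; rewrite mcoeff_msupp mcoeff_map_mpoly => fm.
apply: (dhomog_mf hp); rewrite mcoeff_msupp; apply: contraNneq fm => ->.
by apply/eqP; exact: (rmorph0 f).
Qed.

(** * Frames and the normal form of the statement *)

Section NormalForm.
Variable K : closedFieldType.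
Variables (F : {mpoly K[4]}) (L : {vspace 'rV[K]_4}).

Lemma has_normal_form_of_frame A q g : adapted A L -> frame F A (normal_quartic q g) -> g 4%N = 0 ->
  has_normal_form F L (quad_mpoly q) (cubic_mpoly g).
Proof.
move=> [Au LA] fr g4; exists A, 1; split=> //; first exact: oner_neq0.
by rewrite scale1r normal_form_comp [LHS]fr /quart /biquad /= g4.
Qed.

Lemma frame_of_has_normal_form q g : has_normal_form F L (quad_mpoly q) (cubic_mpoly g) ->
  exists A a, [/\ a != 0, adapted A L & frame (a *: F) A (normal_quartic q (mul_x3 g))].
Proof.
move=> [A [a [Au a0 FE LA]]]; exists A, a^-1; split=> //; first by rewrite invr_eq0.
by rewrite /frame FE scalerA mulVf// scale1r normal_form_comp.
Qed.

(** Evaluation at (1, 0) isolates the coefficient of x3^3, the only cubic monomial that x4 does not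
    divide. *)
Lemma dvd_x4P (g : nat -> K) :
  (exists h, cubic_mpoly g = 'X_(1 : 'I_2) * h) <-> g 0%N = 0.
Proof.
split=> [[h gE]|g0].
  have := congr1 (fun p : {mpoly K[2]} => p.@[fun i => nth 0 [:: 1; 0] i]) gE.
  rewrite mevalM mevalXU /= mul0r /cubic_mpoly => <-.
  rewrite rmorph_cubic /= !mevalXU /cubic /= !mevalC; ring.
exists (quad (@mpolyC 2 K \o (fun i => g i.+1)) 'X_0 'X_1).
by rewrite /cubic_mpoly /cubic /quad /= g0 mpolyC0; ring.
Qed.
End NormalForm.

Theorem proposition1p1 (k : fieldType) (K : closedFieldType)
  (iota : {rmorphism k -> K})
  (K_algebraic : forall x : K, algebraicOver iota x)
  (char_not2 : 2%N \notin [pchar k]) (char_not3 : 3%N \notin [pchar k])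
  (f : {mpoly k[4]}) (f_neq0 : f != 0) (f_quartic : f \is 4.-homog)
  (f_smooth : geometrically_smooth iota f)
  (L : {vspace 'rV[K]_4}) (L_on : line_on (map_mpoly iota f) L) :
  let S := map_mpoly iota f in
  [/\ (other_lines_meeting S L #<= `I_20)%card,
      (`I_19 #<= other_lines_meeting S L)%card ->
        exists q g : {mpoly K[2]},
          [/\ q \is 2.-homog, g \is 3.-homog & has_normal_form S L q g]
    & forall q g : {mpoly K[2]},
        q \is 2.-homog -> g \is 3.-homog -> has_normal_form S L q g ->
        ((other_lines_meeting S L #= `I_20)%card <->
         exists h : {mpoly K[2]}, g = 'X_(1 : 'I_2) * h)].
Proof.
move=> S.
have nz n : prime n -> n \notin [pchar k] -> n%:R != 0 :> K.
  move=> pn; rewrite inE pn /=; apply: contraNneq => n0.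
  by rewrite -(fmorph_eq0 iota) rmorph_nat n0.
have nz2 : 2 != 0 :> K by apply: nz.
have nz3 : 3 != 0 :> K by apply: nz.
have hS : S \is 4.-homog by apply: map_mpoly_homog.
have normal Ms : uniq Ms -> (forall M, M \in Ms -> other_lines_meeting S L M) ->
    (18 < size Ms)%N -> exists A q g, adapted A L /\ frame S A (normal_quartic q g).
  move=> uM hM sM.
  have [A [c [AL fr mc R0]]] := special_frame nz2 nz3 hS f_smooth L_on uM hM sM.
  by have [A' [q [g [AL' fr']]]] := complete_cubes nz2 nz3 AL fr mc R0; exists A', q, g.
have max20 : (other_lines_meeting S L #<= `I_20)%card.
  apply: card_le_seqP => Ms uM hM; have [//|/(normal Ms uM hM)[A [q [g [AL fr]]]]] := leqP (size Ms) 18.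
    by move=> /leq_trans; apply.
  apply: leq_trans (normal_count nz2 nz3 AL fr f_smooth L_on uM hM) _.
  by case: (g 0%N == 0); case: (g 4%N == 0).
split=> //.
- move=> /card_ge_seq[Ms [uM sM hM]].
  have [|A [q [g [AL fr]]]] := normal Ms uM hM; first by rewrite sM.
  (* Nineteen lines force [g 0 = 0] or [g 4 = 0]; the swap reduces the former to the latter. *)
  have := normal_count nz2 nz3 AL fr f_smooth L_on uM hM; rewrite sM => g04.
  have [g4|g4] := eqVneq (g 4%N) 0.
    exists (quad_mpoly q), (cubic_mpoly g); split; [exact: quad_homog|exact: cubic_homog|].
    exact: has_normal_form_of_frame AL fr g4.
  have g0 : g 0%N = 0 by apply/eqP; move: g04; rewrite (negbTE g4); case: eqP.
  have [AL' fr'] := frame_swap AL fr.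
  exists (quad_mpoly (fun i => q (2 - i)%N)), (cubic_mpoly (fun i => g (4 - i)%N)).
  split; [exact: quad_homog|exact: cubic_homog|].
  exact: has_normal_form_of_frame AL' fr' g0.
move=> q g /homog2_quad[q0 ->] /homog3_cubic[g0 ->] /frame_of_has_normal_form[A [a [a0 AL fr]]].
have smS := smooth_surfaceZ a0 f_smooth.
have LS : line_on (a *: S) L by apply/(line_onZ _ a0).
rewrite dvd_x4P; split=> [/card_eqPle[_ /card_ge_seq[Ms [uM sM hM]]]|g00].
  have hMa M : M \in Ms -> other_lines_meeting (a *: S) L M.
    by move/hM; apply: (other_lines_meetingZ _ a0 _ _).2.
  (* [mul_x3] has last entry 0, so the bound is 19, plus one only if [g0 0 = 0]. *)
  by have := normal_count nz2 nz3 AL fr smS LS uM hMa; rewrite sM /= eqxx; case: eqP.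
have [Ms [uM sM hM]] := normal_twenty nz2 nz3 AL fr smS g00 erefl.
apply/card_eqPle; split=> //; rewrite -sM; apply: seq_card_ge => // M /hM.
by move/(other_lines_meetingZ _ a0).
Qed.
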